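(* Let $M$ be a saturated nonstandard model of the superstructure $\mathcal{S}$ over $\mathbf{R}$ and let $\varepsilon\in{}^*\mathbf{R}_M$ be a positive infinitesimal. Then the asymptotic space $\mathcal{H}_{0,M}$ of the Lobachevsky plane, which coincides up to isometry with $\mathcal{F}_M$, is an $\mathbf{R}$-tree.
   Context: Models. Let $S_0=\mathbf{R}$ (treated as individuals), $S_{i+1}=S_i\cup\mathcal{P}(S_i)$ and $\mathcal{S}=\bigcup_{i}S_i$ (the superstructure). Consider bounded first-order formulas (every variable ranges over some entity, i.e. over some element of $\mathcal{S}\setminus S_0$) in the language with $=$, $\in$ and a constant for each element of $\mathcal{S}$. A nonstandard model $M$ of $\mathcal{S}$ is a structure containing $\mathcal{S}$ via an injection $x\mapsto{}^*x$, with relations extending $=$ and $\in$, in which exactly the bounded sentences true in $\mathcal{S}$ are true (transfer), and such that ${}^*\mathbf{R}$ is a proper extension of $\mathbf{R}$. A number $a\in{}^*\mathbf{R}$ is finite if $|a|<K$ for some $K\in\mathbf{R}$; its standard part $\operatorname{st}(a)\in\mathbf{R}$ is the unique real infinitely close to $a$. Saturation. A set $T$ of (bounded) formulas $R(x,c)$ with one free variable $x$ and parameters $c$ from $M$ is finitely satisfiable if for every finite subset of $T$ there is an $x\in M$ satisfying all formulas in this subset. $M$ is $\kappa$-saturated if for every finitely satisfiable $T$ with $|T|<\kappa$ there is an $x\in M$ satisfying all formulas of $T$. $M$ is saturated if it is $\kappa$-saturated for $\kappa$ equal to the cardinality of (the underlying set of) $M$. Tree. A metric space is an $\mathbf{R}$-tree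 if for every two points $x,y$ there is a unique geodesic segment $[x,y]$ (isometric image of a real interval) joining $x$ and $y$, and whenever two geodesic segments $[x,y]$ and $[y,z]$ have only the point $y$ in common, their union is a geodesic segment $[x,z]$. Asymptotic space. The Lobachevsky plane $\mathcal{H}=(H,d)$ (curvature $-1$) is described in polar coordinates $(\rho,\varphi)$, $\rho\ge0$ (the distance to the origin), $\varphi\in S^1$, by $\cosh d(x_1,x_2)=\cosh\rho_1\cosh\rho_2-\sinh\rho_1\sinh\rho_2\cos(\varphi_1-\varphi_2)$. Its nonstandard extension is $({}^*H,{}^*d)$. Let $Y=\{(\rho,\varphi)\in{}^*H:\varepsilon\rho\text{ is finite}\}$. The asymptotic space $\mathcal{H}_{0,M}$ is the metric space $Y/{\approx}$ with distance $\operatorname{st}(\varepsilon\cdot{}^*d(x,y))$, where $x\approx y$ iff $\varepsilon\cdot{}^*d(x,y)$ is infinitesimal. The space $\mathcal{F}_M$. Fix a well-ordering $\prec$ of ${}^*\mathbf{R}$ given by a bijection with the least ordinal of cardinality $|{}^*\mathbf{R}|$. For nonzero $x,y\in{}^*\mathbf{R}$ write $x\sim y$ if both $x/y$ and $y/x$ are finite. Let $\Lambda=({}^*\mathbf{R}\setminus\{0\})/{\sim}$, let $\lambda(x)$ be the class of $x$, and order $\Lambda$ by: $\lambda(x)<\lambda(y)$ iff $\lambda(x)\ne\lambda(y)$ and $|x|<|y|$. Let $\lambda^0=\lambda(1)$, $a_{\lambda^0}=1$, and for $\lambda\neq\lambda^0$ let $a_\lambda$ be the $\prec$-minimal element of $\lambda$.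 For $\lambda\le\lambda^0$ let $g(\lambda)=\operatorname{st}(-\varepsilon\log|a_\lambda|)\in[0,\infty]$ ($+\infty$ if $-\varepsilon\log|a_\lambda|$ is infinite). Consider pairs $(f,\lambda_1)$ where $\lambda_1\in\Lambda$, $\lambda_1\le\lambda^0$, $g(\lambda_1)<\infty$, and $f$ is a function on $\{\lambda\in\Lambda:\lambda_1\le\lambda\le\lambda^0\}$ with $f(\lambda^0)\in S^1=\mathbf{R}/2\pi\mathbf{Z}$, $f(\lambda)\in\mathbf{R}$ for $\lambda<\lambda^0$, and $f(\lambda)=0$ outside a set $\Sigma_f$ that is well ordered with respect to the reverse of the order of $\Lambda$ and satisfies $|\Sigma_f|<|{}^*\mathbf{R}|$. Put $$\delta((f_1,\lambda_1),(f_2,\lambda_2))=(g(\lambda_1)-\tilde g)+(g(\lambda_2)-\tilde g),$$ $$\tilde g=\sup\{h\in\mathbf{R}: f_1(\lambda)=f_2(\lambda)\text{ for all }\lambda\le\lambda^0\text{ such that }g(\lambda)<h\},$$ where ''$f_1(\lambda)=f_2(\lambda)$'' means that both are defined at $\lambda$ and equal. $\mathcal{F}_M$ is the metric space obtained from the set of these pairs with $\delta$ by identifying pairs at $\delta$-distance $0$. *)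

(* Defs.v *)
From HB Require Import structures.
From mathcomp Require Import all_boot all_order all_algebra.
From mathcomp Require Import all_classical all_reals all_analysis.
From mathcomp Require wochoice.
Set Implicit Arguments.
Unset Strict Implicit.
Unset Printing Implicit Defensive.
Import Order.TTheory GRing.Theory Num.Theory.
Local Open Scope classical_set_scope.
Local Open Scope ring_scope.

(* Hilbert choice, with default value x0 when P is empty *)
Definition the {T : Type} (x0 : T) (P : set T) : T :=
  if pselect (exists x, P x) is left e then sval (cid e) else x0.

(* D / E, the quotient of a subset D of T, as a set of classes *)
Definition quot {T : Type} (D : set T) (E : T -> T -> Prop) :=
  {A : set T | exists2 x, D x & A = [set y | D y /\ E x y]}.

Definition class {T : Type} (D : set T) (E : T -> T -> Prop) (x : T)
    (Dx : D x) : quot D E :=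
  exist _ [set y | D y /\ E x y] (ex_intro2 _ _ x Dx erefl).

(* The function induced by delta on D / E; meaningful when delta is constant
   on pairs of classes. *)
Definition quot_dist {R : realType} {T : Type} (D : set T)
    (E : T -> T -> Prop) (delta : T -> T -> R) (A B : quot D E) : R :=
  the 0 [set r | exists x y, [/\ sval A x, sval B y & r = delta x y]].

Definition card_lt {T U : Type} (A : set T) (B : set U) : Prop :=
  card_le A B /\ ~ card_le B A.

Section metric.
Variables (R : realType).

(* the axioms of the factory isMetric, as a predicate *)
Definition is_metric {T : Type} (d : T -> T -> R) : Prop :=
  [/\ forall x, d x x = 0,
      forall x y, d x y = 0 -> x = y,
      forall x y, d x y = d y x &
      forall y x z, d x z <= d x y + d y z].

Definition isometric {T U : Type} (d : T -> T -> R) (e : U -> U -> R) : Prop :=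
  exists2 f : T -> U, bijective f & forall x y, e (f x) (f y) = d x y.

Definition geodesic_segment {T : Type} (d : T -> T -> R) (x y : T)
    (S : set T) : Prop :=
  exists (a b : R) (c : R -> T),
    [/\ a <= b, c a = x, c b = y, S = c @` `[a, b] &
        {in `[a, b] &, forall s t, d (c s) (c t) = `|s - t|}].

Definition R_tree {T : Type} (d : T -> T -> R) : Prop :=
  [/\ is_metric d,
      forall x y, exists! S, geodesic_segment d x y S &
      forall x y z S1 S2,
        geodesic_segment d x y S1 -> geodesic_segment d y z S2 ->
        S1 `&` S2 = [set y] -> geodesic_segment d x z (S1 `|` S2)].

End metric.

Section superstructure.
Variable R : realType.

(* Since S_i is contained in the union of S_0 and P(S_(i-1)), the set S_(i+1)
   is also the union of S_0 and P(S_i); [lev i] represents S_i in this way. A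
   set of S_i is represented at each later level too; [lev_eq] is equality of
   the represented individuals or sets. *)
Fixpoint lev (i : nat) : Type :=
  if i is j.+1 then (R + set (lev j))%type else R.

Fixpoint lev_eq (i j : nat) {struct i} : lev i -> lev j -> Prop :=
  match i, j return lev i -> lev j -> Prop with
  | 0, 0 => fun x y => x = y
  | 0, j'.+1 => fun x y => if y is inl s then x = s else False
  | i'.+1, 0 => fun x y => if x is inl r then r = y else False
  | i'.+1, j'.+1 => fun x y =>
      match x, y with
      | inl r, inl s => r = s
      | inr A, inr B =>
          (forall a, A a -> exists2 b, B b & lev_eq a b) /\
          (forall b, B b -> exists2 a, A a & lev_eq a b)
      | _, _ => False
      end
  end.

Definition code := {i : nat & lev i}.

Definition code_eq (x y : code) : Prop := lev_eq (projT2 x) (projT2 y).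

Definition code_mem (x y : code) : Prop :=
  match y with
  | existT j.+1 (inr A) => exists2 a, A a & code_eq x (existT lev j a)
  | _ => False
  end.

Definition SS := quot [set: code] code_eq.

Definition inj_lev (i : nat) (x : lev i) : SS :=
  @class code setT code_eq (existT lev i x) I.

Definition ind (r : R) : SS := @inj_lev 0 r.

(* the subset A of S_i, as an entity *)
Definition ent (i : nat) (A : set (lev i)) : SS := @inj_lev i.+1 (inr A).

(* the entity S_i *)
Definition stage (i : nat) : SS := @ent i setT.

Definition memSS (X Y : SS) : Prop :=
  exists x y, [/\ sval X x, sval Y y & code_mem x y].

Definition is_entity (a : SS) : Prop := forall r, a <> ind r.

(* Terms and bounded formulas with free variables in X and parameters in P;
   besides the parameters, there is a constant for each element of SS. A
   quantifier adds the variable [None] to the variables [Some x], x in X. *)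
Inductive term (P X : Type) :=
  | Var of X
  | Par of P
  | Cst of SS.

Inductive formula (P X : Type) : Type :=
  | Eq of term P X & term P X
  | Mem of term P X & term P X
  | Neg of formula P X
  | And of formula P X & formula P X
  | Or of formula P X & formula P X
  | Imp of formula P X & formula P X
  | All (a : SS) of is_entity a & formula P (option X)
  | Ex (a : SS) of is_entity a & formula P (option X).

(* [=] is interpreted as equality. *)
Record structure := Structure {
  dom :> Type;
  mem_in : dom -> dom -> Prop;
  star : SS -> dom }.

Definition std : structure := @Structure SS memSS id.

Section semantics.
Variable S : structure.

Definition eval {P X : Type} (p : P -> S) (v : X -> S) (t : term P X) : S :=
  match t with Var x => v x | Par c => p c | Cst a => star S a end.

Definition extend {X : Type} (v : X -> S) (d : S) (o : option X) : S :=
  if o is Some x then v x else d.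

Fixpoint sat {P X : Type} (p : P -> S) (v : X -> S) (phi : formula P X)
    {struct phi} : Prop :=
  match phi with
  | Eq t u => eval p v t = eval p v u
  | Mem t u => mem_in (eval p v t) (eval p v u)
  | Neg f => ~ sat p v f
  | And f g => sat p v f /\ sat p v g
  | Or f g => sat p v f \/ sat p v g
  | Imp f g => sat p v f -> sat p v g
  | All a _ f => forall d, mem_in d (star S a) -> sat p (extend v d) f
  | Ex a _ f => exists d, mem_in d (star S a) /\ sat p (extend v d) f
  end.

Definition holds (phi : formula void void) : Prop :=
  sat (of_void S) (of_void S) phi.

Definition satisfies (x : S) (phi : formula S unit) : Prop :=
  sat id (fun=> x) phi.

Definition finitely_satisfiable (T : set (formula S unit)) : Prop :=
  forall F, F `<=` T -> finite_set F -> exists x, forall phi, F phi ->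
    satisfies x phi.

(* kappa-saturation, kappa being the cardinality of the type K *)
Definition saturated_at (K : Type) : Prop :=
  forall T : set (formula S unit), card_lt T [set: K] ->
    finitely_satisfiable T -> exists x, forall phi, T phi -> satisfies x phi.

Definition saturated : Prop := saturated_at S.

(* Kuratowski pairs and tuples (x1, (x2, (.., xn))) of elements of S_0. All
   quantifiers are bounded: [is_dbl k w x y] says that w is {x, y} for w in
   S_(k+1) and x, y in S_k, and [is_pair k p x y] that p is (x, y) for p in
   S_(k+2) and x, y in S_k. *)
Definition is_dbl (k : nat) (w x y : S) : Prop :=
  forall t, mem_in t (star S (stage k)) -> (mem_in t w <-> t = x \/ t = y).

Definition is_pair (k : nat) (p x y : S) : Prop :=
  forall w, mem_in w (star S (stage k.+1)) ->
    (mem_in w p <-> is_dbl k w x x \/ is_dbl k w x y).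

(* z in S_(2(n-1)) is the tuple of the n entries of xs *)
Fixpoint is_tuple (z : S) (xs : seq S) : Prop :=
  match xs with
  | [::] => False
  | x :: ys =>
      if ys is [::] then z = x else
        let k := ((size ys).-1).*2 in
        exists t, [/\ mem_in t (star S (stage k)), is_tuple t ys &
                      is_pair k z x t]
  end.

End semantics.

(* the n-ary relation P on R, as an entity *)
Definition rel_ent (n : nat) (P : seq R -> Prop) : SS :=
  @ent (n.-1).*2 [set z | exists s,
    [/\ size s = n, P s & is_tuple (inj_lev z : std) (map ind s)]].

Record nonstandard_model := NonstandardModel {
  model :> structure;
  star_inj : injective (star model);
  star_mem : forall a b, mem_in (star model a) (star model b) <-> memSS a b;
  transfer : forall phi, holds std phi <-> holds model phi;
  star_proper : exists2 x, mem_in x (star model (stage 0)) &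
    forall r, x <> star model (ind r) }.

Lemma lev_eq_refl i (x : lev i) : lev_eq x x.
Proof.
elim: i x => [//|i IH] [//|A] /=.
by split=> a Aa; exists a => //; apply: IH.
Qed.

Lemma ind_stage0 r : memSS (ind r) (stage 0).
Proof.
exists (existT lev 0%N r), (existT lev 1%N (inr setT)).
by split; [split=> //; apply: lev_eq_refl.. | exists r].
Qed.

Lemma ind_inj : injective ind.
Proof.
move=> r s /(congr1 sval) rs.
by have [] : sval (ind r) (existT lev 0%N s) by rewrite rs.
Qed.

Section hyperreal.
Variable M : nonstandard_model.

Definition hyper := {x : M | mem_in x (star M (stage 0))}.

Definition hreal (r : R) : hyper :=
  exist _ (star M (ind r)) (proj2 (star_mem M _ _) (ind_stage0 r)).

Lemma hreal_inj : injective hreal.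
Proof. by move=> r s /(congr1 sval) /(@star_inj M) /ind_inj. Qed.

(* nonstandard extensions of a relation between real numbers, and of a
   function of several real variables (through its graph) *)
Definition hrel (P : seq R -> Prop) (xs : seq hyper) : Prop :=
  exists2 z, mem_in z (star M (rel_ent (size xs) P)) &
             is_tuple z (map sval xs).

Definition hfun (f : seq R -> R) (xs : seq hyper) : hyper :=
  the (hreal 0) [set z | hrel (fun s => head 0 s = f (behead s)) (z :: xs)].

Definition hfun1 (f : R -> R) (x : hyper) : hyper :=
  hfun (fun s => f s`_0) [:: x].

Definition hfun2 (f : R -> R -> R) (x y : hyper) : hyper :=
  hfun (fun s => f s`_0 s`_1) [:: x; y].

Definition hopp := hfun1 -%R.
Definition habs := hfun1 Num.norm.
Definition hln := hfun1 (@ln R).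
Definition hadd := hfun2 +%R.
Definition hmul := hfun2 *%R.
Definition hdiv := hfun2 (fun x y => x / y).
Definition hlt (x y : hyper) : Prop :=
  hrel (fun s => s`_0 < s`_1) [:: x; y].

Definition hfinite (a : hyper) : Prop := exists K : R, hlt (habs a) (hreal K).

Definition infinitesimal (a : hyper) : Prop :=
  forall r : R, 0 < r -> hlt (habs a) (hreal r).

Definition st (a : hyper) : R :=
  the 0 [set r | infinitesimal (hadd a (hopp (hreal r)))].

(* a well-order (in reflexive form) of order type the least ordinal of
   cardinality |*R|, i.e. whose proper initial segments have a smaller
   cardinality *)
Definition initial_well_order (prec : rel hyper) : Prop :=
  wochoice.well_order prec /\
  forall x, card_lt [set y | prec y x /\ y <> x] [set: hyper].

Definition cosh (x : R) : R := (expR x + expR (- x)) / 2.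
Definition sinh (x : R) : R := (expR x - expR (- x)) / 2.

(* In polar coordinates, an angle being represented by its element of
   [0, 2 pi[. The origin has all the coordinates (0, phi), at distance 0 from
   each other; these are identified by the relation [approx] below. *)
Definition H_coord (s : seq R) : Prop :=
  0 <= s`_0 /\ 0 <= s`_1 < 2 * pi.

Definition H_dist (s : seq R) : R :=
  let: (rho1, phi1, rho2, phi2) := (s`_0, s`_1, s`_2, s`_3) in
  the 0 [set d | 0 <= d /\
    cosh d = cosh rho1 * cosh rho2 - sinh rho1 * sinh rho2 * cos (phi1 - phi2)].

Variable eps : hyper.

Definition Y : set (hyper * hyper) :=
  [set x | hrel H_coord [:: x.1; x.2] /\ hfinite (hmul eps x.1)].

Definition eps_dist (x y : hyper * hyper) : hyper :=
  hmul eps (hfun H_dist [:: x.1; x.2; y.1; y.2]).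

Definition approx (x y : hyper * hyper) : Prop := infinitesimal (eps_dist x y).

Definition H0 := quot Y approx.

Definition H0_dist : H0 -> H0 -> R := quot_dist (fun x y => st (eps_dist x y)).

Definition nonzero : set hyper := [set x | x <> hreal 0].

Definition sim (x y : hyper) : Prop :=
  hfinite (hdiv x y) /\ hfinite (hdiv y x).

Definition Lambda := quot nonzero sim.

Lemma nonzero1 : nonzero (hreal 1).
Proof. by move=> /hreal_inj /eqP; rewrite oner_eq0. Qed.

Definition lambda0 : Lambda := class sim nonzero1.

Definition lt_Lambda (l m : Lambda) : Prop :=
  l <> m /\ exists x y, [/\ sval l x, sval m y & hlt (habs x) (habs y)].

Definition le_Lambda (l m : Lambda) : Prop := l = m \/ lt_Lambda l m.

Variable prec : rel hyper.

Definition repr (l : Lambda) : hyper :=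
  if pselect (l = lambda0) then hreal 1
  else the (hreal 1) [set x | sval l x /\ forall y, sval l y -> prec x y].

Definition g (l : Lambda) : \bar R :=
  let v := hopp (hmul eps (hln (habs (repr l)))) in
  if pselect (hfinite v) then (st v)%:E else +oo%E.

Definition rev_well_ordered (Sigma : set Lambda) : Prop :=
  wochoice.wo_chain (fun l m => `[< le_Lambda m l >]) (mem Sigma).

(* A pair (f, lambda1); f is a partial function, equal to [None] outside its
   domain, and f(lambda0), an element of R / 2 pi Z, is represented by its
   element of [0, 2 pi[. *)
Definition is_branch (b : (Lambda -> option R) * Lambda) : Prop :=
  let: (f, l1) := b in
  [/\ le_Lambda l1 lambda0,
      (g l1 < +oo)%E,
      forall l, f l <> None <-> le_Lambda l1 l /\ le_Lambda l lambda0,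
      forall t, f lambda0 = Some t -> 0 <= t < 2 * pi &
      exists Sigma : set Lambda,
        [/\ rev_well_ordered Sigma,
            card_lt Sigma [set: hyper] &
            forall l t, f l = Some t -> ~ Sigma l -> t = 0]].

Definition branch_meet (f1 f2 : Lambda -> option R) : R :=
  sup [set h : R | forall l, le_Lambda l lambda0 -> (g l < h%:E)%E ->
    exists2 t, f1 l = Some t & f2 l = Some t].

Definition branch_dist (b1 b2 : (Lambda -> option R) * Lambda) : R :=
  let: (f1, l1) := b1 in
  let: (f2, l2) := b2 in
  (fine (g l1) - branch_meet f1 f2) + (fine (g l2) - branch_meet f1 f2).

Definition FM := quot is_branch (fun b1 b2 => branch_dist b1 b2 = 0).

Definition FM_dist : FM -> FM -> R := quot_dist branch_dist.

End hyperreal.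
End superstructure.

(* Main.v *)
(* Tree.  If [w] is the absolute value of the sine of half the angle between two
   points at distances [a] and [b] from the origin and [mu] is the largest of [exp (- a)],
   [exp (- b)] and [w], then the distance of the points is
   [a + b + 2 ln mu] up to an error of at most 2.  Hence, after multiplication by
   [eps] and passage to standard parts, it is [r x + r y - 2 G x y], where [r] is
   the distance to the origin and the Gromov product [G x y = st (- eps ln mu)]
   satisfies the ultrametric inequality because [w] is subadditive in the angle.
   Such a distance is a tree metric by the four-point condition.

   Isometry.  An angle is, modulo 2 pi, a real number [theta] plus an
   infinitesimal [u].  For an order of magnitude [l], let [m_l u] be the
   prec-least element of the ball of all [y] with [y - u = O(a_l)]; the
   coefficient of [u] at [l] is the standard part of [(u - m_l u) / a_l].  The
   largest [l] at which the coefficients of [u] and [v] differ is the order of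
   magnitude of [u - v].  The support of the coefficients is well ordered and
   small, since [l |-> m_l u] reverses the orders on it and takes its values
   strictly below [u] for [prec].  Conversely, a family of coefficients with such
   a support is realized by well-founded induction on the support: at a limit,
   saturation provides a point in the intersection of the balls around the
   approximations built so far, and the prec-least such point has no further
   coefficients.

   Both parts use transfer through one mechanism: the internal extension [hrel]
   of the relations between real numbers commutes with Boolean operations,
   quantifiers and substitutions, so that hyperreal numbers can be handled as
   germs [hfun F xs] of real functions [F] at a fixed list [xs]. *)
Require Import Defs.
From HB Require Import structures.
From mathcomp Require Import all_boot all_order all_algebra.
From mathcomp Require Import all_classical all_reals all_analysis.
From mathcomp Require Import lra ring.
Set Implicit Arguments.
Unset Strict Implicit.
Unset Printing Implicit Defensive.
Import Order.TTheory GRing.Theory Num.Theory numFieldNormedType.Exports.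
Local Open Scope classical_set_scope.
Local Open Scope ring_scope.

(** * Transfer of first-order statements about real numbers *)

Section standard.
Variable R : realType.

Lemma lev_eq_sym i j (x : lev R i) (y : lev R j) : lev_eq x y -> lev_eq y x.
Proof.
elim: i j x y => [|i IH] [|j] //=; [by move=> x [r|A]|by move=> [r|A]|].
move=> [r|A] [s|B] //= [AB BA]; split=> [b Bb|a Aa].
  by have [a Aa /IH] := BA _ Bb; exists a.
by have [b Bb /IH] := AB _ Aa; exists b.
Qed.

Lemma lev_eq_trans i j k (x : lev R i) (y : lev R j) (z : lev R k) :
  lev_eq x y -> lev_eq y z -> lev_eq x z.
Proof.
elim: i j k x y z => [|i IH] [|j] [|k] /=.
- by move=> x y z ->.
- by move=> x y [r|A] // ->.
- by move=> x [r|A] //= z ->.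
- by move=> x [r|A] //= [s|B] // ->.
- by move=> [r|A] //= y z ->.
- by move=> [r|A] //= y [s|B] // ->.
- by move=> [r|A] [s|B] //= z ->.
move=> [r|A] [s|B] [t|C] //= => [-> //|[AB BA] [BC CB]]; split=> [a Aa|c Cc].
  by have [b Bb ab] := AB _ Aa; have [c Cc bc] := BC _ Bb; exists c; last exact: IH ab bc.
by have [b Bb bc] := CB _ Cc; have [a Aa ab] := BA _ Bb; exists a; last exact: IH ab bc.
Qed.

Lemma inj_lev_eq i j (x : lev R i) (y : lev R j) :
  inj_lev x = inj_lev y <-> lev_eq x y.
Proof.
split=> [/(congr1 sval) xy|xy].
  suff [] : sval (inj_lev x) (existT _ j y) by [].
  by rewrite xy; split=> //; apply: lev_eq_refl.
apply: eq_exist; apply/seteqP; split=> -[k z] [_ /= xz]; split=> //.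
  exact: lev_eq_trans (lev_eq_sym xy) xz.
exact: lev_eq_trans xy xz.
Qed.

Lemma inj_lev_surj (X : SS R) : exists i (x : lev R i), X = inj_lev x.
Proof. by case: X => A pA; have [[i x] _ eA] := pA; exists i, x; apply: eq_exist. Qed.

(** Membership is defined through arbitrary codes of possibly different levels. Equality of coded
    sets is mutual inclusion up to [lev_eq], so every code of the entity gives the same elements as
    [A]. *)
Lemma memSS_ent i (A : set (lev R i)) X :
  memSS X (ent A) <-> exists2 a, A a & X = inj_lev a.
Proof.
have [i0 [x0 ->]] := inj_lev_surj X; split=> [|[a Aa eX]].
  case=> -[k x] [] -[[|j] y] [] [_ /= x0x] [_ /= Ay] //.
  case: y Ay => // B [AB BA] [b Bb xb].
  have [a Aa ab] := BA _ Bb; exists a => //; apply/inj_lev_eq.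
  exact: lev_eq_trans x0x (lev_eq_trans xb (lev_eq_sym ab)).
rewrite eX; exists (existT _ i a), (existT _ i.+1 (inr A)).
by split; [split=> //; exact: lev_eq_refl..|exists a => //; exact: lev_eq_refl].
Qed.

Lemma memSS_stage k (X : SS R) :
  memSS X (stage R k) <-> exists x : lev R k, X = inj_lev x.
Proof. by rewrite memSS_ent; split=> [[a _ ->]|[a ->]]; exists a. Qed.

Lemma ind_stage k r : memSS (ind r) (stage R k).
Proof.
apply/memSS_stage; case: k => [|k]; first by exists r.
by exists (inl r); apply/inj_lev_eq.
Qed.

Lemma is_entity_ent i (A : set (lev R i)) : is_entity (ent A).
Proof. by move=> r /inj_lev_eq. Qed.

Notation std := (std R).

Lemma is_dbl_exists k (x y : std) :
  exists2 w : std, memSS w (stage R k.+1) & is_dbl k w x y.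
Proof.
exists (ent [set a : lev R k | inj_lev a = x \/ inj_lev a = y]).
  by apply/memSS_stage; eexists.
move=> t /memSS_stage[a ->].
by split=> [/memSS_ent[b bxy ->]//|axy]; apply/memSS_ent; exists a.
Qed.

Lemma is_pair_exists k (x y : std) :
  exists2 p : std, memSS p (stage R k.+2) & is_pair k p x y.
Proof.
exists (ent [set a : lev R k.+1 |
    is_dbl (S := std) k (inj_lev a) x x \/ is_dbl (S := std) k (inj_lev a) x y]).
  by apply/memSS_stage; eexists.
move=> t /memSS_stage[a ->].
by split=> [/memSS_ent[b bxy ->]//|axy]; apply/memSS_ent; exists a.
Qed.

(** Injectivity of Kuratowski pairs. The components are taken in stage [k] because [is_dbl] tests
    only elements of that stage. *)
Lemma is_pair_inj k (p x y x' y' : std) :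
    memSS x (stage R k) -> memSS y (stage R k) ->
    memSS x' (stage R k) -> memSS y' (stage R k) ->
  is_pair k p x y -> is_pair k p x' y' -> x = x' /\ y = y'.
Proof.
move=> kx ky kx' ky' pxy pxy'.
have xx' : x = x'.
  have [w kw wxx] := is_dbl_exists k x x.
  have /(pxy' _ kw) : memSS w p by apply/(pxy _ kw); left.
  have wE t : memSS t (stage R k) -> memSS t w -> t = x.
    by move=> kt /(wxx _ kt) [].
  by case=> wx'; apply/esym/wE => //; apply/wx' => //; left.
subst x'; split=> //.
(* The doubleton of [x] and [z] belongs to [p], hence is the singleton of [x] or the doubleton of
   [x] and [z']. The exchange of [y] and [y'] then settles the second components. *)
have dblr z z' : memSS z (stage R k) -> is_pair k p x z -> is_pair k p x z' ->
    z = x \/ z = z'.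
  move=> kz pz pz'; have [w kw wxz] := is_dbl_exists k x z.
  have wz : memSS z w by apply/wxz => //; right.
  have /(pz' _ kw) : memSS w p by apply/(pz _ kw); right.
  by case=> wxz'; have /(wxz' _ kz) := wz; tauto.
have := dblr _ _ ky pxy pxy'; have := dblr _ _ ky' pxy' pxy.
by case=> [->|//]; case=> ->.
Qed.

Lemma is_tuple_exists (s : seq R) : (0 < size s)%N ->
  exists2 z : lev R ((size s).-1).*2, True & is_tuple (inj_lev z : std) (map (@ind R) s).
Proof.
case: s => // r s _; elim: s r => [|r' s IH] r; first by exists r.
have [t _ tP] := IH r'; rewrite /= in tP *; rewrite size_map.
have [p kp pP] := is_pair_exists (size s).*2 (ind r) (inj_lev t).
have [z ez] := (memSS_stage _ _).1 kp; exists z => //; rewrite -?ez; exists (inj_lev t); split=> //.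
  by apply/memSS_stage; exists t.
by move: tP; rewrite size_map.
Qed.

Lemma is_tuple_inj (z : std) (s s' : seq R) : size s = size s' ->
  is_tuple z (map (@ind R) s) -> is_tuple z (map (@ind R) s') -> s = s'.
Proof.
elim: s s' z => [|r s IH] [|r' s'] z //= [].
case: s s' IH => [|r2 s] [|r2' s'] IH //=; first by move=> _ -> /ind_inj ->.
move=> -[sz] [t [kt tP zP]] [t' [kt' tP' zP']].
rewrite size_map in kt zP; rewrite size_map -sz in kt' zP'.
have [/ind_inj <- ett'] := is_pair_inj (ind_stage _ _) kt (ind_stage _ _) kt' zP zP'.
rewrite -{}ett' in tP'.
by rewrite (IH (r2' :: s') t _ tP tP') //= sz.
Qed.

(** By injectivity of the tuples, a relation can be read back from its coding as an entity. This
    gives the atoms of transferred formulas their meaning over the reals. *)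
Lemma rel_ent_std n P (s : seq R) : size s = n -> (0 < n)%N ->
  (exists2 z : std, memSS z (rel_ent n P) & is_tuple z (map (@ind R) s)) <-> P s.
Proof.
move=> ns n0; split=> [[_ /memSS_ent[a [s' [ns' Ps' as']] ->] as_]|Ps].
  by rewrite (is_tuple_inj _ as_ as') // ns ns'.
have [z _ zP] : exists2 z : lev R ((size s).-1).*2, True & _ :=
  is_tuple_exists (s := s) ltac:(by rewrite ns).
rewrite ns in z zP; exists (inj_lev z) => //; apply/memSS_ent.
by exists z => //; exists s.
Qed.

End standard.

(** * Bounded formulas for pairs, tuples and relations *)

Section formulas.
Variables (R : realType).

Definition shift_term (P X : Type) (t : term R P X) : term R P (option X) :=
  match t with Var x => Var R P (Some x) | Par c => Par R (option X) c
             | Cst a => Cst P (option X) a end.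

Definition bvar {P X : Type} : term R P (option X) := Var R P None.

Definition All_stage (P X : Type) k (f : formula R P (option X)) : formula R P X :=
  All (@is_entity_ent R k setT) f.
Definition Ex_stage (P X : Type) k (f : formula R P (option X)) : formula R P X :=
  Ex (@is_entity_ent R k setT) f.

Definition Iff (P X : Type) (f g : formula R P X) := And (Imp f g) (Imp g f).

Definition dbl_fm (P X : Type) k (w x y : term R P X) : formula R P X :=
  All_stage k (Iff (Defs.Mem (bvar) (shift_term w))
    (Or (Eq (bvar) (shift_term x)) (Eq (bvar) (shift_term y)))).

Definition pair_fm (P X : Type) k (p x y : term R P X) : formula R P X :=
  All_stage k.+1 (Iff (Defs.Mem (bvar) (shift_term p))
    (Or (dbl_fm k (bvar) (shift_term x) (shift_term x))
        (dbl_fm k (bvar) (shift_term x) (shift_term y)))).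

(* The tuple of the terms [e i]; it is kept as a map so that the shifts of a
   quantifier do not hide the structural recursion on the list. *)
Fixpoint tuple_fm (P X I : Type) (e : I -> term R P X) (z : term R P X) (xs : seq I) :
    formula R P X :=
  match xs with
  | [::] => Neg (Eq z z)
  | x :: ys =>
      if ys is [::] then Eq z (e x) else
        let k := ((size ys).-1).*2 in
        Ex_stage k (And (tuple_fm (@shift_term P X \o e) (bvar) ys)
          (pair_fm k (shift_term z) (shift_term (e x)) (bvar)))
  end.

Definition rel_fm (P X : Type) n (Q : seq R -> Prop) (ts : seq (term R P X)) :
    formula R P X :=
  Ex (@is_entity_ent R _ _ : is_entity (rel_ent n Q))
     (tuple_fm (@shift_term P X) (bvar) ts).

End formulas.

Arguments bvar {R P X}.

Section formulas_sat.
Variables (R : realType) (S : structure R) (P : Type) (p : P -> S).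

Lemma eval_shift X (v : X -> S) d (t : term R P X) :
  Defs.eval p (extend v d) (shift_term t) = Defs.eval p v t.
Proof. by case: t. Qed.

Lemma sat_Iff X (v : X -> S) (f h : formula R P X) :
  sat p v (Iff f h) = (sat p v f <-> sat p v h).
Proof. by []. Qed.

Lemma sat_Or X (v : X -> S) (f h : formula R P X) :
  sat p v (Or f h) = (sat p v f \/ sat p v h).
Proof. by []. Qed.

Lemma sat_All_stage X (v : X -> S) k (f : formula R P (option X)) :
  sat p v (All_stage k f) =
  forall d, mem_in d (star S (stage R k)) -> sat p (extend v d) f.
Proof. by []. Qed.

Lemma sat_And X (v : X -> S) (f h : formula R P X) :
  sat p v (And f h) = (sat p v f /\ sat p v h).
Proof. by []. Qed.

Lemma sat_Ex_stage X (v : X -> S) k (f : formula R P (option X)) :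
  sat p v (Ex_stage k f) =
  exists d, mem_in d (star S (stage R k)) /\ sat p (extend v d) f.
Proof. by []. Qed.

Lemma sat_dbl_fm X (v : X -> S) k (w x y : term R P X) :
  sat p v (dbl_fm k w x y) =
  is_dbl k (Defs.eval p v w) (Defs.eval p v x) (Defs.eval p v y).
Proof.
by apply/propext; split=> h d kd; have := h d kd; rewrite /= !eval_shift.
Qed.

Lemma sat_pair_fm X (v : X -> S) k (z x y : term R P X) :
  sat p v (pair_fm k z x y) =
  is_pair k (Defs.eval p v z) (Defs.eval p v x) (Defs.eval p v y).
Proof.
rewrite sat_All_stage /is_pair; apply: eq_forall => d.
by rewrite sat_Iff sat_Or !sat_dbl_fm [sat _ _ (Defs.Mem _ _)]/= !eval_shift.
Qed.

Lemma sat_tuple_fm X (v : X -> S) I (e : I -> term R P X) z ts :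
  sat p v (tuple_fm e z ts) = is_tuple (Defs.eval p v z) (map (Defs.eval p v \o e) ts).
Proof.
elim: ts X v e z => [|x [|y ts] IH] X v e z; [| by []|].
  by apply/propext; split=> [/(_ erefl)|].
have IHe t : sat p (extend v t) (tuple_fm (@shift_term R P X \o e) (bvar) (y :: ts)) =
    is_tuple t (map (Defs.eval p v \o e) (y :: ts)).
  rewrite IH; congr is_tuple; apply: eq_map => i /=; exact: eval_shift.
rewrite -[tuple_fm e z _]/(Ex_stage _ (And (tuple_fm (@shift_term R P X \o e)
  bvar (y :: ts)) (pair_fm _ (shift_term z) (shift_term (e x)) bvar))).
rewrite -[RHS]/(exists t, let k := (size (map (Defs.eval p v \o e) (y :: ts))).-1.*2 in
  [/\ mem_in t (star S (stage R k)), is_tuple t (map (Defs.eval p v \o e) (y :: ts)) &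
      is_pair k (Defs.eval p v z) (Defs.eval p v (e x)) t]).
rewrite sat_Ex_stage size_map; apply: eq_exists => t.
rewrite sat_And IHe sat_pair_fm !eval_shift.
by apply/propext; split=> [[kt [tP zP]]|[kt tP zP]].
Qed.

Lemma sat_rel_fm X (v : X -> S) n Q (ts : seq (term R P X)) :
  sat p v (rel_fm n Q ts) <->
  exists2 z, mem_in z (star S (rel_ent n Q)) & is_tuple z (map (Defs.eval p v) ts).
Proof.
have E z : sat p (extend v z) (tuple_fm (@shift_term R P X) (bvar) ts) =
    is_tuple z (map (Defs.eval p v) ts).
  by rewrite sat_tuple_fm; congr is_tuple; apply: eq_map => i; exact: eval_shift.
have -> : sat p v (rel_fm n Q ts) =
    exists z, mem_in z (star S (rel_ent n Q)) /\ is_tuple z (map (Defs.eval p v) ts).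
  by rewrite /rel_fm [LHS]/=; apply: eq_exists => z; rewrite -E.
by split=> [[z []]|[z]]; exists z.
Qed.

End formulas_sat.

(** * Transfer between real and hyperreal environments *)

Section transfer.
Variable R : realType.

(* First-order formulas about real numbers; variables are positions in an
   environment to which a quantifier adds an element in front. *)
Inductive real_formula :=
  | REq of nat & nat
  | RAtom of (seq R -> Prop) & nat & seq nat
  | RImp of real_formula & real_formula
  | RAnd of real_formula & real_formula
  | RNeg of real_formula
  | RAll of real_formula
  | REx of real_formula.

(** The reading of atoms and the range of quantifiers are parameters, so that one formula can be
    read over the reals, over the hyperreals and inside either structure. *)
Fixpoint rsat (T : Type) (at_ : (seq R -> Prop) -> seq T -> Prop) (D : T -> Prop) (t0 : T)
    (env : seq T) (f : real_formula) : Prop :=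
  match f with
  | REq i j => nth t0 env i = nth t0 env j
  | RAtom Q i idx => at_ Q (map (nth t0 env) (i :: idx))
  | RImp f g => rsat at_ D t0 env f -> rsat at_ D t0 env g
  | RAnd f g => rsat at_ D t0 env f /\ rsat at_ D t0 env g
  | RNeg f => ~ rsat at_ D t0 env f
  | RAll f => forall d, D d -> rsat at_ D t0 (d :: env) f
  | REx f => exists d, D d /\ rsat at_ D t0 (d :: env) f
  end.

(** A position outside [vars] becomes the constant 0, in agreement with the default value of [nth]
    in [rsat]. *)
Fixpoint real_fm (X : Type) (vars : seq X) (f : real_formula) : formula R void X :=
  let t i := nth (Cst void X (ind 0)) (map (@Var R void X) vars) i in
  match f with
  | REq i j => Eq (t i) (t j)
  | RAtom Q i idx =>
      rel_fm (size (i :: idx)) Q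
        (map t (i :: idx))
  | RImp f g => Imp (real_fm vars f) (real_fm vars g)
  | RAnd f g => And (real_fm vars f) (real_fm vars g)
  | RNeg f => Neg (real_fm vars f)
  | RAll f => All_stage 0 (real_fm (None :: map Some vars) f)
  | REx f => Ex_stage 0 (real_fm (None :: map Some vars) f)
  end.

Definition srel (S : structure R) (Q : seq R -> Prop) (xs : seq S) : Prop :=
  exists2 z, mem_in z (star S (rel_ent (size xs) Q)) & is_tuple z xs.

Lemma nth_map_default T U (f : T -> U) x0 s i :
  nth (f x0) (map f s) i = f (nth x0 s i).
Proof. by elim: s i => [|x s IH] [|i] //=. Qed.

Lemma sat_real_fm (S : structure R) X (v : X -> S) vars f :
  sat (of_void S) v (real_fm vars f) =
  rsat (@srel S) (fun d => mem_in d (star S (stage R 0))) (star S (ind 0))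
    (map v vars) f.
Proof.
have E Y (w : Y -> S) vs k :
    Defs.eval (of_void S) w (nth (Cst void Y (ind 0)) (map (@Var R void Y) vs) k) =
    nth (star S (ind 0)) (map w vs) k.
  transitivity (nth (Defs.eval (of_void S) w (Cst void Y (ind 0)))
    (map (Defs.eval (of_void S) w) (map (@Var R void Y) vs)) k).
    by rewrite nth_map_default.
  by rewrite -map_comp.
elim: f X v vars => [i j|Q i idx|f IHf h IHh|f IHf h IHh|f IHf|f IHf|f IHf] X v vars.
- by rewrite -[LHS]/(Defs.eval _ _ _ = Defs.eval _ _ _) !E.
- pose ts := map (nth (Cst void X (ind 0)) (map (@Var R void X) vars)) (i :: idx).
  rewrite -[LHS]/(sat (of_void S) v (rel_fm (size (i :: idx)) Q ts)).
  rewrite -[RHS]/(srel Q (map (nth (star S (ind 0)) (map v vars)) (i :: idx))).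
  have <- : map (Defs.eval (of_void S) v) ts =
      map (nth (star S (ind 0)) (map v vars)) (i :: idx).
    by rewrite /ts -map_comp; apply: eq_map => k; exact: E.
  by apply/propext; rewrite sat_rel_fm /srel size_map /ts size_map.
- by rewrite -[LHS]/(sat _ v (real_fm vars f) -> sat _ v (real_fm vars h)) IHf IHh.
- by rewrite -[LHS]/(sat _ v (real_fm vars f) /\ sat _ v (real_fm vars h)) IHf IHh.
- by rewrite -[LHS]/(~ sat _ v (real_fm vars f)) IHf.
- rewrite [real_fm _ _]/= sat_All_stage; apply: eq_forall => d.
  by rewrite IHf /= -map_comp.
- rewrite [real_fm _ _]/= sat_Ex_stage; apply: eq_exists => d.
  by rewrite IHf /= -map_comp.
Qed.

Definition rsatR := @rsat R (fun Q s => Q s) setT 0.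

Lemma rsat_std env f :
  rsat (@srel (std R)) (fun d => memSS d (stage R 0)) (ind 0) (map (@ind R) env) f =
  rsatR env f.
Proof.
elim: f env => [i j|Q i idx|f IHf h IHh|f IHf h IHh|f IHf|f IHf|f IHf] env.
- rewrite -[LHS]/(nth (ind 0) (map (@ind R) env) i = nth (ind 0) (map (@ind R) env) j).
  by rewrite !nth_map_default; apply/propext; split=> [/ind_inj //|e]; congr ind.
- rewrite -[LHS]/(@srel (std R) Q (map (nth (ind 0) (map (@ind R) env)) (i :: idx))).
  rewrite -[RHS]/(Q (map (nth 0 env) (i :: idx))).
  have -> : map (nth (ind 0) (map (@ind R) env)) (i :: idx) =
      map (@ind R) (map (nth 0 env) (i :: idx)).
    by rewrite -map_comp; apply: eq_map => k; rewrite /= nth_map_default.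
  by apply/propext; rewrite /srel rel_ent_std // !size_map.
- by rewrite /rsatR /= IHf IHh.
- by rewrite /rsatR /= IHf IHh.
- by rewrite /rsatR /= IHf.
- rewrite /rsatR /=; apply/propext; split=> H d.
    by move=> _; have := H _ (ind_stage 0 d); rewrite -map_cons IHf.
  by case/memSS_stage=> r ->; rewrite -[inj_lev r]/(ind r) -map_cons IHf; apply: H.
- rewrite /rsatR /=; apply/propext; split=> -[d [kd]].
    have [r ->] := (memSS_stage _ _).1 kd.
    by rewrite -[inj_lev r]/(ind r) -map_cons IHf; exists r.
  exists (ind d); split; first exact: ind_stage.
  by rewrite -map_cons IHf.
Qed.

Variable M : nonstandard_model R.

Definition rsatH := @rsat (hyper M) (@hrel R M) setT (hreal M 0).

Lemma rsat_model (env : seq (hyper M)) f :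
  rsat (@srel M) (fun d => mem_in d (star M (stage R 0))) (star M (ind 0)) (map sval env) f =
  rsatH env f.
Proof.
elim: f env => [i j|Q i idx|f IHf h IHh|f IHf h IHh|f IHf|f IHf|f IHf] env.
- rewrite -[LHS]/(nth (sval (hreal M 0)) (map sval env) i =
    nth (sval (hreal M 0)) (map sval env) j).
  rewrite !nth_map_default; apply/propext; split=> e; last by congr sval.
  by apply: eq_sig_hprop e => ? ? ?; exact: Prop_irrelevance.
- rewrite -[LHS]/(@srel M Q (map (nth (sval (hreal M 0)) (map sval env)) (i :: idx))).
  rewrite -[RHS]/(hrel Q (map (nth (hreal M 0) env) (i :: idx))).
  have -> : map (nth (sval (hreal M 0)) (map sval env)) (i :: idx) =
      map sval (map (nth (hreal M 0) env) (i :: idx)).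
    by rewrite -map_comp; apply: eq_map => k; exact: nth_map_default.
  by rewrite /srel /hrel size_map.
- by rewrite /rsatH /= IHf IHh.
- by rewrite /rsatH /= IHf IHh.
- by rewrite /rsatH /= IHf.
- rewrite /rsatH /=; apply/propext; split=> H.
    by move=> d _; have := H _ (svalP d); rewrite -map_cons IHf.
  by move=> d kd; rewrite -[d]/(sval (exist _ d kd : hyper M)) -map_cons IHf; apply: H.
- rewrite /rsatH /=; apply/propext; split=> -[d [kd]].
    by rewrite -[d]/(sval (exist _ d kd : hyper M)) -map_cons IHf => h; exists (exist _ d kd).
  rewrite -[rsat _ _ _ _ _]/(rsatH (d :: env) f) -IHf => h'.
  by exists (sval d); split; first exact: (svalP d).
Qed.

Lemma rsat_transfer f : rsatR [::] f <-> rsatH [::] f.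
Proof.
have := transfer M (real_fm [::] f).
by rewrite /holds !sat_real_fm /= -rsat_std -rsat_model.
Qed.

(** [transfer] concerns sentences, so the [n] free variables are first closed by universal
    quantifiers. *)
Lemma rsat_transfer_all n f :
  (forall env : seq R, size env = n -> rsatR env f) ->
  forall env : seq (hyper M), size env = n -> rsatH env f.
Proof.
move=> H.
have iterP T at_ (t0 : T) m env :
    rsat at_ setT t0 env (iter m RAll f) <->
    forall ds, size ds = m -> rsat at_ setT t0 (ds ++ env) f.
  elim: m env => [|m IH] env; first by split=> [h [|]//|/(_ [::])]; apply.
  rewrite iterS; split=> /= h ds.
    elim/last_ind: ds => [//|ds d _]; rewrite size_rcons => -[sz].
    by rewrite cat_rcons; exact: ((IH (d :: env)).1 (h d Logic.I) ds sz).
  move=> _; apply/IH => es sz; rewrite -cat_rcons; apply: h.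
  by rewrite size_rcons sz.
have /rsat_transfer /iterP H' : rsatR [::] (iter n RAll f).
  by apply/iterP => ds sz; rewrite cats0; apply: H.
by move=> env sz; have := H' env sz; rewrite cats0.
Qed.

End transfer.

(** * The ordered field of hyperreal numbers *)

Section extension.
Variables (R : realType) (M : nonstandard_model R).
Implicit Types (P Q : seq R -> Prop) (xs : seq (hyper M)) (x y : hyper M).

Lemma hyper_eq x y : sval x = sval y -> x = y.
Proof. by move=> e; apply: eq_sig_hprop e => ? ? ?; exact: Prop_irrelevance. Qed.

(** The index 0 stands apart because an atom carries its first argument separately, which keeps its
    arity positive. *)
Lemma select_all T (t0 : T) (env : seq T) n : size env = n.+1 ->
  map (nth t0 env) (0%N :: iota 1 n) = env.
Proof. by move=> sz; rewrite -[_ :: _]/(iota 0 n.+1) -sz map_nth_iota0 ?take_size. Qed.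

(** Atoms may be arbitrary relations on the reals, so each closure property of [hrel] is the
    transfer of one short formula. This one passes from a pointwise implication to hyperreals. *)
Lemma hrel_imp P Q xs : (0 < size xs)%N ->
  (forall s, size s = size xs -> P s -> Q s) -> hrel P xs -> hrel Q xs.
Proof.
case: xs => // x xs _ PQ.
have := @rsat_transfer_all R M (size xs).+1
  (RImp (RAtom P 0 (iota 1 (size xs))) (RAtom Q 0 (iota 1 (size xs)))) _ (x :: xs) erefl.
rewrite /rsatH /rsat select_all //; apply=> env sz.
by rewrite /rsatR /rsat select_all //; apply: PQ.
Qed.

Lemma hrel_and P Q xs : (0 < size xs)%N ->
  hrel P xs -> hrel Q xs -> hrel (fun s => P s /\ Q s) xs.
Proof.
case: xs => // x xs _.
have := @rsat_transfer_all R M (size xs).+1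
  (RImp (RAtom P 0 (iota 1 (size xs))) (RImp (RAtom Q 0 (iota 1 (size xs)))
    (RAtom (fun s => P s /\ Q s) 0 (iota 1 (size xs))))) _ (x :: xs) erefl.
rewrite /rsatH /rsat select_all //; apply=> env sz.
by rewrite /rsatR /rsat select_all.
Qed.

Lemma hrel_not P xs : (0 < size xs)%N ->
  hrel (fun s => ~ P s) xs <-> ~ hrel P xs.
Proof.
case: xs => // x xs _.
have := @rsat_transfer_all R M (size xs).+1
  (RAnd (RImp (RAtom (fun s => ~ P s) 0 (iota 1 (size xs)))
     (RNeg (RAtom P 0 (iota 1 (size xs)))))
   (RImp (RNeg (RAtom P 0 (iota 1 (size xs))))
     (RAtom (fun s => ~ P s) 0 (iota 1 (size xs))))) _ (x :: xs) erefl.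
rewrite /rsatH /rsat select_all //; apply=> env sz.
by rewrite /rsatR /rsat select_all.
Qed.

Lemma hrel_true P xs : (0 < size xs)%N ->
  (forall s, size s = size xs -> P s) -> hrel P xs.
Proof.
move=> xs0 Pall; have [//|/(hrel_not _ xs0)] := pselect (hrel P xs).
by apply: hrel_imp => // s sz; have := Pall s sz.
Qed.

Lemma hrel_select P xs i idx : (0 < size xs)%N ->
  hrel P (map (nth (hreal M 0) xs) (i :: idx)) <->
  hrel (fun s => P (map (nth 0 s) (i :: idx))) xs.
Proof.
case: xs => // x xs _; set Q := fun s => P _.
have := @rsat_transfer_all R M (size xs).+1
  (RAnd (RImp (RAtom P i idx) (RAtom Q 0 (iota 1 (size xs))))
        (RImp (RAtom Q 0 (iota 1 (size xs))) (RAtom P i idx))) _ (x :: xs) erefl.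
rewrite /rsatH /rsat select_all //; apply=> env sz.
by rewrite /rsatR /rsat select_all.
Qed.

Lemma hrel_exists P xs :
  (forall s : seq R, size s = size xs -> exists b : R, P (b :: s)) ->
  exists y, hrel P (y :: xs).
Proof.
move=> Pex; have [env sz|y [_]] := @rsat_transfer_all R M (size xs)
  (REx (RAtom P 0 (iota 1 (size xs)))) _ xs erefl.
  have [y Py] := Pex _ sz; exists y; split=> //.
  by rewrite /rsat select_all //= sz.
by rewrite /rsat => h; exists y; move: h; rewrite select_all.
Qed.

Lemma hrel_eq x y : hrel (fun s => s`_0 = s`_1) [:: x; y] <-> x = y.
Proof.
pose Q := fun s : seq R => s`_0 = s`_1.
have := @rsat_transfer_all R M 2
  (RAnd (RImp (RAtom Q 0 [:: 1%N]) (REq _ 0 1)) (RImp (REq _ 0 1) (RAtom Q 0 [:: 1%N])))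
  _ [:: x; y] erefl.
by rewrite /rsatH /=; apply=> -[|a [|b [|c env]]] //= _; rewrite /rsatR /=.
Qed.

(** A tuple of length one is its only entry, so [star_mem] decides this case directly. *)
Lemma hrel_real P r : hrel P [:: hreal M r] <-> P [:: r].
Proof.
rewrite -(@rel_ent_std R 1 P [:: r]) // /hrel /=; split=> -[z].
  by move=> + e; rewrite e => /star_mem; exists (ind r).
by move=> + e; rewrite e => zP; exists (star M (ind r)) => //; apply/star_mem.
Qed.

(** By transfer the extended graph of [F] is total and single-valued, so the choice in [hfun] never
    falls back on its default. *)
Lemma hfunP (F : seq R -> R) xs y :
  y = hfun F xs <-> hrel (fun s => head 0 s = F (behead s)) (y :: xs).
Proof.
set G := fun s => _.
have [z Gz] : exists z, hrel G (z :: xs).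
  by apply: hrel_exists => s _; exists (F s).
have Gf : hrel G (hfun F xs :: xs).
  rewrite /hfun /the; case: pselect => [e|[]]; last by exists z.
  by case: cid.
have uniq y1 y2 : hrel G (y1 :: xs) -> hrel G (y2 :: xs) -> y1 = y2.
  move=> G1 G2; set n := size xs.
  have := @rsat_transfer_all R M n.+2
   (RImp (RAtom G 0 (iota 2 n)) (RImp (RAtom G 1 (iota 2 n)) (REq _ 0 1))) _
   [:: y1, y2 & xs] erefl.
  have sel T (t0 : T) a b c s : size s = n ->
      map (nth t0 [:: a, b & s]) (c :: iota 2 n) = nth t0 [:: a, b & s] c :: s.
    move=> sz; rewrite map_cons (iotaDl 2 0 n) -map_comp.
    by rewrite (eq_map (g := nth t0 s)) // -sz map_nth_iota0 ?take_size.
  rewrite /rsatH /rsat !sel //; apply=> // -[|a [|b env]] // [] sz.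
  by rewrite /rsatR /rsat !sel // /G /= => -> ->.
by split=> [->//|/uniq]; apply.
Qed.

Lemma hfun_proj xs i : (0 < size xs)%N ->
  nth (hreal M 0) xs i = hfun (fun s => s`_i) xs.
Proof.
move=> xs0; apply/hfunP.
have -> : nth (hreal M 0) xs i :: xs =
    map (nth (hreal M 0) xs) (i :: iota 0 (size xs)).
  by rewrite /= map_nth_iota0 ?take_size.
apply/hrel_select => //; apply: hrel_true => // s sz.
by rewrite /= -sz map_nth_iota0 ?take_size.
Qed.

Lemma hfun_cst r xs : hreal M r = hfun (fun=> r) xs.
Proof.
apply/hfunP; set Q := fun s => _.
have := (hrel_real (fun s => head 0 s = r) r).2 erefl.
have := @hrel_select (fun s => head 0 s = r) (hreal M r :: xs) 0 [::] isT.
by move=> [h _] /h; apply: hrel_imp => // -[|a s].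
Qed.

(** Both sides are statements about the concatenation of the values with [xs]. There the graphs of
    all the functions hold simultaneously, by induction on their number, and they turn one side into
    the other pointwise. *)
Lemma hrel_hfun P (Fs : seq (seq R -> R)) xs :
    (0 < size Fs)%N -> (0 < size xs)%N ->
  hrel P (map (fun F => hfun F xs) Fs) <-> hrel (fun s => P (map (fun F => F s) Fs)) xs.
Proof.
move=> Fs0 xs0; set ys := map _ Fs; set Q := fun s => _; set m := size Fs.
pose env := ys ++ xs.
have sys : size ys = m by rewrite size_map.
have senv : size env = (m + size xs)%N by rewrite size_cat sys.
have env0 : (0 < size env)%N by rewrite senv ltn_addl.
have dropE T (t0 : T) s : size s = (m + size xs)%N ->
    map (nth t0 s) (iota m (size xs)) = drop m s.
  by move=> sz; rewrite map_nth_iota ?sz // ?addKn // take_oversize // size_drop sz addKn.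
have takeE T (t0 : T) s : size s = (m + size xs)%N ->
    map (nth t0 s) (iota 0 m) = take m s.
  by move=> sz; rewrite map_nth_iota0 // sz leq_addr.
have graph k : (k <= m)%N ->
    hrel (fun s => forall i, (i < k)%N -> s`_i = nth (fun=> 0) Fs i (drop m s)) env.
  elim: k => [|k IH] km; first exact: hrel_true.
  have gk : hrel (fun s => s`_k = nth (fun=> 0) Fs k (drop m s)) env.
    have := (hfunP (nth (fun=> 0) Fs k) xs _).1 erefl.
    have -> : hfun (nth (fun=> 0) Fs k) xs :: xs =
        map (nth (hreal M 0) env) (k :: iota m (size xs)).
      rewrite /= dropE // drop_size_cat // nth_cat sys km.
      by rewrite (nth_map (fun=> 0)).
    move/hrel_select => /(_ env0); apply: hrel_imp => // s.
    by rewrite senv => sz; rewrite /= dropE.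
  have := hrel_and env0 (IH (ltnW km)) gk; apply: hrel_imp => // s _ [h1 h2] i.
  by rewrite ltnS leq_eqVlt => /orP[/eqP -> //|/h1].
have {}graph : hrel (fun s => take m s = map (fun F => F (drop m s)) Fs) env.
  apply: hrel_imp (graph m (leqnn m)) => // s; rewrite senv => sz h.
  apply: (@eq_from_nth _ 0); rewrite size_takel ?size_map // ?sz ?leq_addr // => i im.
  by rewrite nth_take // (nth_map (fun=> 0)) // h.
have PE : hrel P ys <-> hrel (fun s => P (take m s)) env.
  have eys : ys = map (nth (hreal M 0) env) (iota 0 m).
    by rewrite takeE // take_size_cat.
  have em : iota 0 m = 0%N :: iota 1 m.-1 by rewrite -{1}(prednK (Fs0 : (0 < m)%N)).
  rewrite {1}eys em; split.
    move/hrel_select => /(_ env0); apply: hrel_imp => // s.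
    by rewrite -em senv => sz; rewrite takeE.
  move=> h; apply/hrel_select => //; move: h; apply: hrel_imp => // s.
  by rewrite -em senv => sz; rewrite takeE.
have QE : hrel Q xs <-> hrel (fun s => Q (drop m s)) env.
  have exs : xs = map (nth (hreal M 0) env) (iota m (size xs)).
    by rewrite dropE // drop_size_cat.
  have em : iota m (size xs) = m :: iota m.+1 (size xs).-1 by case: (size xs) xs0.
  rewrite {1}exs em; split.
    move/hrel_select => /(_ env0); apply: hrel_imp => // s.
    by rewrite -em senv => sz; rewrite dropE.
  move=> h; apply/hrel_select => //; move: h; apply: hrel_imp => // s.
  by rewrite -em senv => sz; rewrite dropE.
rewrite PE QE; split=> h; have := hrel_and env0 graph h; apply: hrel_imp => // s _ [].
  by move=> ->.
by rewrite /Q => <-.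
Qed.

Lemma hfun_comp (f : seq R -> R) (Fs : seq (seq R -> R)) xs :
    (0 < size xs)%N ->
  hfun f (map (fun F => hfun F xs) Fs) = hfun (fun s => f (map (fun F => F s) Fs)) xs.
Proof.
move=> xs0; apply/esym/hfunP.
rewrite -(map_cons (fun F => hfun F xs) (fun s => f (map (fun F => F s) Fs))).
by apply/hrel_hfun => //; apply: hrel_true.
Qed.

End extension.

(** * Germs of real functions at a list of hyperreals *)

Section germs.
Variables (R : realType) (M : nonstandard_model R) (xs : seq (hyper M)).
Hypothesis xs0 : (0 < size xs)%N.
Implicit Types F G : seq R -> R.

Lemma hfun1_germ (f : R -> R) F : hfun1 f (hfun F xs) = hfun (fun s => f (F s)) xs.
Proof. exact: (hfun_comp (fun s => f s`_0) [:: F]). Qed.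

Lemma hfun2_germ (f : R -> R -> R) F G :
  hfun2 f (hfun F xs) (hfun G xs) = hfun (fun s => f (F s) (G s)) xs.
Proof. exact: (hfun_comp (fun s => f s`_0 s`_1) [:: F; G]). Qed.

Lemma hlt_germ F G : hlt (hfun F xs) (hfun G xs) <-> hrel (fun s => F s < G s) xs.
Proof. exact: (hrel_hfun (fun s => s`_0 < s`_1) (Fs := [:: F; G])). Qed.

Lemma eq_germ F G : hfun F xs = hfun G xs <-> hrel (fun s => F s = G s) xs.
Proof.
by rewrite -hrel_eq; exact: (hrel_hfun (fun s => s`_0 = s`_1) (Fs := [:: F; G])).
Qed.

End germs.

(** * Field operations and order of the hyperreals *)

Section field_structure.
Variables (R : realType) (M : nonstandard_model R).
Notation hyper := (hyper M).

HB.instance Definition _ := gen_eqMixin hyper.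
HB.instance Definition _ := gen_choiceMixin hyper.

(** Given hyperreals are the germs of the coordinate functions at the list they form, so a law of
    the field reduces to its pointwise form over the reals. *)
Lemma germ_ind3 (P : hyper -> hyper -> hyper -> Prop) :
  (forall xs F G K, (0 < size xs)%N -> P (hfun F xs) (hfun G xs) (hfun K xs)) ->
  forall x y z, P x y z.
Proof.
move=> H x y z.
have := H [:: x; y; z] (fun s => s`_0) (fun s => s`_1) (fun s => s`_2) isT.
by rewrite -!hfun_proj.
Qed.

Lemma germ_ind2 (P : hyper -> hyper -> Prop) :
  (forall xs F G, (0 < size xs)%N -> P (hfun F xs) (hfun G xs)) -> forall x y, P x y.
Proof.
move=> H x y; apply: (@germ_ind3 (fun x y _ => P x y) _ x y y) => xs F G _ xs0.
exact: H.
Qed.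

Lemma germ_ind1 (P : hyper -> Prop) :
  (forall xs F, (0 < size xs)%N -> P (hfun F xs)) -> forall x, P x.
Proof. by move=> H x; apply: (@germ_ind2 (fun x _ => P x) _ x x) => xs F _ xs0; exact: H. Qed.

Lemma haddA : associative (@hadd R M).
Proof.
apply: germ_ind3 => xs F G K xs0; rewrite /hadd !hfun2_germ //.
by congr hfun; apply/funext => s; rewrite addrA.
Qed.

Lemma haddC : commutative (@hadd R M).
Proof.
apply: germ_ind2 => xs F G xs0; rewrite /hadd !hfun2_germ //.
by congr hfun; apply/funext => s; rewrite addrC.
Qed.

Lemma hadd0 : left_id (hreal M 0) (@hadd R M).
Proof.
apply: germ_ind1 => xs F xs0; rewrite /hadd (hfun_cst 0 xs) !hfun2_germ //.
by congr hfun; apply/funext => s; rewrite add0r.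
Qed.

Lemma haddN : left_inverse (hreal M 0) (@hopp R M) (@hadd R M).
Proof.
apply: germ_ind1 => xs F xs0.
rewrite /hadd /hopp hfun1_germ // hfun2_germ // (hfun_cst 0 xs).
by congr hfun; apply/funext => s; rewrite addNr.
Qed.

HB.instance Definition _ := GRing.isZmodule.Build hyper haddA haddC hadd0 haddN.

Lemma hmulA : associative (@hmul R M).
Proof.
apply: germ_ind3 => xs F G K xs0; rewrite /hmul !hfun2_germ //.
by congr hfun; apply/funext => s; rewrite mulrA.
Qed.

Lemma hmulC : commutative (@hmul R M).
Proof.
apply: germ_ind2 => xs F G xs0; rewrite /hmul !hfun2_germ //.
by congr hfun; apply/funext => s; rewrite mulrC.
Qed.

Lemma hmul1 : left_id (hreal M 1) (@hmul R M).
Proof.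
apply: germ_ind1 => xs F xs0; rewrite /hmul (hfun_cst 1 xs) !hfun2_germ //.
by congr hfun; apply/funext => s; rewrite mul1r.
Qed.

Lemma hmulDl : left_distributive (@hmul R M) (@hadd R M).
Proof.
apply: germ_ind3 => xs F G K xs0; rewrite /hmul /hadd !hfun2_germ //.
by congr hfun; apply/funext => s; rewrite mulrDl.
Qed.

Lemma hreal1_neq0 : hreal M 1 != hreal M 0.
Proof. by apply/eqP => /hreal_inj/eqP; rewrite oner_eq0. Qed.

HB.instance Definition _ :=
  GRing.Zmodule_isComNzRing.Build hyper hmulA hmulC hmul1 hmulDl hreal1_neq0.

Definition hinv := @hfun1 R M (@GRing.inv R).

Lemma hmulV (x : hyper) : x != 0 -> hinv x * x = 1.
Proof.
elim/germ_ind1: x => xs F xs0 /eqP; rewrite /hinv -[_ * _]/(hmul _ _) /hmul.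
rewrite hfun1_germ // hfun2_germ // -[0]/(hreal M 0) -[1]/(hreal M 1).
rewrite (hfun_cst 0 xs) (hfun_cst 1 xs) !eq_germ // => /(hrel_not _ xs0).
by apply: hrel_imp => // s _ /eqP ?; rewrite mulVf.
Qed.

Lemma hinv0 : hinv 0 = 0.
Proof.
rewrite /hinv -[0]/(hreal M 0) (hfun_cst 0 [:: hreal M 0]) hfun1_germ //.
by congr hfun; apply/funext => s; rewrite invr0.
Qed.

HB.instance Definition _ := GRing.ComNzRing_isField.Build hyper hmulV hinv0.

Definition hltb (x y : hyper) := `[< hlt x y >].

Lemma hltb_germ xs F G : (0 < size xs)%N ->
  hltb (hfun F xs) (hfun G xs) <-> hrel (fun s => F s < G s) xs.
Proof. by move=> xs0; rewrite -hlt_germ //; split=> /asboolP. Qed.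

Lemma hltb_add (x y : hyper) : hltb 0 x -> hltb 0 y -> hltb 0 (x + y).
Proof.
move: x y; apply: germ_ind2 => xs F G xs0.
rewrite -[0]/(hreal M 0) (hfun_cst 0 xs) -[_ + _]/(hadd _ _) /hadd hfun2_germ //.
rewrite !hltb_germ // => h /(hrel_and xs0 h).
by apply: hrel_imp => // s _ []; exact: addr_gt0.
Qed.

Lemma hltb_mul (x y : hyper) : hltb 0 x -> hltb 0 y -> hltb 0 (x * y).
Proof.
move: x y; apply: germ_ind2 => xs F G xs0.
rewrite -[0]/(hreal M 0) (hfun_cst 0 xs) -[_ * _]/(hmul _ _) /hmul hfun2_germ //.
rewrite !hltb_germ // => h /(hrel_and xs0 h).
by apply: hrel_imp => // s _ []; exact: mulr_gt0.
Qed.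

Lemma hltb_asym (x : hyper) : hltb 0 x -> ~~ hltb x 0.
Proof.
elim/germ_ind1: x => xs F xs0; rewrite -[0]/(hreal M 0) (hfun_cst 0 xs).
move=> /(hltb_germ _ _ xs0) h; apply/negP; rewrite hltb_germ //.
apply/hrel_not => //; move: h; apply: hrel_imp => // s _ F0.
by rewrite lt_gtF.
Qed.

Lemma hltb_sub (x y : hyper) : hltb 0 (y - x) = hltb x y.
Proof.
move: x y; apply: germ_ind2 => xs F G xs0; rewrite -[0]/(hreal M 0) (hfun_cst 0 xs).
rewrite -[_ - _]/(hadd _ (hopp _)) /hadd /hopp hfun1_germ // hfun2_germ //.
by apply/idP/idP; rewrite !hltb_germ //; apply: hrel_imp => // s _; rewrite subr_gt0.
Qed.

Lemma hltb_total (x : hyper) : x != 0 -> hltb 0 x || hltb x 0.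
Proof.
elim/germ_ind1: x => xs F xs0; rewrite -[0]/(hreal M 0) (hfun_cst 0 xs) => /eqP F0.
apply/orP; have [?|] := pselect (hltb (hfun (fun=> 0) xs) (hfun F xs)); first by left.
rewrite hltb_germ // => /(hrel_not _ xs0) h; right; apply/hltb_germ => //.
move: F0; rewrite eq_germ // => /(hrel_not _ xs0) h'.
apply: hrel_imp (hrel_and xs0 h h') => // s _ [/negP + /eqP F0].
by rewrite -leNgt le_eqVlt (negbTE F0).
Qed.

Lemma habsN (x : hyper) : habs (- x) = habs x.
Proof.
elim/germ_ind1: x => xs F xs0; rewrite -[- _]/(hopp _) /hopp /habs !hfun1_germ //.
by congr hfun; apply/funext => s; rewrite normrN.
Qed.

Lemma habs_ge0 (x : hyper) : (0 == x) || hltb 0 x -> habs x = x.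
Proof.
elim/germ_ind1: x => xs F xs0; rewrite -[0]/(hreal M 0) (hfun_cst 0 xs) /habs hfun1_germ //.
case/orP=> [/eqP/eq_germ|/hltb_germ] /(_ xs0) h; apply/eq_germ => //; move: h.
  by apply: hrel_imp => // s _ <-; rewrite normr0.
by apply: hrel_imp => // s _ F0; rewrite gtr0_norm.
Qed.

HB.instance Definition _ := Num.IntegralDomain_isLtReal.Build hyper
  hltb_add hltb_mul hltb_asym hltb_sub hltb_total habsN habs_ge0 (fun _ _ => erefl).

End field_structure.

(** * Metric trees *)

Section trees.
Variables (R : realType) (T : Type) (d : T -> T -> R).

Definition metric_interval x y : set T := [set z | d x z + d z y = d x y].

Hypothesis dm : is_metric d.
Hypothesis four_point : forall x y z w,
  d x y + d z w <= Num.max (d x z + d y w) (d x w + d y z).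
Hypothesis geodesic : forall x y, exists S, geodesic_segment d x y S.

Let dxx x : d x x = 0. Proof. by case: dm. Qed.
Let d0_eq x y : d x y = 0 -> x = y. Proof. by case: dm => _ + _ _; apply. Qed.
Let dC x y : d x y = d y x. Proof. by case: dm. Qed.
Let d_tri y x z : d x z <= d x y + d y z. Proof. by case: dm. Qed.

Lemma metric_ge0 x y : 0 <= d x y.
Proof. by have := d_tri y x x; rewrite dxx (dC y x) => ?; lra. Qed.

(** In the four-point condition for these points both sums on the right equal [d x y], which leaves
    [d z w <= 0]. *)
Lemma interval_inj x y z w :
  metric_interval x y z -> metric_interval x y w -> d x z = d x w -> z = w.
Proof.
rewrite /metric_interval /= => hz hw e; apply: d0_eq; apply/eqP; rewrite eq_le metric_ge0 andbT.
have := four_point x y z w; rewrite le_max => /orP[]; rewrite (dC y); lra.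
Qed.

(** A point of the interval coincides, by [interval_inj], with the point of the segment at the same
    distance from [x]. Uniqueness of geodesic segments follows, the interval being independent of
    [S]. *)
Lemma geodesic_segmentE x y S : geodesic_segment d x y S -> S = metric_interval x y.
Proof.
move=> [a [b [c [ab <- <- -> cP]]]].
have dc s t : a <= s -> s <= t -> t <= b -> d (c s) (c t) = t - s.
  move=> as_ st tb; rewrite cP ?in_itv /= ?as_ ?tb ?(le_trans as_) ?(le_trans st) //.
  by rewrite distrC ger0_norm // subr_ge0.
apply/seteqP; split=> [_ [t + <-]|z hz].
  by rewrite /= in_itv /= => /andP[at_ tb]; rewrite /metric_interval /= !dc //; lra.
have := metric_ge0 (c a) z; have := metric_ge0 z (c b).
move: (hz); rewrite /metric_interval /= dc // => e z1 z2.
exists (a + d (c a) z); first by rewrite /= in_itv /=; lra.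
have h1 : d (c a) (c (a + d (c a) z)) = d (c a) z by rewrite dc; lra.
apply: (@interval_inj (c a) (c b)) => //.
by rewrite /metric_interval /= h1 !dc; lra.
Qed.

Lemma interval_point x y t : 0 <= t <= d x y -> exists2 z, metric_interval x y z & d x z = t.
Proof.
move=> /andP[t0 tD]; have [S xyS] := geodesic x y; have := geodesic_segmentE xyS.
move: xyS => [a [b [c [ab ca cb -> cP]]]] SE.
have D : d x y = b - a.
  rewrite -ca -cb cP ?in_itv /= ?lexx ?ab //.
  by rewrite distrC ger0_norm // subr_ge0.
exists (c (a + t)).
  by rewrite -SE; exists (a + t) => //; rewrite /= in_itv /=; lra.
rewrite -ca cP ?in_itv /= ?lexx ?ab //; last by lra.
by rewrite opprD addrA subrr add0r normrN ger0_norm.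
Qed.

Lemma four_point_R_tree : R_tree d.
Proof.
split=> //.
  move=> x y; have [S xyS] := geodesic x y; exists S; split=> // S'.
  by rewrite (geodesic_segmentE xyS) => /geodesic_segmentE ->.
move=> x y z _ _ /geodesic_segmentE -> /geodesic_segmentE -> meet.
have tri1 := d_tri y x z; have tri2 := d_tri x y z; have tri3 := d_tri z y x.
have sxy := dC x y; have sxz := dC x z; have syz := dC y z.
have xyz : d x z = d x y + d y z.
  (* The Gromov product of [x] and [z] based at [y]. The point [p] at distance [a] from [y] on the
     way to [x] is the branch point; it also lies between [y] and [z], so the hypothesis forces
     [p = y] and [a = 0]. *)
  pose a := (d x y + d y z - d x z) / 2.
  have ea : 2 * a = d x y + d y z - d x z by rewrite /a; lra.
  have [p xyp dp] : exists2 p, metric_interval x y p & d x p = d x y - a.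
    by apply: interval_point; lra.
  have pz : d p z <= d y z - a.
    have := four_point p z x y; have := dC p x; move: xyp dp; rewrite /metric_interval /= le_max.
    by move=> ? ? ? /orP[]; lra.
  have yzp : metric_interval y z p.
    have := d_tri p y z; have := dC p y; move: xyp; rewrite /metric_interval /=; lra.
  have py : p = y by have : (metric_interval x y `&` metric_interval y z) p by []; rewrite meet.
  by move: dp; rewrite py; lra.
have [S xzS] := geodesic x z; suff <- : S = metric_interval x y `|` metric_interval y z by [].
rewrite (geodesic_segmentE xzS).
have sub1 w : metric_interval x y w -> metric_interval x z w.
  rewrite /metric_interval /= => h; have := d_tri y w z; have := d_tri w x z; lra.
have sub2 w : metric_interval y z w -> metric_interval x z w.
  rewrite /metric_interval /= => h; have := d_tri y x w; have := d_tri w x z; lra.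
apply/seteqP; split=> w; last by case=> [/sub1|/sub2].
move=> xzw; have [le_w|gt_w] := leP (d x w) (d x y).
  left; have [v xyv dv] : exists2 v, metric_interval x y v & d x v = d x w.
    by apply: interval_point; rewrite metric_ge0.
  by rewrite -(interval_inj (sub1 _ xyv) xzw).
right; have [v yzv dv] : exists2 v, metric_interval y z v & d y v = d x w - d x y.
  apply: interval_point; have := metric_ge0 w z; move: xzw; rewrite /metric_interval /=; lra.
rewrite -(interval_inj (sub2 _ yzv) xzw) //.
by move: (sub2 _ yzv) (yzv); rewrite /metric_interval /=; lra.
Qed.

End trees.

(* [r] is the distance to the root and [G x y] the height at which the paths
   from the root to [x] and to [y] separate. *)
Lemma rooted_R_tree (R : realType) (T : Type) (d : T -> T -> R) (r : T -> R)
    (G : T -> T -> R) :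
    (forall x y, d x y = r x + r y - 2 * G x y) ->
    (forall x y, d x y = 0 -> x = y) ->
    (forall x, G x x = r x) -> (forall x y, G x y = G y x) ->
    (forall x y, 0 <= G x y <= r x) ->
    (forall x y z, Num.min (G x y) (G y z) <= G x z) ->
    (forall x t, 0 <= t <= r x -> exists y, r y = t /\ G x y = t) ->
  R_tree d.
Proof.
move=> dE d0 Gxx GC Gr Gu Gt.
have Gle x y : (G x y <= r x) * (G x y <= r y).
  by have /andP[_ h1] := Gr x y; have /andP[_] := Gr y x; rewrite (GC y).
have Gu' x y z : G x y <= G y z -> G x y <= G x z.
  by move=> h; have := Gu x y z; rewrite min_l.
have Gu2 x y z : G y z <= G x y -> G y z <= G x z.
  by move=> h; have := Gu x y z; rewrite min_r.
apply: four_point_R_tree.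
- split=> //.
  + by move=> x; rewrite dE Gxx; lra.
  + by move=> x y; rewrite !dE (GC y x); lra.
  + move=> y x z; rewrite !dE; have := Gle x y; have := Gle y z => -[h1 h2] [h3 h4].
    have [/Gu'|/ltW/Gu2] := leP (G x y) (G y z); lra.
(* In terms of [G] the claim is that [G x y + G z w] is at least the smaller of [G x z + G y w] and
   [G x w + G y z]; four instances of the ultrametric inequality decide it. *)
- move=> x y z w; rewrite !dE le_max.
  have := Gu x z y; have := Gu x w y; have := Gu z x w; have := Gu z y w.
  rewrite !ge_min (GC z y) (GC z x) (GC w y).
  move=> /orP[?|?] /orP[?|?] /orP[?|?] /orP[?|?]; apply/orP;
  by have [h|h] := leP (G x z + G y w) (G x w + G y z); [left|right]; lra.
- move=> x y; set m := G x y.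
  have path z : exists p : R -> T, forall t, 0 <= t <= r z -> r (p t) = t /\ G z (p t) = t.
    have [t|p pP] := @choice _ _ (fun t p => 0 <= t <= r z -> r p = t /\ G z p = t).
      by have [/Gt[p ?]|] := pselect (0 <= t <= r z); [exists p|exists z].
    by exists p.
  have [px pxP] := path x; have [py pyP] := path y.
  have [/andP[m0 mx]] := Gr x y; have [_ my] := Gle x y.
  rewrite -/m in m0 mx my.
  have same z (p : R -> T) s t :
      (forall t, 0 <= t <= r z -> r (p t) = t /\ G z (p t) = t) ->
      0 <= s <= r z -> 0 <= t <= r z -> d (p s) (p t) = `|s - t|.
    move=> pP sz tz; have [rs Gs] := pP _ sz; have [rt Gt'] := pP _ tz.
    rewrite dE rs rt.
    have [st|/ltW ts] := leP s t.
      have -> : G (p s) (p t) = s.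
        have [] := Gle (p s) (p t); have := Gu (p s) z (p t).
        by rewrite (GC _ z) Gs Gt' min_l //; lra.
      by rewrite distrC ger0_norm; lra.
    have -> : G (p s) (p t) = t.
      have [] := Gle (p s) (p t); have := Gu (p s) z (p t).
      by rewrite (GC _ z) Gs Gt' min_r //; lra.
    by rewrite ger0_norm; lra.
  (* From height [m] upwards the two paths are apart: the ultrametric inequalities force
     [G (px s) (py t) = m]. *)
  have cross s t : m <= s <= r x -> m <= t <= r y -> d (px s) (py t) = s + t - 2 * m.
    move=> sx ty; have [rs Gs] := pxP s ltac:(lra); have [rt Gt'] := pyP t ltac:(lra).
    rewrite dE rs rt; suff -> : G (px s) (py t) = m by [].
    have := Gle (px s) (py t); rewrite rs rt => -[h1 h2].
    have := Gu x y (py t); have := Gu (px s) x (py t).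
    have := Gu x (px s) (py t); have := Gu x (py t) y.
    rewrite !ge_min (GC (py t)) (GC _ x) Gs Gt' -/m.
    by move=> /orP[?|?] /orP[?|?] /orP[?|?] /orP[?|?]; lra.
  (* The geodesic descends from [x] to height [m] and then climbs to [y]. By [cross] the points
     [px m] and [py m] are at distance 0, so nothing is lost at the junction. *)
  pose c t := if t <= r x - m then px (r x - t) else py (t - r x + 2 * m).
  exists (c @` `[0, r x + r y - 2 * m]), 0, (r x + r y - 2 * m), c.
  split=> //; first by lra.
  + rewrite /c ifT; last by lra.
    apply: d0; rewrite dE subr0; have [-> e] := pxP (r x) ltac:(lra).
    by rewrite GC e; lra.
  + rewrite /c; case: ifP => h.
      have [rp Gp] := pxP (r x - (r x + r y - 2 * m)) ltac:(lra).
      apply: d0; rewrite dE rp.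
      have := Gu (px (r x - (r x + r y - 2 * m))) x y; rewrite (GC _ x) Gp -/m.
      rewrite ge_min => /orP[]; have [] := Gle (px (r x - (r x + r y - 2 * m))) y; rewrite rp; lra.
    have [rp Gp] := pyP (r x + r y - 2 * m - r x + 2 * m) ltac:(lra).
    by apply: d0; rewrite dE rp GC Gp; lra.
  + move=> s t; rewrite !in_itv /= => sI tI; rewrite /c.
    case: ifP => hs; case: ifP => ht.
    * by rewrite (same x) //; [rewrite opprB addrC addrA subrK distrC|lra|lra].
    * rewrite cross; [|lra|lra]; rewrite distrC ger0_norm; lra.
    * have -> a b : d a b = d b a by rewrite !dE (GC b); lra.
      rewrite cross; [|lra|lra]; rewrite ger0_norm; lra.
    * by rewrite (same y) //; [congr `|_|; lra|lra|lra].
Qed.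

(** * Quotients of pseudometric spaces *)

Section quotients.
Variables (R : realType) (T : Type) (D : set T) (E : T -> T -> Prop)
  (delta : T -> T -> R).
Hypothesis d_refl : forall x, D x -> delta x x = 0.
Hypothesis d_sym : forall x y, D x -> D y -> delta x y = delta y x.
Hypothesis d_tri : forall y x z, D x -> D y -> D z -> delta x z <= delta x y + delta y z.
Hypothesis d_zero : forall x y, D x -> D y -> E x y <-> delta x y = 0.

Lemma quot_class (A : quot D E) : exists x (Dx : D x), A = class E Dx.
Proof.
by case: A => S pS; have [x Dx eS] := pS; exists x, Dx; apply: eq_exist.
Qed.

Lemma class_mem x (Dx : D x) y : sval (class E Dx) y <-> D y /\ delta x y = 0.
Proof. by split=> -[Dy]; [rewrite d_zero|move=> ?; split=> //; apply/d_zero]. Qed.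

(** The triangle inequality makes [delta] constant on pairs of classes, so the choice in [quot_dist]
    has only one candidate. *)
Lemma quot_dist_class x y (Dx : D x) (Dy : D y) :
  quot_dist delta (class E Dx) (class E Dy) = delta x y.
Proof.
rewrite /quot_dist /the; case: pselect => [e|[]]; last first.
  exists (delta x y), x, y.
  by split=> //; apply/class_mem; rewrite d_refl.
case: cid => s /= [x' [y' [hx hy ->]]].
have [Dx' xx'] := (class_mem Dx x').1 hx; have [Dy' yy'] := (class_mem Dy y').1 hy.
have t1 := d_tri Dx' Dx Dy'; have t2 := d_tri Dx Dy Dy'.
have t3 := d_tri Dx Dx' Dy; have t4 := d_tri Dx' Dy' Dy.
have e1 := d_sym Dx Dx'; have e2 := d_sym Dy Dy'.
by apply/eqP; rewrite eq_le; lra.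
Qed.

Lemma quot_dist_eq0 (A B : quot D E) : quot_dist delta A B = 0 -> A = B.
Proof.
have [x [Dx ->]] := quot_class A; have [y [Dy ->]] := quot_class B.
rewrite quot_dist_class => xy; apply: eq_exist; apply/seteqP.
have yx : delta y x = 0 by rewrite d_sym.
have z0 a b c : D a -> D b -> D c -> delta a b = 0 -> delta b c = 0 -> delta a c = 0.
  move=> Da Db Dc ab bc; have := d_tri Da Db Dc; have := d_tri Da Dc Da.
  have := d_tri Dc Db Da; rewrite d_refl // (d_sym Dc Db) // (d_sym Db Da) // ab bc.
  by rewrite (d_sym Dc Da) //; lra.
split=> z [Dz] /d_zero h; split=> //; apply/d_zero => //.
  exact: z0 yx (h _ _).
exact: z0 xy (h _ _).
Qed.

End quotients.

Lemma inj_surj_bijective T U (f : T -> U) :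
  injective f -> (forall y, exists x, f x = y) -> bijective f.
Proof.
by move=> fI /choice[h fh]; exists h => // x; apply: fI; rewrite fh.
Qed.

(** A correspondence suffices in place of a map between representatives. The pseudometric laws of
    [delta'] are inherited from those of [delta] along it. *)
Lemma correspondence_isometric (R : realType) (T U : Type) (D : set T)
    (E : T -> T -> Prop) (delta : T -> T -> R)
    (D' : set U) (delta' : U -> U -> R) (rel : T -> U -> Prop) :
    (forall x, D x -> delta x x = 0) ->
    (forall x y, D x -> D y -> delta x y = delta y x) ->
    (forall y x z, D x -> D y -> D z -> delta x z <= delta x y + delta y z) ->
    (forall x y, D x -> D y -> E x y <-> delta x y = 0) ->
    (forall x, D x -> exists2 u, D' u & rel x u) ->
    (forall u, D' u -> exists2 x, D x & rel x u) ->
    (forall x y u v, D x -> D y -> D' u -> D' v -> rel x u -> rel y v ->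
      delta' u v = delta x y) ->
  isometric (@quot_dist R T D E delta)
    (@quot_dist R U D' (fun u v => delta' u v = 0) delta').
Proof.
move=> d0 dC dT dE rel_l rel_r relP.
pose E' u v := delta' u v = 0.
have d0' u : D' u -> delta' u u = 0.
  by move=> Du; have [x Dx xu] := rel_r _ Du; rewrite (relP x x) // d0.
have dC' u v : D' u -> D' v -> delta' u v = delta' v u.
  move=> Du Dv; have [x Dx xu] := rel_r _ Du; have [y Dy yv] := rel_r _ Dv.
  by rewrite (relP x y) // (relP y x) // dC.
have dT' v u w : D' u -> D' v -> D' w -> delta' u w <= delta' u v + delta' v w.
  move=> Du Dv Dw; have [x Dx xu] := rel_r _ Du; have [y Dy yv] := rel_r _ Dv.
  have [z Dz zw] := rel_r _ Dw.
  by rewrite (relP x z) // (relP x y) // (relP y z) // dT.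
have dE' u v : D' u -> D' v -> E' u v <-> delta' u v = 0 by [].
have [f fP] : exists f : quot D E -> quot D' E', forall A,
    exists x u (Dx : D x) (Du : D' u), [/\ rel x u, A = class E Dx & f A = class E' Du].
  have [A|f fP] := @choice _ _ (fun (A : quot D E) (B : quot D' E') =>
      exists x u (Dx : D x) (Du : D' u), [/\ rel x u, A = class E Dx & B = class E' Du]).
    have [x [Dx ->]] := quot_class A; have [u Du xu] := rel_l _ Dx.
    by exists (class E' Du), x, u, Dx, Du.
  by exists f.
have fD A B : quot_dist delta' (f A) (f B) = quot_dist delta A B.
  have [x [u [Dx [Du [xu -> ->]]]]] := fP A; have [y [v [Dy [Dv [yv -> ->]]]]] := fP B.
  by rewrite !quot_dist_class // (relP x y).
exists f => //; apply: inj_surj_bijective => [A B fAB|B].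
  have : quot_dist delta' (f A) (f B) = 0.
    by rewrite -fAB; have [x [u [Dx [Du [_ _ ->]]]]] := fP A; rewrite quot_dist_class ?d0'.
  by rewrite fD; apply: quot_dist_eq0.
have [v [Dv ->]] := quot_class B; have [y Dy yv] := rel_r _ Dv.
exists (class E Dy); have [x [u [Dx [Du [xu eA ->]]]]] := fP (class E Dy).
apply: (@quot_dist_eq0 _ _ _ _ delta') => //; rewrite quot_dist_class // (relP x y) //.
by rewrite -(quot_dist_class (E := E) d0 dC dT dE Dx Dy) -eA quot_dist_class // d0.
Qed.

(** * Quotients of pseudometrics given by a radius and a meeting height *)

Section rooted_quotient.
Variables (R : realType) (T : Type) (D : set T) (E : T -> T -> Prop)
  (delta : T -> T -> R) (r : T -> R) (G : T -> T -> R).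
Hypothesis deltaE : forall x y, D x -> D y -> delta x y = r x + r y - 2 * G x y.
Hypothesis delta0 : forall x y, D x -> D y -> E x y <-> delta x y = 0.
Hypothesis G_refl : forall x, D x -> G x x = r x.
Hypothesis G_sym : forall x y, D x -> D y -> G x y = G y x.
Hypothesis G_le : forall x y, D x -> D y -> 0 <= G x y <= r x.
Hypothesis G_ultra : forall y x z, D x -> D y -> D z -> Num.min (G x y) (G y z) <= G x z.

Lemma rooted_dist_refl x : D x -> delta x x = 0.
Proof. by move=> Dx; rewrite deltaE // G_refl //; ring. Qed.

Lemma rooted_dist_sym x y : D x -> D y -> delta x y = delta y x.
Proof. by move=> Dx Dy; rewrite !deltaE // (G_sym Dx Dy); ring. Qed.

Lemma rooted_dist_triangle y x z : D x -> D y -> D z -> delta x z <= delta x y + delta y z.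
Proof.
move=> Dx Dy Dz; rewrite !deltaE //; have := G_ultra Dx Dy Dz.
have /andP[_ h1] := G_le Dy Dx; have /andP[_ h2] := G_le Dy Dz; have := G_sym Dx Dy.
by rewrite ge_min => ? /orP[]; lra.
Qed.

Hypothesis truncate : forall x t, D x -> 0 <= t <= r x ->
  exists2 y, D y & r y = t /\ G x y = t.

Lemma rooted_quot_R_tree : R_tree (@quot_dist R T D E delta).
Proof.
have [rep repP] : exists rep : quot D E -> T, forall A, exists DA : D (rep A), A = class E DA.
  have [A|rep repP] := @choice _ _ (fun (A : quot D E) x => exists Dx : D x, A = class E Dx).
    by have [x [Dx ->]] := quot_class A; exists x, Dx.
  by exists rep.
have Drep A : D (rep A) by have [] := repP A.
have dE A B : quot_dist delta A B = delta (rep A) (rep B).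
  have [DA eA] := repP A; have [DB eB] := repP B; rewrite {1}eA {1}eB.
  exact: (quot_dist_class rooted_dist_refl rooted_dist_sym rooted_dist_triangle delta0).
apply: (@rooted_R_tree _ _ _ (r \o rep) (fun A B => G (rep A) (rep B))).
- by move=> A B; rewrite dE deltaE.
- by move=> A B; apply:
  (quot_dist_eq0 rooted_dist_refl rooted_dist_sym rooted_dist_triangle delta0).
- by move=> A; rewrite G_refl.
- by move=> A B; apply: G_sym.
- by move=> A B; apply: G_le.
- by move=> A B C; apply: G_ultra.
move=> A t /= tA; have [y Dy [ry Gy]] := truncate (Drep A) tA.
pose B := class E Dy; exists B; have DB := Drep B.
(* The representative chosen in the class of [y] may differ from [y]. Being at distance 0, it has
   the same radius and the same meeting height with the other point. *)
have dyB : delta y (rep B) = 0.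
  have [DB' eB] := repP B.
  rewrite -(quot_dist_class rooted_dist_refl rooted_dist_sym rooted_dist_triangle delta0 Dy DB').
  rewrite -eB /B (quot_dist_class rooted_dist_refl rooted_dist_sym rooted_dist_triangle delta0).
  exact: rooted_dist_refl.
have /andP[_ h1] := G_le Dy DB; have /andP[_ h2] := G_le DB Dy.
have h3 := G_sym Dy DB; move: dyB; rewrite (deltaE Dy DB) => h4.
have rB : r (rep B) = t by lra.
split=> //; have := G_ultra (Drep A) Dy DB; have /andP[_] := G_le DB (Drep A).
have := G_sym (Drep A) DB.
have -> : G y (rep B) = t by lra.
by rewrite Gy minxx => ? ? ?; lra.
Qed.

End rooted_quotient.

(** * Hyperbolic trigonometry up to bounded error *)

Section trigonometry.
Variable R : realType.
Implicit Types x y : R.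

Lemma le_sqr_norm x y : `|x| <= `|y| -> x ^+ 2 <= y ^+ 2.
Proof.
move=> xy; rewrite -(real_normK (num_real x)) -(real_normK (num_real y)).
by rewrite lerXn2r // nnegrE.
Qed.

Lemma sin_mean_value x y : x <= y ->
  exists2 c, x <= c <= y & sin y - sin x = cos c * (y - x).
Proof.
move=> xy.
have sin_cont : {within `[x, y], continuous (@sin R)}.
  by apply: continuous_subspaceT => z; exact: continuous_sin.
have [c cxy e] := MVT_segment xy (fun z _ => is_derive_sin z) sin_cont.
by exists c => //; rewrite in_itv /= in cxy.
Qed.

Lemma sin_lipschitz x y : `|sin x - sin y| <= `|x - y|.
Proof.
wlog xy : x y / y <= x.
  by have [xy|/ltW xy] := leP y x; last rewrite distrC (distrC x); apply.
have [c _ ->] := sin_mean_value xy.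
by rewrite normrM ler_piMl // cos_max.
Qed.

Lemma normr_sin_le x : `|sin x| <= `|x|.
Proof. by have := sin_lipschitz x 0; rewrite sin0 !subr0. Qed.

Lemma cos_ge_sqr x : 1 - x ^+ 2 / 2 <= cos x.
Proof.
rewrite [x in cos x](_ : _ = (x / 2) *+ 2); last by rewrite -mulr_natr divfK.
rewrite cos_mulr2n cos2sin2.
have : sin (x / 2) ^+ 2 <= (x / 2) ^+ 2 by rewrite le_sqr_norm // normr_sin_le.
have -> : (x / 2) ^+ 2 = x ^+ 2 / 4 by field.
by lra.
Qed.

(** By the mean value theorem, since the cosine is at least 1/2 on the unit interval. *)
Lemma normr_sin_ge x : `|x| <= 1 -> `|x| / 2 <= `|sin x|.
Proof.
wlog x0 : x / 0 <= x.
  move=> H; have [x0|/ltW x0] := leP 0 x; first exact: H.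
  by rewrite -normrN -(normrN (sin x)) -sinN; apply: H; lra.
rewrite (ger0_norm x0) => x1; have [c] := sin_mean_value x0; rewrite sin0 !subr0 => cx ->.
have hc := cos_ge_sqr c; rewrite normrM (ger0_norm x0) mulrC.
rewrite ler_wpM2r //; apply: le_trans (ler_norm _); apply: le_trans hc.
by have : c ^+ 2 <= 1; [rewrite expr_le1 //; lra|lra].
Qed.

Lemma normr_sinD x y : `|sin (x + y)| <= `|sin x| + `|sin y|.
Proof.
rewrite sinD; apply: le_trans (ler_normD _ _) _; rewrite !normrM.
by apply: lerD; rewrite ?ler_piMr ?ler_piMl ?cos_max.
Qed.

Lemma normr_sinDpi x : `|sin (x + pi)| = `|sin x|.
Proof. by rewrite sinDpi normrN. Qed.

End trigonometry.

(** * The distance of the hyperbolic plane in polar coordinates *)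

Section hyperbolic.
Variable R : realType.
Implicit Types a b p q : R.

Lemma cosh_ge a : expR a / 2 <= Defs.cosh a.
Proof. by rewrite /Defs.cosh; have := expR_ge0 (- a); lra. Qed.

Lemma cosh_le a : 0 <= a -> Defs.cosh a <= expR a.
Proof.
move=> a0; have : expR (- a) <= expR a by rewrite ler_expR; lra.
by rewrite /Defs.cosh; lra.
Qed.

Lemma cosh_surj (c : R) : 1 <= c -> exists2 d, 0 <= d & Defs.cosh d = c.
Proof.
move=> c1; set s := Num.sqrt (c ^+ 2 - 1).
have s0 : 0 <= s by exact: sqrtr_ge0.
have s2 : s ^+ 2 = c ^+ 2 - 1 by rewrite sqr_sqrtr // subr_ge0 expr_ge1 //; lra.
have cs : 0 < c + s by lra.
(* The inverse hyperbolic cosine; [c + s] and [c - s] are inverse to each other. *)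
exists (ln (c + s)); first by apply: ln_ge0; lra.
have e : (c + s)^-1 = c - s.
  apply: (mulfI (lt0r_neq0 cs)); rewrite divff ?lt0r_neq0 //.
  have -> : (c + s) * (c - s) = c ^+ 2 - s ^+ 2 by ring.
  by rewrite s2; ring.
by rewrite /Defs.cosh expRN lnK ?posrE // e; lra.
Qed.

(* [- ln sep] is the height at which the segments from the origin to the two
   points cease to fellow travel. *)
Definition sep a p b q : R :=
  Num.max (Num.max (expR (- a)) (expR (- b))) `|sin ((p - q) / 2)|.

Lemma sep_gt0 a p b q : 0 < sep a p b q.
Proof. by rewrite /sep !lt_max expR_gt0. Qed.

(** The half-angle formula removes the cancellation from the law of cosines: for nonnegative [a] and
    [b] all terms of the bracket are nonnegative, so its size can be estimated. *)
Lemma hyperbolic_cosine a p b q :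
  let w := sin ((p - q) / 2) in
  Defs.cosh a * Defs.cosh b - Defs.sinh a * Defs.sinh b * cos (p - q) =
  expR (a + b) / 2 * (expR (- a) ^+ 2 + expR (- b) ^+ 2 +
    (1 - expR (- a) ^+ 2) * (1 - expR (- b) ^+ 2) * w ^+ 2).
Proof.
move=> w; have -> : cos (p - q) = 1 - 2 * w ^+ 2.
  rewrite [p - q](_ : _ = ((p - q) / 2) *+ 2); last by rewrite -[RHS]mulr_natr divfK.
  by rewrite cos_mulr2n cos2sin2 -/w; lra.
rewrite /Defs.cosh /Defs.sinh expRD !expRN; have := expR_eq0 a; have := expR_eq0 b.
move: (expR a) (expR b) => A B B0 A0; field.
by rewrite A0 B0.
Qed.

(** The bracket [Q] lies between [mu ^+ 2] and [3 * mu ^+ 2], and the hyperbolic cosine of [d]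
    between [expR d / 2] and [expR d]. Hence [expR d] agrees with [expR L] up to a factor 3, which
    is less than [expR 2]. *)
Lemma H_dist_bounds a p b q : 0 <= a -> 0 <= b ->
  `|H_dist [:: a; p; b; q] - (a + b + 2 * ln (sep a p b q))| <= 2.
Proof.
move=> a0 b0; set mu := sep a p b q; have mu0 : 0 < mu := sep_gt0 a p b q.
set w := sin ((p - q) / 2).
set Q := expR (- a) ^+ 2 + expR (- b) ^+ 2 +
    (1 - expR (- a) ^+ 2) * (1 - expR (- b) ^+ 2) * w ^+ 2.
have cE := hyperbolic_cosine a p b q; rewrite -/w -/Q /= in cE.
have w1 : w ^+ 2 <= 1 by rewrite -(expr1n _ 2) le_sqr_norm // normr1 sin_max.
have w0 : 0 <= w ^+ 2 by exact: sqr_ge0.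
have E (t : R) : 0 <= t -> 0 < expR (- t) ^+ 2 <= 1.
  by move=> t0; rewrite exprn_gt0 ?expR_gt0 // expr_le1 ?expR_ge0 // expR_le1 oppr_le0.
have E1 := E _ a0; have E2 := E _ b0.
have muE : [/\ expR (- a) ^+ 2 <= mu ^+ 2, expR (- b) ^+ 2 <= mu ^+ 2 & w ^+ 2 <= mu ^+ 2].
  have le2 x : 0 <= x -> x <= mu -> x ^+ 2 <= mu ^+ 2.
    by move=> x0 xm; rewrite lerXn2r // nnegrE // ltW.
  split; last (rewrite -(real_normK (num_real w)));
    by apply: le2; rewrite ?expR_ge0 // /mu /sep !le_max lexx ?orbT.
have muE' : mu ^+ 2 = expR (- a) ^+ 2 \/ mu ^+ 2 = expR (- b) ^+ 2 \/ mu ^+ 2 = w ^+ 2.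
  rewrite -(real_normK (num_real w)) /mu /sep -/w.
  case: (leP _ `|w|) => _; first by right; right.
  by case: leP => _; [right; left|left].
(* In the lower bound the case where [mu] is the sine is the delicate one: the factor [k] costs at
   most [1 - k <= e1 + e2], which the first two terms restore. *)
have Qmu : [/\ mu ^+ 2 <= Q, Q <= 3 * mu ^+ 2 & expR (- a) ^+ 2 + expR (- b) ^+ 2 <= Q].
  case: muE => m1 m2 m3; rewrite /Q.
  move: (expR (- a) ^+ 2) (expR (- b) ^+ 2) (w ^+ 2) E1 E2 w0 w1 m1 m2 m3 muE'.
  move=> e1 e2 v /andP[e10 e11] /andP[e20 e21] v0 v1 m1 m2 m3 muE'.
  set k := (1 - e1) * (1 - e2).
  have k0 : 0 <= k by rewrite mulr_ge0 //; lra.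
  have k1 : k <= 1 by rewrite mulr_ile1 //; lra.
  have kE : k = 1 - e1 - e2 + e1 * e2 by rewrite /k; ring.
  have e12 : 0 <= e1 * e2 by rewrite mulr_ge0 //; lra.
  have kv0 : 0 <= k * v by rewrite mulr_ge0.
  have kv1 : k * v <= v by rewrite ler_piMl.
  have kv2 : (1 - k) * v <= 1 - k by rewrite ler_piMr //; lra.
  by split; [case: muE' => [|[]]; lra|lra|lra].
(* The prescribed hyperbolic cosine is at least 1, by comparison of arithmetic and geometric means,
   so a distance exists and the default value in [H_dist] does not occur. *)
have AB : 1 <= expR (a + b) / 2 * Q.
  have h : 2 * (expR (- a) * expR (- b)) <= Q.
    have [_ _] := Qmu; apply: le_trans.
    have := sqr_ge0 (expR (- a) - expR (- b)); rewrite sqrrB; lra.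
  have h1 : expR (a + b) * (expR (- a) * expR (- b)) = 1.
    by rewrite -!expRD -(expR0); congr expR; ring.
  have h2 : expR (a + b) * (2 * (expR (- a) * expR (- b))) <= expR (a + b) * Q.
    by rewrite ler_wpM2l // expR_ge0.
  by lra.
rewrite /H_dist /the; case: pselect => [e|[]]; last first.
  have [d d0 dE] := cosh_surj AB; exists d; split=> //.
  by rewrite dE -cE.
case: cid => d /= [d0]; rewrite cE => dE.
move: Qmu dE; rewrite -/Q; move: Q {e AB cE} => Q Qmu dE.
set L := a + b + 2 * ln mu.
have LE : expR L = expR (a + b) * mu ^+ 2.
  have -> : L = (a + b) + (ln mu + ln mu) by rewrite /L; ring.
  by rewrite expRD [expR (ln mu + _)]expRD lnK ?posrE.
have [Q1 Q2 _] := Qmu; have := cosh_ge d; have := cosh_le d0; rewrite dE => h1 h2.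
have AB0 := expR_ge0 (a + b).
have h3 : expR L <= expR (a + b) * Q by rewrite LE ler_wpM2l.
have h4 : expR (a + b) * Q <= 3 * expR L.
  by rewrite LE mulrCA ler_wpM2l.
have e2 : 3 <= expR 2 :> R by have := expR_ge1Dx (2 : R); lra.
have dL : expR d <= expR (L + 2).
  rewrite expRD; apply: (@le_trans _ _ (expR L * 3)); first by lra.
  by rewrite ler_wpM2l // expR_ge0.
have Ld : expR L <= expR (d + 2).
  rewrite [expR (d + 2)]expRD; apply: (@le_trans _ _ (expR d * 3)).
    by have := expR_ge0 d; lra.
  by rewrite ler_wpM2l // expR_ge0.
by move: dL Ld; rewrite !ler_expR ler_norml; lra.
Qed.

(** Subadditivity of the absolute sine gives the ultrametric inequality for [sep] up to a factor 2,
    whose logarithm is at most 1. *)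
Lemma ln_sep_ultra a p b q c r :
  ln (sep a p c r) <= Num.max (ln (sep a p b q)) (ln (sep b q c r)) + 1.
Proof.
have s1 := sep_gt0 a p b q; have s2 := sep_gt0 b q c r; have s3 := sep_gt0 a p c r.
have h : sep a p c r <= 2 * Num.max (sep a p b q) (sep b q c r).
  set m := Num.max (sep a p b q) _.
  have [m1 m2] : sep a p b q <= m /\ sep b q c r <= m.
    by split; rewrite /m le_max lexx ?orbT.
  have m0 : 0 < m by apply: lt_le_trans m1.
  have [a1 w1] : expR (- a) <= m /\ `|sin ((p - q) / 2)| <= m.
    by move: m1; rewrite /sep !ge_max => /andP[/andP[-> _] ->].
  have [c1 w2] : expR (- c) <= m /\ `|sin ((q - r) / 2)| <= m.
    by move: m2; rewrite /sep !ge_max => /andP[/andP[_ ->] ->].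
  have := normr_sinD ((p - q) / 2) ((q - r) / 2).
  have -> : (p - q) / 2 + (q - r) / 2 = (p - r) / 2 by field.
  by move=> w3; rewrite {1}/sep !ge_max; lra.
have ln2 : ln 2 <= 1 :> R by have := @le_ln1Dx R 1; rewrite (_ : 1 + 1 = 2 :> R) //; lra.
have : ln (sep a p c r) <= ln (2 * Num.max (sep a p b q) (sep b q c r)).
  by rewrite ler_ln ?posrE // mulr_gt0 // lt_max s1.
have l1 : ln (sep a p b q) <= Num.max (ln (sep a p b q)) (ln (sep b q c r)).
  by rewrite le_max lexx.
have l2 : ln (sep b q c r) <= Num.max (ln (sep a p b q)) (ln (sep b q c r)).
  by rewrite le_max lexx orbT.
rewrite lnM; [|by rewrite posrE|by rewrite posrE lt_max s1].
have [m|/ltW m] := leP (sep a p b q) (sep b q c r); lra.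
Qed.

End hyperbolic.

(** * Standard parts *)

Section germ_arithmetic.
Variables (R : realType) (M : nonstandard_model R) (xs : seq (hyper M)).
Hypothesis xs0 : (0 < size xs)%N.
Implicit Types F G : seq R -> R.

Lemma germD F G : hfun F xs + hfun G xs = hfun (fun s => F s + G s) xs.
Proof. exact: hfun2_germ. Qed.

Lemma germN F : - hfun F xs = hfun (fun s => - F s) xs.
Proof. exact: hfun1_germ. Qed.

Lemma germM F G : hfun F xs * hfun G xs = hfun (fun s => F s * G s) xs.
Proof. exact: hfun2_germ. Qed.

Lemma germV F : (hfun F xs)^-1 = hfun (fun s => (F s)^-1) xs.
Proof. exact: hfun1_germ. Qed.

Lemma germ_norm F : `|hfun F xs| = hfun (fun s => `|F s|) xs.
Proof. exact: hfun1_germ. Qed.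

Lemma germ_lt F G : hfun F xs < hfun G xs <-> hrel (fun s => F s < G s) xs.
Proof. exact: hltb_germ. Qed.

Lemma germ_le F G : hfun F xs <= hfun G xs <-> hrel (fun s => F s <= G s) xs.
Proof.
rewrite leNgt; split=> [/negP|] h.
  have /hrel_not : ~ hrel (fun s => G s < F s) xs by rewrite -germ_lt.
  by move=> /(_ xs0); apply: hrel_imp => // s _ /negP; rewrite leNgt.
apply/negP; rewrite germ_lt; apply/hrel_not => //; move: h.
by apply: hrel_imp => // s _; rewrite leNgt => /negP.
Qed.

Lemma germ_max F G :
  Num.max (hfun F xs) (hfun G xs) = hfun (fun s => Num.max (F s) (G s)) xs.
Proof.
have [/germ_le|/germ_lt] := leP (hfun F xs) (hfun G xs).
  by move=> h; apply/eq_germ => //; move: h; apply: hrel_imp => // s _; case: leP.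
by move=> h; apply/eq_germ => //; move: h; apply: hrel_imp => // s _; case: leP.
Qed.

End germ_arithmetic.

Section hyperreals.
Variables (R : realType) (M : nonstandard_model R).
Implicit Types (x y z : hyper M) (r t : R).
Notation "r %:H" := (hreal M r) (at level 1, format "r %:H").

Lemma hltE x y : hlt x y <-> x < y.
Proof. by split=> /asboolP. Qed.

Lemma hdivE x y : hdiv x y = x / y.
Proof.
move: x y; apply: germ_ind2 => xs F G xs0.
by rewrite /hdiv hfun2_germ // (germV xs0) (germM xs0).
Qed.

Lemma hrealD r t : (r + t)%:H = r%:H + t%:H.
Proof. by rewrite (hfun_cst r [:: 0]) (hfun_cst t [:: 0]) germD // -hfun_cst. Qed.

Lemma hrealN r : (- r)%:H = - r%:H.
Proof. by rewrite (hfun_cst r [:: 0]) germN // -hfun_cst. Qed.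

Lemma hrealB r t : (r - t)%:H = r%:H - t%:H.
Proof. by rewrite hrealD hrealN. Qed.

Lemma hrealM r t : (r * t)%:H = r%:H * t%:H.
Proof. by rewrite (hfun_cst r [:: 0]) (hfun_cst t [:: 0]) germM // -hfun_cst. Qed.

Lemma hrealV r : (r^-1)%:H = (r%:H)^-1.
Proof. by rewrite (hfun_cst r [:: 0]) germV // -hfun_cst. Qed.

Lemma hreal0 : 0%:H = 0. Proof. by []. Qed.
Lemma hreal1 : 1%:H = 1. Proof. by []. Qed.

Lemma hreal_nat n : (n%:R)%:H = n%:R.
Proof. by elim: n => [//|n IH]; rewrite -!natr1 hrealD IH. Qed.

Lemma hreal_lt r t : (r%:H < t%:H) = (r < t).
Proof.
apply/idP/idP; rewrite (hfun_cst r [:: 0]) (hfun_cst t [:: 0]) germ_lt //.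
  move=> h; apply: contrapT => rt; have /hrel_not : hrel (fun=> ~ r < t) [:: 0 : hyper M].
    by apply: hrel_true.
  by apply.
by move=> rt; apply: hrel_true.
Qed.

Lemma hreal_le r t : (r%:H <= t%:H) = (r <= t).
Proof. by rewrite !leNgt hreal_lt. Qed.

Lemma hreal_norm r : `|r|%:H = `|r%:H|.
Proof. by rewrite (hfun_cst r [:: 0]) germ_norm // -hfun_cst. Qed.

Lemma infinitesimalP x : infinitesimal x <-> forall r, 0 < r -> `|x| < r%:H.
Proof. by split=> h r r0; apply/hltE; apply: h. Qed.

Lemma hfiniteP x : hfinite x <-> exists r, `|x| < r%:H.
Proof. by split=> -[r xr]; exists r; apply/hltE. Qed.

Lemma hfinite_le x r : `|x| <= r%:H -> hfinite x.
Proof.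
move=> xr; apply/hfiniteP; exists (r + 1); apply: le_lt_trans xr _.
by rewrite hreal_lt ltrDl.
Qed.

Lemma hfinite_real r : hfinite r%:H.
Proof. by apply: (@hfinite_le _ `|r|); rewrite hreal_norm. Qed.

Lemma hfinite_mono x y : `|x| <= `|y| -> hfinite y -> hfinite x.
Proof.
by move=> xy /hfiniteP[r yr]; apply/hfiniteP; exists r; apply: le_lt_trans yr.
Qed.

Lemma hfiniteD x y : hfinite x -> hfinite y -> hfinite (x + y).
Proof.
move=> /hfiniteP[r xr] /hfiniteP[t yt]; apply/hfiniteP; exists (r + t).
by apply: le_lt_trans (ler_normD _ _) _; rewrite hrealD ltrD.
Qed.

Lemma hfiniteN x : hfinite x -> hfinite (- x).
Proof. by apply: hfinite_mono; rewrite normrN. Qed.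

Lemma hfiniteB x y : hfinite x -> hfinite y -> hfinite (x - y).
Proof. by move=> fx /hfiniteN; apply: hfiniteD. Qed.

Lemma hfiniteM x y : hfinite x -> hfinite y -> hfinite (x * y).
Proof.
move=> /hfiniteP[r xr] /hfiniteP[t yt]; apply/hfiniteP; exists (r * t).
by rewrite normrM hrealM ltr_pM.
Qed.

Lemma infinitesimal_finite x : infinitesimal x -> hfinite x.
Proof. by move=> /infinitesimalP h; apply/hfiniteP; exists 1; apply: h. Qed.

Lemma infinitesimal_mono x y : `|x| <= `|y| -> infinitesimal y -> infinitesimal x.
Proof.
by move=> xy /infinitesimalP h; apply/infinitesimalP => r /h; apply: le_lt_trans.
Qed.

Lemma infinitesimal0 : infinitesimal (0 : hyper M).
Proof. by apply/infinitesimalP => r r0; rewrite normr0 -hreal0 hreal_lt. Qed.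

Lemma infinitesimalN x : infinitesimal x -> infinitesimal (- x).
Proof. by apply: infinitesimal_mono; rewrite normrN. Qed.

Lemma infinitesimalD x y : infinitesimal x -> infinitesimal y -> infinitesimal (x + y).
Proof.
move=> /infinitesimalP xi /infinitesimalP yi; apply/infinitesimalP => r r0.
apply: le_lt_trans (ler_normD _ _) _.
by rewrite [r](splitr r) hrealD ltrD ?xi ?yi ?divr_gt0.
Qed.

Lemma infinitesimalB x y : infinitesimal x -> infinitesimal y -> infinitesimal (x - y).
Proof. by move=> fx /infinitesimalN; apply: infinitesimalD. Qed.

Lemma infinitesimalMl x y : infinitesimal x -> hfinite y -> infinitesimal (x * y).
Proof.
move=> /infinitesimalP xi /hfiniteP[t yt]; apply/infinitesimalP => r r0.
have t0 : 0 < t by rewrite -hreal_lt hreal0; apply: le_lt_trans yt.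
have -> : r%:H = (r / t)%:H * t%:H by rewrite -hrealM divfK // gt_eqF.
by rewrite normrM ltr_pM // xi // divr_gt0.
Qed.

Lemma infinitesimalMr x y : hfinite x -> infinitesimal y -> infinitesimal (x * y).
Proof. by move=> fx yi; rewrite mulrC; apply: infinitesimalMl. Qed.

Lemma infinitesimal_real r : infinitesimal r%:H -> r = 0.
Proof.
move=> /infinitesimalP h; apply: contrapT => /eqP r0.
by have := h `|r|; rewrite normr_gt0 => /(_ r0); rewrite -hreal_norm ltxx.
Qed.

Lemma not_infinitesimal x : ~ infinitesimal x -> exists2 r, 0 < r & r%:H <= `|x|.
Proof.
move=> xi; apply: contrapT => h; apply: xi; apply/infinitesimalP => r r0.
by rewrite ltNge; apply/negP => rx; apply: h; exists r.
Qed.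

Lemma hfiniteV x : ~ infinitesimal x -> hfinite x^-1.
Proof.
move=> /not_infinitesimal[r r0 rx]; apply: (@hfinite_le _ r^-1).
have r0' : 0 < r%:H by rewrite -hreal0 hreal_lt.
by rewrite hrealV normfV lef_pV2 ?posrE // (lt_le_trans r0').
Qed.

Lemma infinitesimalV x : infinitesimal x -> x != 0 -> ~ hfinite x^-1.
Proof.
move=> xi x0 xf; have := infinitesimalMl xi xf; rewrite divff // -hreal1.
by move/infinitesimal_real/eqP; rewrite oner_eq0.
Qed.

(** Completeness of the reals: the standard part is the supremum of the reals below [x]. *)
Lemma st_exists x : hfinite x -> exists r, infinitesimal (x - r%:H).
Proof.
move=> /hfiniteP[k xk]; pose A := [set r : R | r%:H <= x].
move: xk; rewrite ltr_norml => /andP[kx xk].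
have supA : has_sup A.
  split; first by exists (- k); rewrite /A /= hrealN ltW.
  by exists k => r /= rx; rewrite -hreal_le (le_trans rx) // ltW.
exists (sup A); apply/infinitesimalP => r r0; rewrite ltr_norml; apply/andP; split.
  have [t /= tx st] := sup_adherent r0 supA.
  rewrite ltrBrDl -hrealN -hrealD; apply: lt_le_trans tx.
  by rewrite hreal_lt; lra.
rewrite ltrBlDl -hrealD ltNge; apply/negP => h.
by have := sup_upper_bound supA h; lra.
Qed.

Lemma st_unique x r : infinitesimal (x - r%:H) -> st x = r.
Proof.
rewrite /st /the => xr; case: pselect => [e|[]]; last by exists r.
case: cid => s /= xs; apply/eqP; rewrite -subr_eq0; apply/eqP.
apply: infinitesimal_real; have -> : (s - r)%:H = (x - r%:H) - (x - s%:H).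
  by rewrite hrealB; ring.
exact: infinitesimalB.
Qed.

Lemma stP x : hfinite x -> infinitesimal (x - (st x)%:H).
Proof. by move=> /st_exists[r xr]; rewrite (st_unique xr). Qed.

Lemma st_real r : st r%:H = r.
Proof. by apply: st_unique; rewrite subrr; exact: infinitesimal0. Qed.

Lemma stD x y : hfinite x -> hfinite y -> st (x + y) = st x + st y.
Proof.
move=> /stP xi /stP yi; apply: st_unique.
rewrite hrealD. rewrite opprD. rewrite addrACA.
exact: (infinitesimalD xi yi).
Qed.

Lemma stN x : hfinite x -> st (- x) = - st x.
Proof.
by move=> /stP xi; apply: st_unique; rewrite hrealN -opprD; exact: infinitesimalN.
Qed.

Lemma stB x y : hfinite x -> hfinite y -> st (x - y) = st x - st y.
Proof. by move=> fx fy; rewrite stD ?stN //; exact: hfiniteN. Qed.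

Lemma stM x y : hfinite x -> hfinite y -> st (x * y) = st x * st y.
Proof.
move=> fx fy; apply: st_unique; rewrite hrealM.
have -> : x * y - (st x)%:H * (st y)%:H =
   x * (y - (st y)%:H) + (x - (st x)%:H) * (st y)%:H by ring.
apply: infinitesimalD; first by apply: infinitesimalMr => //; exact: stP.
by apply: infinitesimalMl; [exact: stP|exact: hfinite_real].
Qed.

Lemma st_infinitesimal x : infinitesimal x -> st x = 0.
Proof. by move=> xi; apply: st_unique; rewrite hreal0 subr0. Qed.

Lemma st_eq0 x : hfinite x -> st x = 0 -> infinitesimal x.
Proof. by move=> /stP + x0; rewrite x0 hreal0 subr0. Qed.

Lemma st_eq x y : hfinite y -> infinitesimal (x - y) -> st x = st y.
Proof.
move=> fy xy; apply: st_unique; have := infinitesimalD xy (stP fy).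
by congr infinitesimal; ring.
Qed.

Lemma st_ge0 x : hfinite x -> 0 <= x -> 0 <= st x.
Proof.
move=> fx x0; rewrite leNgt; apply/negP => sx.
have /infinitesimalP /(_ (- st x)) := stP fx.
rewrite oppr_gt0 => /(_ sx); rewrite hrealN.
have sx0 : (st x)%:H <= 0 by rewrite -hreal0 hreal_le; exact: ltW.
by rewrite ger0_norm; lra.
Qed.

Lemma st_le x y : hfinite x -> hfinite y -> x <= y -> st x <= st y.
Proof.
by move=> fx fy xy; rewrite -subr_ge0 -stB //; apply: st_ge0;
  [exact: hfiniteB|rewrite subr_ge0].
Qed.

(** The gap is a real number. In [level_gap] it separates orders of magnitude. *)
Lemma st_lt x y : hfinite x -> hfinite y -> st x < st y ->
  exists2 r, 0 < r & x + r%:H <= y.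
Proof.
move=> fx fy xy; exists ((st y - st x) / 2); first by lra.
rewrite leNgt; apply/negP => /ltW /st_le.
rewrite stD ?st_real //; last exact: hfinite_real.
move=> /(_ fy (hfiniteD fx (hfinite_real _))); lra.
Qed.

End hyperreals.

(** * Elementary functions of hyperreal numbers *)

Section elementary_functions.
Variables (R : realType) (M : nonstandard_model R).
Implicit Types (x y z : hyper M) (r t : R).
Notation "r %:H" := (hreal M r) (at level 1, format "r %:H").

Definition hexp : hyper M -> hyper M := hfun1 (@expR R).
Definition hsin : hyper M -> hyper M := hfun1 (@sin R).
Definition hsep (a p b q : hyper M) : hyper M :=
  hfun (fun s => sep s`_0 s`_1 s`_2 s`_3) [:: a; p; b; q].

Lemma germ_ind6 (P : hyper M -> hyper M -> hyper M -> hyper M -> hyper M -> hyper M -> Prop) :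
  (forall xs F1 F2 F3 F4 F5 F6, (0 < size xs)%N -> P (hfun F1 xs) (hfun F2 xs) (hfun F3 xs)
    (hfun F4 xs) (hfun F5 xs) (hfun F6 xs)) ->
  forall a b c d e f, P a b c d e f.
Proof.
move=> H a b c d e f.
have := H [:: a; b; c; d; e; f] (fun s => s`_0) (fun s => s`_1) (fun s => s`_2)
  (fun s => s`_3) (fun s => s`_4) (fun s => s`_5) isT.
by rewrite -!hfun_proj.
Qed.

Lemma germ_ind4 (P : hyper M -> hyper M -> hyper M -> hyper M -> Prop) :
  (forall xs F1 F2 F3 F4, (0 < size xs)%N ->
    P (hfun F1 xs) (hfun F2 xs) (hfun F3 xs) (hfun F4 xs)) ->
  forall a b c d, P a b c d.
Proof.
move=> H a b c d; apply: (@germ_ind6 (fun a b c d _ _ => P a b c d) _ a b c d a b).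
by move=> xs F1 F2 F3 F4 _ _ xs0; exact: H.
Qed.

Lemma hexp_gt0 x : 0 < hexp x.
Proof.
elim/germ_ind1: x => xs F xs0; rewrite -hreal0 (hfun_cst 0 xs) /hexp (hfun1_germ xs0).
by apply/(germ_lt xs0)/(hrel_true xs0) => s _; exact: expR_gt0.
Qed.

Lemma hexp_ge1D x : 1 + x <= hexp x.
Proof.
elim/germ_ind1: x => xs F xs0; rewrite -hreal1 (hfun_cst 1 xs) /hexp (hfun1_germ xs0) (germD xs0).
by apply/(germ_le xs0)/(hrel_true xs0) => s _; exact: expR_ge1Dx.
Qed.

Lemma hexpB x y : hexp (x - y) = hexp x / hexp y.
Proof.
move: x y; apply: germ_ind2 => xs F G xs0; rewrite /hexp (germN xs0) (germD xs0).
rewrite !(hfun1_germ xs0) (germV xs0) (germM xs0); congr hfun.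
by apply/funext => s; rewrite expRB.
Qed.

Lemma hexp_le1 x : x <= 0 -> hexp x <= 1.
Proof.
elim/germ_ind1: x => xs F xs0; rewrite -hreal0 -hreal1 (hfun_cst 0 xs) (hfun_cst 1 xs).
rewrite /hexp (hfun1_germ xs0) !(germ_le xs0); apply: (hrel_imp xs0) => s _.
by rewrite expR_le1.
Qed.

Lemma hexp_le x y : x <= y -> hexp x <= hexp y.
Proof.
move: x y; apply: germ_ind2 => xs F G xs0; rewrite /hexp !(hfun1_germ xs0) !(germ_le xs0).
by apply: (hrel_imp xs0) => s _; rewrite ler_expR.
Qed.

Lemma hexpK x : hln (hexp x) = x.
Proof.
elim/germ_ind1: x => xs F xs0; rewrite /hexp /hln !(hfun1_germ xs0); congr hfun.
by apply/funext => s; rewrite expRK.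
Qed.

Lemma hlnK x : 0 < x -> hexp (hln x) = x.
Proof.
elim/germ_ind1: x => xs F xs0; rewrite -hreal0 (hfun_cst 0 xs) /hexp /hln !(hfun1_germ xs0).
rewrite (germ_lt xs0) (eq_germ xs0); apply: (hrel_imp xs0) => s _ F0.
by rewrite lnK ?posrE.
Qed.

Lemma hln_le x y : 0 < x -> x <= y -> hln x <= hln y.
Proof.
move: x y; apply: germ_ind2 => xs F G xs0; rewrite -hreal0 (hfun_cst 0 xs) /hln !(hfun1_germ xs0).
rewrite (germ_lt xs0) !(germ_le xs0) => F0 FG; have := hrel_and xs0 F0 FG.
by apply: (hrel_imp xs0) => s _ [h1 h2]; rewrite ler_ln ?posrE // (lt_le_trans h1).
Qed.

Lemma hln_div x y : 0 < x -> 0 < y -> hln (x / y) = hln x - hln y.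
Proof.
move=> x0 y0; rewrite -{1}(hlnK x0) -{1}(hlnK y0) -hexpB; exact: hexpK.
Qed.

Lemma hln_real r : hln r%:H = (ln r)%:H.
Proof. by rewrite (hfun_cst r [:: 0]) /hln hfun1_germ // -hfun_cst. Qed.

Lemma hln1 : hln 1 = 0 :> hyper M.
Proof. by rewrite -hreal1 hln_real ln1. Qed.

Lemma hln_le0 x : 0 < x -> x <= 1 -> hln x <= 0.
Proof. by move=> x0 x1; rewrite -hln1; exact: hln_le. Qed.

Lemma hsin_le x : `|hsin x| <= `|x|.
Proof.
elim/germ_ind1: x => xs F xs0; rewrite /hsin (hfun1_germ xs0) !(germ_norm xs0).
by apply/(germ_le xs0)/(hrel_true xs0) => s _; exact: normr_sin_le.
Qed.

Lemma hsin_ge x : `|x| <= 1 -> `|x| / 2 <= `|hsin x|.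
Proof.
elim/germ_ind1: x => xs F xs0; rewrite -(hreal_nat M 2) -hreal1 (hfun_cst 1 xs) (hfun_cst 2%:R xs).
rewrite /hsin (hfun1_germ xs0) (germV xs0) !(germ_norm xs0) (germM xs0) !(germ_le xs0).
by apply: (hrel_imp xs0) => s _; exact: normr_sin_ge.
Qed.

Lemma hsin_lipschitz x y : `|hsin x - hsin y| <= `|x - y|.
Proof.
move: x y; apply: germ_ind2 => xs F G xs0.
rewrite /hsin !(hfun1_germ xs0) !(germN xs0) !(germD xs0) !(germ_norm xs0).
by apply/(germ_le xs0)/(hrel_true xs0) => s _; exact: sin_lipschitz.
Qed.

Lemma hsin_real r : hsin r%:H = (sin r)%:H.
Proof. by rewrite (hfun_cst r [:: 0]) /hsin hfun1_germ // -hfun_cst. Qed.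

Lemma hsinDpi x : `|hsin (x + pi%:H)| = `|hsin x|.
Proof.
elim/germ_ind1: x => xs F xs0; rewrite (hfun_cst pi xs) (germD xs0) /hsin !(hfun1_germ xs0).
rewrite !(germ_norm xs0); congr hfun; apply/funext => s; exact: normr_sinDpi.
Qed.

Lemma hsinBpi x : `|hsin (x - pi%:H)| = `|hsin x|.
Proof. by rewrite -hsinDpi subrK. Qed.

Lemma hsep_germ xs (F1 F2 F3 F4 : seq R -> R) : (0 < size xs)%N ->
  hsep (hfun F1 xs) (hfun F2 xs) (hfun F3 xs) (hfun F4 xs) =
  hfun (fun s => sep (F1 s) (F2 s) (F3 s) (F4 s)) xs.
Proof.
exact: (hfun_comp (fun s => sep s`_0 s`_1 s`_2 s`_3) [:: F1; F2; F3; F4]).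
Qed.

Lemma hsepE a p b q :
  hsep a p b q = Num.max (Num.max (hexp (- a)) (hexp (- b))) `|hsin ((p - q) / 2)|.
Proof.
move: a p b q; apply: germ_ind4 => xs F1 F2 F3 F4 xs0; rewrite (hsep_germ _ _ _ _ xs0).
rewrite -(hreal_nat M 2) (hfun_cst 2%:R xs) !(germN xs0) (germD xs0) (germV xs0) (germM xs0).
rewrite /hexp /hsin !(hfun1_germ xs0) (germ_norm xs0) !(germ_max xs0); congr hfun.
Qed.

Lemma H_dist_hsep a p b q : 0 <= a -> 0 <= b ->
  `|hfun (@H_dist R) [:: a; p; b; q] - (a + b + 2 * hln (hsep a p b q))| <= 2.
Proof.
move: a p b q; apply: germ_ind4 => xs F1 F2 F3 F4 xs0; rewrite (hsep_germ _ _ _ _ xs0).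
have -> : hfun (@H_dist R) [:: hfun F1 xs; hfun F2 xs; hfun F3 xs; hfun F4 xs] =
    hfun (fun s => H_dist [:: F1 s; F2 s; F3 s; F4 s]) xs.
  exact: (hfun_comp (@H_dist R) [:: F1; F2; F3; F4]).
rewrite -hreal0 -(hreal_nat M 2) (hfun_cst 2%:R xs) (hfun_cst 0 xs) /hln (hfun1_germ xs0).
rewrite (germM xs0) !(germD xs0) (germN xs0) !(germD xs0) (germ_norm xs0) !(germ_le xs0).
move=> h1 h2; have := hrel_and xs0 h1 h2; apply: (hrel_imp xs0) => s _ [].
exact: H_dist_bounds.
Qed.

Lemma hln_hsep_ultra a p b q c z :
  hln (hsep a p c z) <= Num.max (hln (hsep a p b q)) (hln (hsep b q c z)) + 1.
Proof.
move: a p b q c z; apply: germ_ind6 => xs F1 F2 F3 F4 F5 F6 xs0.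
rewrite !(hsep_germ _ _ _ _ xs0) -hreal1 (hfun_cst 1 xs) /hln !(hfun1_germ xs0).
rewrite (germ_max xs0) (germD xs0).
by apply/(germ_le xs0)/(hrel_true xs0) => s _; exact: ln_sep_ultra.
Qed.

Lemma H_coordP x y : hrel (@H_coord R) [:: x; y] <-> 0 <= x /\ 0 <= y < (2 * pi)%:H.
Proof.
move: x y; apply: germ_ind2 => xs F G xs0.
rewrite -hreal0 (hfun_cst 0 xs) (hfun_cst (2 * pi) xs).
have e := hrel_hfun (@H_coord R) (Fs := [:: F; G]) isT xs0; rewrite [map _ _]/= in e.
rewrite e; split.
  move=> h; split; last (apply/andP; split);
    [apply/(germ_le xs0)|apply/(germ_le xs0)|apply/(germ_lt xs0)];
    by move: h; apply: (hrel_imp xs0) => s _ [h1 /andP[h2 h3]].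
move=> [/(germ_le xs0) h1 /andP[/(germ_le xs0) h2 /(germ_lt xs0) h3]].
have := hrel_and xs0 h1 (hrel_and xs0 h2 h3); apply: (hrel_imp xs0) => s _ [? [? ?]].
by split=> //; apply/andP.
Qed.

Lemma sim_hln x y : 0 < x -> 0 < y -> hfinite (x / y) -> hfinite (y / x) ->
  hfinite (hln x - hln y).
Proof.
have bound u v : 0 < u -> 0 < v -> hfinite (u / v) -> exists r, hln u - hln v <= r%:H.
  move=> u0 v0 /hfiniteP[r uv]; exists (ln r); rewrite -hln_real -hln_div //.
  have uv0 : 0 < u / v by rewrite divr_gt0.
  by apply: hln_le => //; rewrite -(ger0_norm (ltW uv0)) ltW.
move=> x0 y0 /(bound _ _ x0 y0)[r h1] /(bound _ _ y0 x0)[t h2].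
apply: (@hfinite_le _ _ _ (Num.max r t)); rewrite ler_norml.
have m1 : r%:H <= (Num.max r t)%:H by rewrite hreal_le le_max lexx.
have m2 : t%:H <= (Num.max r t)%:H by rewrite hreal_le le_max lexx orbT.
by lra.
Qed.

(** By [exp s >= 1 + s], the quotient [y / x] is at least [r / eps]. This weak bound suffices to
    make [x / y] infinitesimal when [eps] is. *)
Lemma hln_gap eps x y r : 0 < eps -> 0 < x -> 0 < y -> 0 < r ->
  r%:H <= eps * (hln y - hln x) -> x / y <= eps * (r^-1)%:H.
Proof.
move=> e0 x0 y0 r0 h; have rH0 : 0 < r%:H by rewrite -hreal0 hreal_lt.
have h1 : y / x = hexp (hln y - hln x) by rewrite hexpB !hlnK.
have h2 := hexp_ge1D (hln y - hln x); rewrite -h1 in h2.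
have h3 : r%:H / eps <= hln y - hln x by rewrite ler_pdivrMr // mulrC.
have h4 : r%:H / eps <= y / x by lra.
rewrite hrealV -[leLHS]invf_div -[leRHS]invf_div -ler_pV2 ?invrK //;
  by rewrite inE unitfE ?invr_eq0 ?gt_eqF ?invr_gt0 ?divr_gt0.
Qed.

End elementary_functions.

(** * Orders of magnitude *)

Section well_order.
Variables (T : eqType) (prec : rel T).
Hypothesis prec_wo : wochoice.well_order prec.

Lemma well_order_min (A : set T) x : A x ->
  exists2 m, A m & forall y, A y -> prec m y.
Proof.
move=> Ax; have [|m [[mA mP] _]] := prec_wo (A := [pred x | `[< A x >]]).
  by exists x; apply/asboolP.
exists m; first exact/asboolP.
by move=> y Ay; apply: mP; apply/asboolP.
Qed.

Lemma well_order_refl x : prec x x.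
Proof. by have [y -> h] := @well_order_min [set x] x erefl; apply: h. Qed.

(** [well_order] provides a unique minimum in each non-empty subset. The order axioms are extracted
    from it by means of subsets with few elements. *)
Lemma well_order_anti x y : prec x y -> prec y x -> x = y.
Proof.
move=> xy yx; have [|m [_ uniq]] := prec_wo (A := [pred z | (z == x) || (z == y)]).
  by exists x; rewrite inE eqxx.
rewrite -(uniq x) ?(uniq y) //; split; rewrite ?inE ?eqxx ?orbT // => z;
  by rewrite inE => /orP[] /eqP -> //; exact: well_order_refl.
Qed.

Lemma well_order_trans : transitive prec.
Proof.
move=> y x z xy yz.
have [m mA mP] := @well_order_min [set t | t = x \/ t = y \/ t = z] x (or_introl erefl).
have mx := mP x (or_introl erefl).
have my := mP y (or_intror (or_introl erefl)).
have mz := mP z (or_intror (or_intror erefl)).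
case: mA => [e|[e|e]]; rewrite e in mx my mz => //.
  by rewrite (well_order_anti xy mx).
by rewrite -(well_order_anti yz my).
Qed.

Lemma well_order_total x y : prec x y \/ prec y x.
Proof.
have [m [] -> mP] := @well_order_min [set t | t = x \/ t = y] x (or_introl erefl).
  by left; apply: mP; right.
by right; apply: mP; left.
Qed.

End well_order.

(** * The order of [Lambda] in terms of ratios *)

Section order_of_magnitude.
Variables (R : realType) (M : nonstandard_model R).
Implicit Types (x y z : hyper M).

Lemma ratio_trans x y z : y != 0 -> x / z = (x / y) * (y / z).
Proof. by move=> y0; rewrite mulrA divfK. Qed.

Lemma small_or_large x y : infinitesimal (x / y) \/ hfinite (y / x).
Proof.
have [?|/hfiniteV] := pselect (infinitesimal (x / y)); first by left.
by rewrite invf_div; right.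
Qed.

Lemma small_not_large x y : x != 0 -> y != 0 -> infinitesimal (x / y) -> ~ hfinite (y / x).
Proof.
move=> x0 y0 xy; rewrite -invf_div; apply: (infinitesimalV xy).
by apply: mulf_neq0 x0 _; rewrite invr_eq0.
Qed.

Lemma sim_refl x : x != 0 -> sim x x.
Proof.
move=> x0; have h : hfinite (hdiv x x) by rewrite hdivE divff // -hreal1; exact: hfinite_real.
by split.
Qed.

Lemma simP x y : sim x y <-> hfinite (x / y) /\ hfinite (y / x).
Proof. by rewrite /sim !hdivE. Qed.

Lemma sim_sym x y : sim x y -> sim y x.
Proof. by case. Qed.

Lemma sim_trans x y z : y != 0 -> sim x y -> sim y z -> sim x z.
Proof.
move=> y0 /simP[xy yx] /simP[yz zy]; apply/simP; split.
  by rewrite (ratio_trans _ _ y0); exact: (hfiniteM xy yz).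
by rewrite (ratio_trans _ _ y0); exact: (hfiniteM zy yx).
Qed.

Lemma nonzeroP x : nonzero x <-> x != 0.
Proof. by split=> /eqP. Qed.

Lemma Lambda_ex (l : Lambda M) : exists x, sval l x.
Proof.
case: l => S pS; have [x Dx eS] := pS; exists x => /=; rewrite eS; split=> //.
exact/sim_refl/nonzeroP.
Qed.

Lemma Lambda_mem (l : Lambda M) x y : sval l x -> sval l y <-> y != 0 /\ sim x y.
Proof.
case: l => S pS /=; have [z z0 eS] := pS; rewrite eS => -[x0 zx].
have z0' := (nonzeroP z).1 z0; have x0' := (nonzeroP x).1 x0.
split=> -[y0 h]; split; try exact/nonzeroP.
  exact: (sim_trans z0' (sim_sym zx) h).
exact: (sim_trans x0' zx h).
Qed.

Lemma Lambda_neq0 (l : Lambda M) x : sval l x -> x != 0.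
Proof. by move=> lx; have [] := (Lambda_mem x lx).1 lx. Qed.

Lemma Lambda_eq (l m : Lambda M) x y : sval l x -> sval m y -> sim x y -> l = m.
Proof.
move=> lx my xy; have x0 := Lambda_neq0 lx; have y0 := Lambda_neq0 my.
have : sval l = sval m.
  apply/seteqP; split=> z; rewrite (Lambda_mem _ lx) (Lambda_mem _ my) => -[z0 h]; split=> //.
    exact: (sim_trans x0 (sim_sym xy) h).
  exact: (sim_trans y0 xy h).
by case: l m {lx my} => S pS [S' pS'] /= e; exact: eq_exist.
Qed.

Lemma Lambda_sim (l : Lambda M) x y : sval l x -> sval l y -> sim x y.
Proof. by move=> lx /(Lambda_mem _ lx)[]. Qed.

(** A finite ratio of members of different classes is infinitesimal, since otherwise its inverse
    would be finite too. Changing members multiplies the ratio by finite factors. *)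
Lemma lt_LambdaE (l m : Lambda M) x y : sval l x -> sval m y ->
  lt_Lambda l m <-> infinitesimal (x / y).
Proof.
move=> lx my; have x0 := Lambda_neq0 lx; have y0 := Lambda_neq0 my; split.
  move=> [lm [x' [y' [lx' my' /hltE xy']]]].
  have x0' := Lambda_neq0 lx'; have y0' := Lambda_neq0 my'.
  have fxy : hfinite (x' / y').
    apply: (@hfinite_le _ _ _ 1); rewrite normrM normfV ler_pdivrMr ?normr_gt0 //.
    by rewrite hreal1 mul1r ltW.
  have ixy : infinitesimal (x' / y').
    have [//|fyx] := small_or_large x' y'.
    by case: lm; apply: (Lambda_eq lx' my'); apply/simP.
  have /simP[f1 _] := Lambda_sim lx lx'; have /simP[f2 _] := Lambda_sim my' my.
  rewrite (ratio_trans _ _ x0') (ratio_trans x' _ y0').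
  exact: (infinitesimalMr f1 (infinitesimalMl ixy f2)).
move=> xy; split.
  move=> e; rewrite -e in my; have /simP[_] := Lambda_sim lx my.
  exact: small_not_large.
exists x, y; split=> //; apply/hltE; change (`|x| < `|y|).
have /infinitesimalP /(_ 1 ltr01) := xy.
by rewrite normrM normfV ltr_pdivrMr ?normr_gt0 // hreal1 mul1r.
Qed.

Lemma le_LambdaE (l m : Lambda M) x y : sval l x -> sval m y ->
  le_Lambda l m <-> hfinite (x / y).
Proof.
move=> lx my; split.
  case=> [e|/(lt_LambdaE lx my)]; last exact: infinitesimal_finite.
  by rewrite -e in my; have /simP[] := Lambda_sim lx my.
move=> fxy; have [fyx|nyx] := pselect (hfinite (y / x)).
  by left; apply: (Lambda_eq lx my); apply/simP.
by right; apply/(lt_LambdaE lx my); have [//|] := small_or_large x y.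
Qed.

Lemma lt_Lambda_nle (l m : Lambda M) : lt_Lambda l m <-> ~ le_Lambda m l.
Proof.
have [x lx] := Lambda_ex l; have [y my] := Lambda_ex m.
have x0 := Lambda_neq0 lx; have y0 := Lambda_neq0 my.
rewrite (lt_LambdaE lx my) (le_LambdaE my lx); split; first exact: small_not_large.
by have [//|] := small_or_large x y.
Qed.

Lemma le_Lambda_total (l m : Lambda M) : le_Lambda l m \/ lt_Lambda m l.
Proof. by have [?|/lt_Lambda_nle] := pselect (le_Lambda l m); [left|right]. Qed.

Lemma lt_Lambda_le (l m : Lambda M) : lt_Lambda l m -> le_Lambda l m.
Proof. by right. Qed.

Lemma le_Lambda_refl (l : Lambda M) : le_Lambda l l.
Proof. by left. Qed.

Lemma le_Lambda_trans (l m n : Lambda M) : le_Lambda l m -> le_Lambda m n -> le_Lambda l n.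
Proof.
have [x lx] := Lambda_ex l; have [y my] := Lambda_ex m; have [z nz] := Lambda_ex n.
rewrite (le_LambdaE lx my) (le_LambdaE my nz) (le_LambdaE lx nz) => xy yz.
by rewrite (ratio_trans _ _ (Lambda_neq0 my)); exact: (hfiniteM xy yz).
Qed.

Lemma le_Lambda_anti (l m : Lambda M) : le_Lambda l m -> le_Lambda m l -> l = m.
Proof. by move=> + ml; case=> // /lt_Lambda_nle. Qed.

Lemma lt_Lambda_irr (l : Lambda M) : ~ lt_Lambda l l.
Proof. by move=> /lt_Lambda_nle; apply; exact: le_Lambda_refl. Qed.

Definition magnitude x (x0 : x != 0) : Lambda M := class (@sim R M) ((nonzeroP x).2 x0).

Lemma magnitude_mem x (x0 : x != 0) : sval (magnitude x0) x.
Proof. by split; [exact/nonzeroP|exact: sim_refl]. Qed.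

Lemma lambda0_mem : sval (lambda0 M) 1.
Proof. by split; [exact/nonzeroP/oner_neq0|apply: sim_refl; exact: oner_neq0]. Qed.

Lemma lt_lambda0 (l : Lambda M) x : sval l x -> lt_Lambda l (lambda0 M) <-> infinitesimal x.
Proof. by move=> lx; rewrite (lt_LambdaE lx lambda0_mem) divr1. Qed.

Lemma le_lambda0 (l : Lambda M) x : sval l x -> le_Lambda l (lambda0 M) <-> hfinite x.
Proof. by move=> lx; rewrite (le_LambdaE lx lambda0_mem) divr1. Qed.

Variable prec : rel (hyper M).
Hypothesis prec_wo : wochoice.well_order prec.

Lemma repr_mem (l : Lambda M) : sval l (Defs.repr prec l).
Proof.
rewrite /Defs.repr; case: pselect => [e|_] /=; first by rewrite e; exact: lambda0_mem.
have [x lx] := Lambda_ex l.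
rewrite /the; case: pselect => [e|[]].
  by case: cid => y /= [].
by have [m lm mP] := well_order_min prec_wo lx; exists m.
Qed.

Lemma repr_neq0 (l : Lambda M) : Defs.repr prec l != 0.
Proof. exact: Lambda_neq0 (repr_mem l). Qed.

Lemma lt_repr (l m : Lambda M) :
  lt_Lambda l m <-> infinitesimal (Defs.repr prec l / Defs.repr prec m).
Proof. exact: lt_LambdaE (repr_mem l) (repr_mem m). Qed.

Lemma le_repr (l m : Lambda M) : le_Lambda l m <-> hfinite (Defs.repr prec l / Defs.repr prec m).
Proof. exact: le_LambdaE (repr_mem l) (repr_mem m). Qed.

End order_of_magnitude.

(** * Expansions of infinitesimals *)

Section expansion.
Variables (R : realType) (M : nonstandard_model R) (prec : rel (hyper M)).
Hypothesis prec_wo : wochoice.well_order prec.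
Implicit Types (u v a x y : hyper M) (l m n : Lambda M).
Notation a_ l := (Defs.repr prec l).

Definition prec_min (A : set (hyper M)) : hyper M :=
  the 0 [set x | A x /\ forall y, A y -> prec x y].

Lemma prec_minP A x : A x -> A (prec_min A) /\ forall y, A y -> prec (prec_min A) y.
Proof.
move=> Ax; rewrite /prec_min /the; case: pselect => [e|[]]; first by case: cid.
by have [m mA mP] := well_order_min prec_wo Ax; exists m.
Qed.

Lemma prec_min_eq A x : A x -> (forall y, A y -> prec x y) -> prec_min A = x.
Proof.
move=> Ax xP; have [mA mP] := prec_minP Ax.
by apply: (well_order_anti prec_wo); [exact: mP|exact: xP].
Qed.

Definition ball_min a u := prec_min [set y | hfinite ((y - u) / a)].

(* The coefficient at the order of magnitude of [a] of the expansion of [u] in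
   which the partial sums are the least elements of the balls around [u]. *)
Definition coef a u := st ((u - ball_min a u) / a).

Lemma ball_minP a u :
  hfinite ((u - ball_min a u) / a) /\ forall y, hfinite ((y - u) / a) -> prec (ball_min a u) y.
Proof.
have uu : hfinite ((u - u) / a).
  by rewrite subrr mul0r; exact/infinitesimal_finite/infinitesimal0.
have [h1 h2] := @prec_minP [set y | hfinite ((y - u) / a)] u uu.
split; last exact: h2.
by rewrite -opprB mulNr; exact: (hfiniteN h1).
Qed.

Lemma ball_min_eq a u v : hfinite ((u - v) / a) -> ball_min a u = ball_min a v.
Proof.
move=> uv; apply: (congr1 prec_min); apply/seteqP; split=> y /= h.
  have -> : (y - v) / a = (y - u) / a + (u - v) / a by rewrite -mulrDl; congr (_ / a); ring.
  exact: (hfiniteD h uv).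
have -> : (y - u) / a = (y - v) / a - (u - v) / a by rewrite -mulrBl; congr (_ / a); ring.
exact: (hfiniteB h uv).
Qed.

(** Both points lie in one ball and share its least element, which cancels in the difference. *)
Lemma coef_sub a u v : hfinite ((u - v) / a) -> coef a u - coef a v = st ((u - v) / a).
Proof.
move=> uv; rewrite /coef (ball_min_eq uv); have [h _] := ball_minP a v.
have -> : (u - ball_min a v) / a = (u - v) / a + (v - ball_min a v) / a.
  by rewrite -mulrDl; congr (_ / a); ring.
by rewrite (stD uv h) addrK.
Qed.

Lemma coef_small a u v : infinitesimal ((u - v) / a) -> coef a u = coef a v.
Proof.
move=> uv; apply/eqP; rewrite -subr_eq0 coef_sub ?st_infinitesimal //.
exact: infinitesimal_finite.
Qed.

Lemma coef_eq_small a u v : hfinite ((u - v) / a) -> coef a u = coef a v ->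
  infinitesimal ((u - v) / a).
Proof.
by move=> uv /eqP; rewrite -subr_eq0 (coef_sub uv) => /eqP; exact: st_eq0.
Qed.

Lemma coef_shift a u (r : R) : a != 0 -> coef a (u + hreal M r * a) = coef a u + r.
Proof.
move=> a0; have e : (u + hreal M r * a - u) / a = hreal M r.
  by rewrite addrC addKr mulfK.
have h := coef_sub (a := a) (u := u + hreal M r * a) (v := u).
rewrite e st_real in h.
by apply/eqP; rewrite [eqbRHS]addrC -subr_eq; apply/eqP; exact: (h (hfinite_real _ _)).
Qed.

Lemma coef_center a u : ball_min a u = u -> coef a u = 0.
Proof. by rewrite /coef => ->; rewrite subrr mul0r st_infinitesimal //; exact: infinitesimal0. Qed.

Lemma coef_neq0_prec a u : coef a u <> 0 -> prec (ball_min a u) u /\ ball_min a u <> u.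
Proof.
move=> c0; split; last by move=> /coef_center.
by apply: (ball_minP a u).2; rewrite subrr mul0r; exact/infinitesimal_finite/infinitesimal0.
Qed.

(** The ball for [a] is contained in the larger ball for [b], so its least element comes later. If
    the two were equal, [u] would be infinitely close to it on the scale [b] and its coefficient
    there would vanish. *)
Lemma ball_min_prec a b u : a != 0 -> b != 0 -> infinitesimal (a / b) ->
  coef b u <> 0 -> prec (ball_min b u) (ball_min a u) /\ ball_min b u <> ball_min a u.
Proof.
move=> a0 b0 ab cb; have [h _] := ball_minP a u.
have small : infinitesimal ((u - ball_min a u) / b).
  rewrite (ratio_trans _ _ a0); exact: (infinitesimalMr h ab).
split.
  apply: (ball_minP b u).2; rewrite -opprB mulNr.
  exact: (hfiniteN (infinitesimal_finite small)).
by move=> e; apply: cb; rewrite /coef e (st_infinitesimal small).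
Qed.

(* The first coordinate of a branch is an angle, not a coefficient, hence the
   separate treatment of [lambda0]. *)
Definition coef_support u : set (Lambda M) :=
  [set l | le_Lambda l (lambda0 M) /\ (l = lambda0 M \/ coef (a_ l) u <> 0)].

Lemma rev_well_ordered_sub (S S' : set (Lambda M)) :
  S `<=` S' -> rev_well_ordered S' -> rev_well_ordered S.
Proof.
move=> SS' wo A AS; apply: wo => l lA.
by apply: mem_set; apply: SS'; apply: set_mem; exact: (AS l lA).
Qed.

Lemma rev_well_ordered_max (S : set (Lambda M)) :
    (forall A, A `<=` S -> (exists l, A l) -> exists2 l, A l & forall m, A m -> le_Lambda m l) ->
  rev_well_ordered S.
Proof.
move=> H A AS [l0 lA]; have [||l Al lP] := H [set l | l \in A].
- by move=> l /= lA'; apply: set_mem; exact: (AS l lA').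
- by exists l0.
exists l; split; first by split=> // m mA; apply/asboolP; apply: lP.
move=> m [mA mP]; apply: le_Lambda_anti; last exact: lP.
exact/asboolP/mP.
Qed.

Lemma rev_well_ordered_has_max (S A : set (Lambda M)) : rev_well_ordered S ->
  A `<=` S -> (exists l, A l) -> exists2 l, A l & forall m, A m -> le_Lambda m l.
Proof.
move=> wo AS [l0 Al0]; have [||l [[lA lP] _]] := wo [pred l | `[< A l >]].
- by move=> l /asboolP/AS Sl; exact: (mem_set Sl).
- by exists l0; apply/asboolP.
exists l; first exact/asboolP.
by move=> m Am; apply/asboolP/lP/asboolP.
Qed.

(** Apart from [lambda0], the greatest element of a subset is the index whose ball has the
    [prec]-least centre, since [ball_min_prec] makes centres move forward as the balls shrink. *)
Lemma coef_support_wo u : rev_well_ordered (coef_support u).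
Proof.
apply: rev_well_ordered_max => A AS [l0 Al0].
have [Al|nA] := pselect (A (lambda0 M)).
  by exists (lambda0 M) => // m /AS [].
have AS' l : A l -> coef (a_ l) u <> 0.
  by move=> Al; have [_ [e|//]] := AS _ Al; rewrite e in Al.
have [_ [l Al <-] lP] := @well_order_min _ _ prec_wo [set ball_min (a_ l) u | l in A]
  (ball_min (a_ l0) u) (ex_intro2 _ _ l0 Al0 erefl).
exists l => // m Am; have [//|/(lt_repr prec_wo) lm] := le_Lambda_total m l.
have [p ne] := ball_min_prec (repr_neq0 prec_wo l) (repr_neq0 prec_wo m) lm (AS' _ Am).
have lm' := lP _ (ex_intro2 _ _ m Am erefl).
by case: ne; exact: (well_order_anti prec_wo p lm').
Qed.

End expansion.

Lemma card_le_inj T U (A : set T) (B : set U) (f : T -> U) :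
  (forall x, A x -> B (f x)) -> (forall x y, A x -> A y -> f x = f y -> x = y) ->
  card_le A B.
Proof.
move=> AB inj; have fA : f @` A `<=` B by move=> _ [x Ax <-]; exact: AB.
apply: card_le_trans (subset_card_le fA).
have : card_eq (f @` A) A.
  by apply: inj_card_eq => x y /set_mem Ax /set_mem Ay; exact: inj.
by rewrite card_eq_le => /andP[].
Qed.

Lemma card_lt_le T U V (A : set T) (B : set U) (C : set V) :
  card_le A B -> card_lt B C -> card_lt A C.
Proof.
move=> AB [BC CB]; split; first exact: card_le_trans BC.
by move=> CA; apply: CB; exact: card_le_trans AB.
Qed.

Lemma card_lt_le_trans T U V (A : set T) (B : set U) (C : set V) :
  card_lt A B -> card_le B C -> card_lt A C.
Proof.
move=> [AB BA] BC; split; first exact: card_le_trans BC.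
by move=> CA; apply: BA; exact: card_le_trans CA.
Qed.

(** Needed for sets of formulas, which form a bare type; the axiom of choice supplies the structure
    required by sequences. *)
Lemma finite_set_list T (F : set T) : finite_set F -> exists s, forall x, F x -> List.In x s.
Proof.
elim/Pchoice: T F => T F /finite_seqP[s ->]; exists s => x /=.
elim: s => [//|y s IH]; rewrite inE => /orP[/eqP ->|/IH]; first by left.
by right.
Qed.

(** * Points with prescribed coefficients *)

Section realization.
Variables (R : realType) (M : nonstandard_model R) (prec : rel (hyper M)).
Hypothesis prec_init : initial_well_order prec.
Hypothesis M_saturated : saturated M.
Implicit Types (u v a x y z : hyper M) (l m n : Lambda M).
Notation a_ l := (Defs.repr prec l).
Notation hyperT := [set: hyper M].
Let prec_wo : wochoice.well_order prec := prec_init.1.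

(** The hypothesis bounds strict segments, and the closed segment of [u] lies in the strict segment
    of any later element. If [u] were the last element, its strict segment would have full
    cardinality. *)
Lemma prec_segment_card u : card_lt [set y | prec y u] hyperT.
Proof.
have [[v [uv vu]]|max_u] := pselect (exists v, prec u v /\ v <> u).
  apply: card_lt_le (prec_init.2 v); apply: subset_card_le => y /= yu; split.
    exact: (well_order_trans prec_wo yu uv).
  by move=> e; apply: vu; apply: (well_order_anti prec_wo) => //; rewrite -e.
have all_u y : prec y u.
  have [//|uy] := well_order_total prec_wo y u.
  have [->|yu] := pselect (y = u); first exact: well_order_refl.
  by case: max_u; exists y.
suff h : card_le hyperT [set y | prec y u /\ y <> u].
  by have [_] := prec_init.2 u.
(* Removing [u] from [hyper] does not change the cardinality. *)
apply: (@card_le_inj _ _ _ _ (fun x => if u <= x then x + 1 else x)).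
  move=> x _ /=; split=> //; case: ifP => [ux e|/negP ux e]; last by apply: ux; rewrite e.
  by move: ux; rewrite -e; lra.
move=> x y _ _; case: ifP => ux; case: ifP => uy //.
- exact: addIr.
- by move=> e; move/negbT: uy; rewrite -ltNge => uy; lra.
- by move=> e; move/negbT: ux; rewrite -ltNge => ux; lra.
Qed.

(** Centres of balls for distinct indices of the support are distinct and come strictly before [u].
    This leaves [u] itself as the image of [lambda0]. *)
Lemma coef_support_card u : card_lt (coef_support prec u) hyperT.
Proof.
apply: card_lt_le (prec_segment_card u).
pose f l := if pselect (l = lambda0 M) then u else ball_min prec (a_ l) u.
have fP l : coef_support prec u l -> l <> lambda0 M ->
    [/\ coef prec (a_ l) u <> 0, prec (f l) u, f l <> u & f l = ball_min prec (a_ l) u].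
  move=> [_ [//|c0]] l0; have [h1 h2] := coef_neq0_prec prec_wo c0.
  by rewrite /f; case: pselect.
have f0 : f (lambda0 M) = u by rewrite /f; case: pselect.
apply: (@card_le_inj _ _ _ _ f) => [l Sl|l m Sl Sm].
  have [->|l0] := pselect (l = lambda0 M); last by have [] := fP l Sl l0.
  by rewrite f0; exact: well_order_refl.
have [->|l0] := pselect (l = lambda0 M); have [->|m0] := pselect (m = lambda0 M).
- by [].
- by rewrite f0 => /esym e; have [_ _ /(_ e)] := fP m Sm m0.
- by rewrite f0 => e; have [_ _ /(_ e)] := fP l Sl l0.
have [cl _ _ ->] := fP l Sl l0; have [cm _ _ ->] := fP m Sm m0.
have [le_lm|/(lt_repr prec_wo) ml] := le_Lambda_total l m; last first.
  have [_ ne] := ball_min_prec prec_wo (repr_neq0 prec_wo m) (repr_neq0 prec_wo l) ml cl.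
  by move=> /ne.
case: le_lm => [//|/(lt_repr prec_wo) lm].
have [_ ne] := ball_min_prec prec_wo (repr_neq0 prec_wo l) (repr_neq0 prec_wo m) lm cm.
by move=> /esym/ne.
Qed.

Lemma hrel_dist_lt x y z :
  hrel (fun s => `|s`_0 - s`_1| < s`_2) [:: x; y; z] <-> `|x - y| < z.
Proof.
move: x y z; apply: germ_ind3 => xs F G K xs0.
rewrite (germN xs0) (germD xs0) (germ_norm xs0) (germ_lt xs0).
exact: (hrel_hfun (fun s => `|s`_0 - s`_1| < s`_2) (Fs := [:: F; G; K])).
Qed.

(** Membership in [S_0] is part of the formula because saturation yields only an element of the
    model. *)
Definition dist_lt_fm (y z : hyper M) : formula R M unit :=
  And (Defs.Mem (Var R M tt) (Cst M unit (stage R 0)))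
      (rel_fm 3 (fun s => `|s`_0 - s`_1| < s`_2)
        [:: Var R M tt; Par R unit (sval y); Par R unit (sval z)]).

Lemma satisfies_dist_lt_fm x y z :
  satisfies (sval x) (dist_lt_fm y z) <-> `|x - y| < z.
Proof.
rewrite -hrel_dist_lt /satisfies sat_And sat_rel_fm.
by split=> [[_]//|h]; split=> //; exact: (svalP x).
Qed.

(** Finitely many of the balls contain the centre of the one with the least index. Saturation
    applies since there are fewer balls than hyperreals, hence fewer than elements of the model. *)
Lemma nested_balls (S : set (Lambda M)) (t b : Lambda M -> hyper M) :
    card_lt S hyperT -> (exists l, S l) ->
    (forall l m, S l -> S m -> le_Lambda m l -> `|t m - t l| < b l) ->
  exists x, forall l, S l -> `|x - t l| < b l.
Proof.
move=> Scard [l0 Sl0] nested.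
pose T := (fun l => dist_lt_fm (t l) (b l)) @` S.
have Tcard : card_lt T [set: M].
  apply: (@card_lt_le_trans _ _ _ _ hyperT).
    by apply: card_lt_le Scard; exact: card_image_le.
  by apply: (@card_le_inj _ _ _ _ sval) => // x y _ _; exact: hyper_eq.
have [F FT /finite_set_list[s Fs]|x xT] := M_saturated Tcard.
  (* Along the list, [n] is the least index met so far; asking for every later centre allows [n] to
     be lowered. *)
  have [n Sn nP] : exists2 n, S n & forall phi, List.In phi s -> F phi ->
      forall m, S m -> le_Lambda m n -> satisfies (sval (t m)) phi.
    elim: s {Fs} => [|phi s [n Sn nP]]; first by exists l0.
    have [/[dup] Fphi /FT[l Sl ephi]|nF] := pselect (F phi); last first.
      by exists n => // psi [<- //|]; exact: nP.
    have phiP m : S m -> le_Lambda m l -> satisfies (sval (t m)) phi.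
      by move=> Sm ml; rewrite -ephi; apply/satisfies_dist_lt_fm; exact: nested.
    have [ln|/lt_Lambda_le nl] := le_Lambda_total l n.
      exists l => // psi [<- _|ps Fpsi m Sm ml]; first exact: phiP.
      exact: (nP psi ps Fpsi m Sm (le_Lambda_trans ml ln)).
    exists n => // psi [<- _|ps]; last exact: nP.
    by move=> m Sm mn; apply: phiP => //; exact: (le_Lambda_trans mn nl).
  exists (sval (t n)) => phi Fphi; apply: (nP phi (Fs phi Fphi)) => //.
  exact: le_Lambda_refl.
have : satisfies x (dist_lt_fm (t l0) (b l0)) by apply: xT; exists l0.
rewrite /satisfies sat_And => -[x0 _].
exists (exist _ x x0) => l Sl; apply/satisfies_dist_lt_fm.
by apply: xT; exists l.
Qed.

Let small_sub u v : infinitesimal u -> infinitesimal v -> infinitesimal (u - v).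
Proof. by move=> iu iv; exact: (infinitesimalB iu iv). Qed.

(** Otherwise the order of magnitude [l] of [u - v] is at least that of [m], and equal coefficients
    at [l] make [u - v] infinitesimal with respect to [a_ l], contrary to the choice of [l]. *)
Lemma coef_separation u v m :
    infinitesimal u -> infinitesimal v ->
    (forall l, lt_Lambda l (lambda0 M) -> le_Lambda m l ->
      coef prec (a_ l) u = coef prec (a_ l) v) ->
  infinitesimal ((u - v) / a_ m).
Proof.
move=> iu iv uv; have [->|uv0] := eqVneq u v.
  by rewrite subrr mul0r; exact: infinitesimal0.
rewrite -subr_eq0 in uv0; pose l := magnitude uv0.
have lE := magnitude_mem uv0; rewrite -/l in lE.
have [//|fm] := small_or_large (u - v) (a_ m).
have ml : le_Lambda m l by apply/(le_LambdaE (repr_mem prec_wo m) lE).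
have l0 : lt_Lambda l (lambda0 M) by apply/(lt_lambda0 lE)/small_sub.
have fl : hfinite ((u - v) / a_ l).
  by have /simP[] := Lambda_sim lE (repr_mem prec_wo l).
have := coef_eq_small prec_wo fl (uv l l0 ml).
have /simP[_ fl'] := Lambda_sim lE (repr_mem prec_wo l).
by move/(small_not_large uv0 (repr_neq0 prec_wo l)).
Qed.

Section limit.
Variables (S : set (Lambda M)) (F : Lambda M -> R) (t : Lambda M -> hyper M).
Hypotheses (S_wo : rev_well_ordered S) (S_card : card_lt S hyperT).
Hypothesis S_lt : forall l, S l -> lt_Lambda l (lambda0 M).
Hypothesis t_small : forall n, S n -> infinitesimal (t n).
Hypothesis t_coef : forall n l, S n -> le_Lambda n l -> lt_Lambda l (lambda0 M) ->
  coef prec (a_ l) (t n) = F l.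

Lemma t_diff n m : S n -> S m -> le_Lambda m n -> infinitesimal ((t m - t n) / a_ n).
Proof.
move=> Sn Sm mn; apply: (coef_separation (t_small Sm) (t_small Sn)) => l l0 nl.
by rewrite !t_coef //; exact: (le_Lambda_trans mn nl).
Qed.

Let small_norm x y : infinitesimal (x / y) -> infinitesimal (`|x| / y).
Proof. by apply: infinitesimal_mono; rewrite !normrM normr_id. Qed.

(* One radius per index, instead of all the [r * a_ n] with [r] real and positive,
   keeps the number of conditions down to the cardinality of [S]. *)
Lemma limit_radius : exists b : Lambda M -> hyper M, forall n, S n ->
  infinitesimal (b n / a_ n) /\
  forall m, S m -> le_Lambda m n -> `|t m - t n| < b n.
Proof.
have [n|b bP] := @choice _ _ (fun n (b : hyper M) => S n -> infinitesimal (b / a_ n) /\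
  forall m, S m -> le_Lambda m n -> `|t m - t n| < b); last by exists b.
have an0 := repr_neq0 prec_wo n.
have [[l [Sl ln]]|none] := pselect (exists l, S l /\ lt_Lambda l n); last first.
  (* When no index follows [n], any positive radius negligible against [a_ n] will do; [a_ n] is
     infinitesimal, so its square is one. *)
  exists `|a_ n * a_ n| => Sn; split.
    apply: small_norm; rewrite mulfK //.
    by apply/(lt_lambda0 (repr_mem prec_wo n)); exact: S_lt.
  move=> m Sm [->|mn]; last by case: none; exists m.
  by rewrite subrr normr0 normr_gt0 mulf_neq0.
(* The index [m] immediately follows [n]. All further centres are within [a_ m] of [t m], in
   absolute value, so one radius serves them all. *)
have [m [Sm mn] mP] := rev_well_ordered_has_max S_wo (A := [set k | S k /\ lt_Lambda k n])
    (fun k => @proj1 _ _) (ex_intro _ l (conj Sl ln)).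
have am0 := repr_neq0 prec_wo m.
exists (`|t m - t n| + `|a_ m|) => Sn; split.
  have h1 := small_norm (t_diff Sn Sm (lt_Lambda_le mn)).
  have h2 := small_norm ((lt_repr prec_wo _ _).1 mn).
  rewrite mulrDl; exact: (infinitesimalD h1 h2).
move=> k Sk [->|kn].
  by rewrite subrr normr0 ltr_wpDl // normr_gt0.
have km : le_Lambda k m by apply: mP.
have /infinitesimalP /(_ 1 ltr01) := t_diff Sm Sk km.
rewrite normrM normfV ltr_pdivrMr ?normr_gt0 // hreal1 mul1r => h.
have -> : t k - t n = (t m - t n) + (t k - t m) by ring.
by apply: le_lt_trans (ler_normD _ _) _; rewrite ltrD2l.
Qed.

Lemma limit_expansion : exists u, [/\ infinitesimal u,
  forall n l, S n -> le_Lambda n l -> lt_Lambda l (lambda0 M) -> coef prec (a_ l) u = F l &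
  forall l, lt_Lambda l (lambda0 M) -> (forall n, S n -> lt_Lambda l n) ->
    coef prec (a_ l) u = 0].
Proof.
have a_small l : lt_Lambda l (lambda0 M) -> infinitesimal (a_ l).
  by move/(lt_lambda0 (repr_mem prec_wo l)).
have shift_small l x : lt_Lambda l (lambda0 M) -> hfinite (x / a_ l) -> infinitesimal x.
  move=> /a_small al xl; rewrite -(divfK (repr_neq0 prec_wo l) x).
  exact: (infinitesimalMr xl al).
(* The intersection of the balls on the infinitesimal scale. With no index, 0 belongs to it;
   otherwise [nested_balls] provides a point. *)
pose C : set (hyper M) := [set u | infinitesimal u /\
  forall n, S n -> infinitesimal ((u - t n) / a_ n)].
have [u0 Cu0] : exists u, C u.
  have [[l Sl]|none] := pselect (exists l, S l); last first.
    exists 0; split=> [|n Sn]; first exact: infinitesimal0.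
    by case: none; exists n.
  have [b bP] := limit_radius.
  have [||x xP] := nested_balls (t := t) (b := b) S_card.
  - by exists l.
  - by move=> n m Sn Sm mn; apply: (bP n Sn).2.
  have xt n : S n -> infinitesimal ((x - t n) / a_ n).
    move=> Sn; apply: infinitesimal_mono (bP n Sn).1; rewrite !normrM ler_wpM2r //.
    by rewrite (le_trans (ltW (xP n Sn))) // ler_norm.
  exists x; split=> //; rewrite -(subrK (t l) x).
  have h := shift_small l _ (S_lt Sl) (infinitesimal_finite (xt l Sl)).
  exact: (infinitesimalD h (t_small Sl)).
have [[u_small ut] uP] := prec_minP prec_wo Cu0; set u := prec_min _ C in u_small ut uP *.
exists u; split; [exact: u_small|move=> n l Sn nl l0|move=> l l0 lS].
  rewrite -(t_coef Sn nl l0); apply: (coef_small prec_wo).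
  rewrite (ratio_trans _ _ (repr_neq0 prec_wo n)).
  by have /(le_repr prec_wo) h := nl; exact: (infinitesimalMl (ut n Sn) h).
(* The ball of scale [a_ l] around [u] is contained in [C], so [u], the least element of [C], is
   also the centre of that ball. *)
apply: coef_center; apply: (prec_min_eq prec_wo) => [|y /= yu].
  by rewrite /= subrr mul0r; exact: (infinitesimal_finite (infinitesimal0 M)).
apply: uP; split.
  rewrite -(subrK u y); exact: (infinitesimalD (shift_small l _ l0 yu) u_small).
move=> n Sn; have /(lt_repr prec_wo) ln := lS n Sn.
have -> : (y - t n) / a_ n = (y - u) / a_ l * (a_ l / a_ n) + (u - t n) / a_ n.
  by rewrite -(ratio_trans _ _ (repr_neq0 prec_wo l)) -mulrDl; congr (_ / a_ n); ring.
exact: (infinitesimalD (infinitesimalMr yu ln) (ut n Sn)).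
Qed.

End limit.

Lemma expansion_exists (S : set (Lambda M)) (F : Lambda M -> R) :
    rev_well_ordered S -> card_lt S hyperT ->
    (forall l, S l -> lt_Lambda l (lambda0 M)) ->
    (forall l, lt_Lambda l (lambda0 M) -> ~ S l -> F l = 0) ->
  exists2 u, infinitesimal u &
    forall l, lt_Lambda l (lambda0 M) -> coef prec (a_ l) u = F l.
Proof.
move=> S_wo S_card S_lt F0.
pose approx n u := infinitesimal u /\ forall l, le_Lambda n l -> lt_Lambda l (lambda0 M) ->
  coef prec (a_ l) u = F l.
(* An approximation from the upper part [S'] of [S] is exact down to the next
   element of [S]. *)
have step S' : S' `<=` S -> (forall n, S' n -> exists u, approx n u) ->
    exists2 u, infinitesimal u & forall l, lt_Lambda l (lambda0 M) ->
      ((exists2 n, S' n & le_Lambda n l) -> coef prec (a_ l) u = F l) /\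
      ((forall n, S' n -> lt_Lambda l n) -> coef prec (a_ l) u = 0).
  move=> S'S ap.
  have [n|t tP] := @choice _ _ (fun n u => S' n -> approx n u).
    by have [/ap[u]|] := pselect (S' n); [exists u|exists 0].
  have S'_card : card_lt S' hyperT by apply: card_lt_le S_card; exact: subset_card_le.
  have [u [u_small uF u0]] := @limit_expansion S' F t
    (rev_well_ordered_sub S'S S_wo) S'_card (fun l S'l => S_lt l (S'S l S'l))
    (fun n S'n => (tP n S'n).1) (fun n l S'n => (tP n S'n).2 l).
  exists u; [exact: u_small|move=> l l0]; split=> [[n S'n nl]|lS']; last by exact: (u0 l l0 lS').
  exact: (uF n l S'n nl l0).
have all_approx n : S n -> exists u, approx n u.
  move=> Sn; apply: contrapT => bad.
  (* Induction along the reversed order: [k] is its first index, hence the greatest in [Lambda],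
     without an approximation. *)
  have [|k [Sk kbad] kmax] := rev_well_ordered_has_max S_wo
      (A := [set k | S k /\ ~ exists u, approx k u]) (fun k => @proj1 _ _).
    by exists n.
  apply: kbad; have k0 := S_lt k Sk.
  have [||u u_small uP] := step [set m | S m /\ lt_Lambda k m].
  - by move=> m [].
  - move=> m [Sm km]; apply: contrapT => mbad.
    by have /(lt_Lambda_nle _ _).1 := km; apply; apply: kmax.
  have ak_small : infinitesimal (a_ k) by apply/(lt_lambda0 (repr_mem prec_wo k)).
  (* The limit [u] over the indices above [k] has coefficient 0 at [k]. The added term corrects it
     there and is too small to change the coefficients above. *)
  exists (u + hreal M (F k) * a_ k); split.
    exact: (infinitesimalD u_small (infinitesimalMr (hfinite_real _ _) ak_small)).
  move=> l kl l0; case: kl => [<-|kl].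
    rewrite (coef_shift prec_wo) ?repr_neq0 // (uP k k0).2 ?add0r //.
    by move=> m [].
  have -> : coef prec (a_ l) (u + hreal M (F k) * a_ k) = coef prec (a_ l) u.
    apply: (coef_small prec_wo); rewrite addrC addKr -mulrA.
    exact: (infinitesimalMr (hfinite_real _ _) ((lt_repr prec_wo _ _).1 kl)).
  (* Either some index above [k] lies at or below [l], or [l] is outside [S] and both values
     vanish. *)
  have [ex|nex] := pselect (exists2 m, S m /\ lt_Lambda k m & le_Lambda m l).
    exact: (uP l l0).1.
  have lS' m : S m /\ lt_Lambda k m -> lt_Lambda l m.
    by move=> Sm; apply/lt_Lambda_nle => ml; apply: nex; exists m.
  rewrite (uP l l0).2; last exact: lS'.
  rewrite F0 // => Sl; apply: (@lt_Lambda_irr _ _ l).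
  exact: (lS' l (conj Sl kl)).
have [//|u u_small uP] := step S _ all_approx; exists u; [exact: u_small|move=> l l0].
have [ex|nex] := pselect (exists2 m, S m & le_Lambda m l); first exact: (uP l l0).1.
have lS' m : S m -> lt_Lambda l m.
  by move=> Sm; apply/lt_Lambda_nle => ml; apply: nex; exists m.
rewrite (uP l l0).2; last exact: lS'.
rewrite F0 // => Sl; apply: (@lt_Lambda_irr _ _ l); exact: lS'.
Qed.

End realization.

(** * The asymptotic space is a tree *)

Section asymptotic_plane.
Variables (R : realType) (M : nonstandard_model R) (eps : hyper M).
Hypotheses (eps0 : 0 < eps) (eps_small : infinitesimal eps).
Implicit Types (x y z : hyper M * hyper M) (t : R).
Notation "r %:H" := (hreal M r) (at level 1, format "r %:H").

Let eps_ge0 : 0 <= eps := ltW eps0.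
Let eps_neq0 : eps != 0 := lt0r_neq0 eps0.

Lemma YP x : Y eps x <-> [/\ 0 <= x.1, 0 <= x.2 < (2 * pi)%:H & hfinite (eps * x.1)].
Proof. by rewrite /Y /mkset H_coordP; split=> [[[]]|[]]. Qed.

Definition radius x : R := st (eps * x.1).
(** Up to a bounded error, the Gromov product of the two points based at the origin. *)
Definition split_height x y := - hln (hsep x.1 x.2 y.1 y.2).
Definition meet x y : R := st (eps * split_height x y).

Lemma hsep_gt0 (a p b q : hyper M) : 0 < hsep a p b q.
Proof. by rewrite hsepE !lt_max hexp_gt0. Qed.

Lemma hsep_le1 (a p b q : hyper M) : 0 <= a -> 0 <= b -> hsep a p b q <= 1.
Proof.
move=> a0 b0; rewrite hsepE !ge_max !hexp_le1 ?oppr_le0 //=.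
move: p q; apply: germ_ind2 => xs F G xs0.
rewrite -(hreal_nat M 2) (hfun_cst 2%:R xs) -hreal1 (hfun_cst 1 xs) (germN xs0) (germD xs0).
rewrite (germV xs0) (germM xs0) /hsin (hfun1_germ xs0) (germ_norm xs0).
by apply/(germ_le xs0)/(hrel_true xs0) => s _; exact: sin_max.
Qed.

Lemma hsep_sym (a p b q : hyper M) : hsep a p b q = hsep b q a p.
Proof.
rewrite !hsepE [Num.max (hexp (- a)) _]maxC; congr Num.max.
move: p q; apply: germ_ind2 => xs F G xs0.
rewrite -(hreal_nat M 2) (hfun_cst 2%:R xs) !(germN xs0) !(germD xs0).
rewrite !(germV xs0) !(germM xs0) /hsin !(hfun1_germ xs0) !(germ_norm xs0).
by congr hfun; apply/funext => s; rewrite -normrN -sinN -mulNr opprB.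
Qed.

Lemma hsep_same (a b p : hyper M) : hsep a p b p = Num.max (hexp (- a)) (hexp (- b)).
Proof.
rewrite hsepE subrr mul0r max_l //; apply: le_trans (hsin_le 0) _.
by rewrite normr0 le_max (ltW (hexp_gt0 (- a))).
Qed.

Section pair.
Variables x y : hyper M * hyper M.
Hypotheses (Yx : Y eps x) (Yy : Y eps y).

Lemma split_height_ge0 : 0 <= split_height x y.
Proof.
have [x0 _ _] := (YP x).1 Yx; have [y0 _ _] := (YP y).1 Yy.
by rewrite /split_height oppr_ge0; apply: hln_le0; [exact: hsep_gt0|exact: hsep_le1].
Qed.

Lemma split_height_le : split_height x y <= x.1.
Proof.
rewrite /split_height lerNl -[leLHS]hexpK; apply: hln_le; first exact: hexp_gt0.
by rewrite hsepE !le_max lexx.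
Qed.

Lemma split_height_finite : hfinite (eps * split_height x y).
Proof.
have [x0 _ xf] := (YP x).1 Yx; apply: hfinite_mono xf.
rewrite !normrM (ger0_norm split_height_ge0) (ger0_norm x0).
exact: (ler_wpM2l (normr_ge0 eps) split_height_le).
Qed.

Lemma meet_bounds : 0 <= meet x y <= radius x.
Proof.
have [x0 _ xf] := (YP x).1 Yx; have h := split_height_finite; apply/andP; split.
  exact: (st_ge0 h (mulr_ge0 eps_ge0 split_height_ge0)).
exact: (st_le h xf (ler_wpM2l eps_ge0 split_height_le)).
Qed.

(** The error of at most 2 in [H_dist_hsep] becomes infinitesimal after multiplication by [eps]. *)
Lemma eps_distE : hfinite (eps_dist eps x y) /\
  st (eps_dist eps x y) = radius x + radius y - 2 * meet x y.
Proof.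
have [x0 _ xf] := (YP x).1 Yx; have [y0 _ yf] := (YP y).1 Yy.
have := H_dist_hsep x.2 y.2 x0 y0; set d := hfun _ _ => dle.
have sf := split_height_finite.
pose v := eps * x.1 + eps * y.1 - (1 + 1)%:H * (eps * split_height x y).
have vf : hfinite v.
  exact: (hfiniteB (hfiniteD xf yf) (hfiniteM (hfinite_real M (1 + 1)) sf)).
have close : infinitesimal (eps_dist eps x y - v).
  have -> : eps_dist eps x y - v =
      eps * (d - (x.1 + y.1 + 2 * hln (hsep x.1 x.2 y.1 y.2))).
    rewrite /eps_dist -/d -[hmul eps d]/(eps * d) /v /split_height hrealD hreal1; ring.
  apply: (infinitesimalMl eps_small); apply: (@hfinite_le _ _ _ 2%:R).
  by rewrite hreal_nat.
split.
  by rewrite -(subrK v (eps_dist eps x y)); exact: (hfiniteD (infinitesimal_finite close) vf).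
rewrite (st_eq vf close) /v stB; last 2 first.
- exact: (hfiniteD xf yf).
- exact: (hfiniteM (hfinite_real M (1 + 1)) sf).
rewrite (stD xf yf) (stM (hfinite_real M (1 + 1)) sf) st_real.
by rewrite -/(meet x y) -/(radius x) -/(radius y).
Qed.

Lemma approxP : Defs.approx eps x y <-> st (eps_dist eps x y) = 0.
Proof.
have [f _] := eps_distE; split; first exact: st_infinitesimal.
exact: (st_eq0 f).
Qed.

End pair.

Lemma meet_sym x y : meet x y = meet y x.
Proof. by rewrite /meet /split_height hsep_sym. Qed.

Lemma split_height_same x y : x.2 = y.2 -> y.1 <= x.1 -> split_height x y = y.1.
Proof.
move=> e yx; rewrite /split_height e hsep_same max_r.
  by rewrite hexpK opprK.
by apply: hexp_le; rewrite lerN2.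
Qed.

Lemma meet_refl x : meet x x = radius x.
Proof. by rewrite /meet split_height_same. Qed.

(** The additive constant in the inequality for [hsep] disappears under [eps] and the standard
    part. *)
Lemma meet_ultra y x z : Y eps x -> Y eps y -> Y eps z ->
  Num.min (meet x y) (meet y z) <= meet x z.
Proof.
move=> Yx Yy Yz; have fxy := split_height_finite Yx Yy.
have fyz := split_height_finite Yy Yz; have fxz := split_height_finite Yx Yz.
have := hln_hsep_ultra x.1 x.2 y.1 y.2 z.1 z.2.
have small s : infinitesimal (eps * s - eps * (s + 1)).
  by rewrite -mulrBr opprD addNKr mulrN1; exact: (infinitesimalN eps_small).
have le s : hfinite (eps * s) -> s <= split_height x z + 1 -> st (eps * s) <= meet x z.
  move=> fs h; have fz1 : hfinite (eps * (split_height x z + 1)).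
    by rewrite mulrDr mulr1; exact: (hfiniteD fxz (infinitesimal_finite eps_small)).
  have -> : meet x z = st (eps * (split_height x z + 1)).
    exact: (st_eq fz1 (small _)).
  exact: (st_le fs fz1 (ler_wpM2l eps_ge0 h)).
rewrite -lerBlDr le_max ge_min => /orP[h|h]; apply/orP; [left|right].
  by apply: (le _ fxy); move: h; rewrite /split_height; lra.
by apply: (le _ fyz); move: h; rewrite /split_height; lra.
Qed.

Lemma Y_truncate x t : Y eps x -> 0 <= t <= radius x ->
  exists2 y, Y eps y & radius y = t /\ meet x y = t.
Proof.
move=> Yx /andP[t0 tx]; have [x0 x2 xf] := (YP x).1 Yx.
have tH0 : 0 <= t%:H by rewrite -hreal0 hreal_le.
(* The point at distance [t / eps] on the ray of [x] may lie beyond [x]. In that case [radius x = t]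
   and [x] itself serves. *)
have [h|/ltW h] := leP x.1 (t%:H / eps).
  exists x; first exact: Yx.
  rewrite meet_refl; suff e : radius x = t by rewrite e.
  apply/eqP; rewrite eq_le tx andbT -(st_real M t).
  by apply: (st_le xf (hfinite_real M t)); rewrite mulrC -ler_pdivlMr.
pose y := (t%:H / eps, x.2); have ey : eps * y.1 = t%:H by rewrite mulrC (divfK eps_neq0).
have ry : radius y = t by rewrite /radius ey st_real.
exists y.
  apply/YP; split; [exact: (divr_ge0 tH0 eps_ge0)|exact: x2|rewrite ey; exact: hfinite_real].
split; first exact: ry.
by rewrite /meet (@split_height_same x y erefl h) -/(radius y).
Qed.

Lemma H0_R_tree : R_tree (@H0_dist R M eps).
Proof.
apply: (@rooted_quot_R_tree _ _ _ _ _ radius meet).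
- by move=> x y Yx Yy; exact: (eps_distE Yx Yy).2.
- by move=> x y Yx Yy; exact: (approxP Yx Yy).
- by move=> x _; exact: meet_refl.
- by move=> x y _ _; exact: meet_sym.
- by move=> x y Yx Yy; exact: (meet_bounds Yx Yy).
- by move=> y x z Yx Yy Yz; exact: (meet_ultra Yx Yy Yz).
- by move=> x t Yx; exact: (Y_truncate Yx).
Qed.

End asymptotic_plane.

(** * Angles *)

Section angles.
Variables (R : realType) (M : nonstandard_model R).
Implicit Types (phi u : hyper M) (theta : R).
Notation "r %:H" := (hreal M r) (at level 1, format "r %:H").

(** An angle slightly below a full turn is infinitely close to 0 on the circle. The second
    alternative covers it, with [theta = 0] and a negative [u]. *)
Definition is_angle phi theta u : Prop :=
  [/\ 0 <= theta < 2 * pi, infinitesimal u &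
      phi = theta%:H + u \/ phi = theta%:H + u + (2 * pi)%:H].

Lemma angle_exists phi : 0 <= phi < (2 * pi)%:H -> exists theta u, is_angle phi theta u.
Proof.
move=> /andP[p0 p1]; have pf : hfinite phi.
  by apply: (@hfinite_le _ _ _ (2 * pi)); rewrite (ger0_norm p0) (ltW p1).
have t0 := st_ge0 pf p0.
have t1 : st phi <= 2 * pi.
  by have := st_le pf (hfinite_real M (2 * pi)) (ltW p1); rewrite st_real.
have [t2|t2] := ltP (st phi) (2 * pi).
  exists (st phi), (phi - (st phi)%:H); split; [by rewrite t0 t2|exact: (stP pf)|left].
  by rewrite addrC subrK.
have e : st phi = 2 * pi by apply/eqP; rewrite eq_le t1 t2.
exists 0, (phi - (2 * pi)%:H); split.
- by rewrite lexx mulr_gt0 // pi_gt0.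
- by rewrite -e; exact: (stP pf).
- by right; rewrite hreal0 add0r subrK.
Qed.

Lemma angle_realized theta u : 0 <= theta < 2 * pi -> infinitesimal u ->
  exists2 phi, 0 <= phi < (2 * pi)%:H & is_angle phi theta u.
Proof.
move=> /[dup] th /andP[t0 t1] ui; have t0' : 0 <= theta%:H by rewrite -hreal0 hreal_le.
have [h|h] := leP 0 (theta%:H + u).
  exists (theta%:H + u); last by split; [exact: th|exact: ui|left].
  rewrite h /=; have d0 : 0 < 2 * pi - theta by rewrite subr_gt0.
  have := (infinitesimalP u).1 ui _ d0; have := ler_norm u; rewrite hrealB; lra.
exists (theta%:H + u + (2 * pi)%:H); last by split; [exact: th|exact: ui|right].
have d0 : 0 < 2 * pi :> R by rewrite mulr_gt0 // pi_gt0.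
have := (infinitesimalP u).1 ui _ d0; have := ler_norm (- u); rewrite normrN; lra.
Qed.

Section two_angles.
Variables (phi phi' u u' : hyper M) (theta theta' : R).
Hypotheses (ang : is_angle phi theta u) (ang' : is_angle phi' theta' u').

(** A full turn added to one angle shifts the half difference by [pi], which preserves the absolute
    value of the sine. *)
Lemma angle_half :
  `|hsin ((phi - phi') / 2)| = `|hsin (((theta - theta') / 2)%:H + (u - u') / 2)|.
Proof.
have [_ _ e] := ang; have [_ _ e'] := ang'.
have two : (2 * pi)%:H = 2 * pi%:H by rewrite hrealM hreal_nat.
rewrite hrealM hrealV hrealB hreal_nat; rewrite two in e e'.
have t2 : (2 : hyper M) != 0 by rewrite pnatr_eq0.
set s := _ + _ / 2.
case: e => ->; case: e' => ->.
- by congr (`|hsin _|); rewrite /s; field.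
- transitivity `|hsin (s - pi%:H)|; last exact: (hsinBpi s).
  by congr (`|hsin _|); rewrite /s; field.
- transitivity `|hsin (s + pi%:H)|; last exact: (hsinDpi s).
  by congr (`|hsin _|); rewrite /s; field.
- by congr (`|hsin _|); rewrite /s; field.
Qed.

(** One factor 2 comes from halving the difference and the other from [hsin_ge]. The sine and
    [u - u'] thus have the same order of magnitude. *)
Lemma angle_same : theta = theta' ->
  `|hsin ((phi - phi') / 2)| <= `|u - u'| <= 4 * `|hsin ((phi - phi') / 2)|.
Proof.
move=> e; rewrite angle_half e subrr mul0r hreal0 add0r.
have [_ iu _] := ang; have [_ iu' _] := ang'.
have hn : `|(u - u') / 2| = `|u - u'| / 2 by rewrite normrM normfV (ger0_norm (ler0n _ 2)).
have h1 := hsin_le ((u - u') / 2); have h2 := normr_ge0 (u - u').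
have h3 : `|(u - u') / 2| <= 1.
  rewrite hn; have := (infinitesimalP _).1 (infinitesimalB iu iu') 1 ltr01; rewrite hreal1; lra.
have := hsin_ge h3; rewrite hn in h1 *; lra.
Qed.

(** Half the difference of the standard angles is nonzero and lies strictly between [- pi] and [pi],
    so its sine is a nonzero real. *)
Lemma angle_neq : theta <> theta' -> ~ infinitesimal (hsin ((phi - phi') / 2)).
Proof.
move=> ne iw; have [/andP[t0 t1] iu _] := ang; have [/andP[t0' t1'] iu' _] := ang'.
set c := (theta - theta') / 2; set v := (u - u') / 2.
have iv : infinitesimal v.
  apply: (infinitesimalMl (infinitesimalB iu iu')).
  by rewrite -(hreal_nat M 2) -hrealV; exact: hfinite_real.
have is_ : infinitesimal (hsin (c%:H + v)).
  by apply: infinitesimal_mono iw; rewrite angle_half.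
have id_ : infinitesimal (hsin (c%:H + v) - hsin c%:H).
  by apply: infinitesimal_mono iv; apply: le_trans (hsin_lipschitz _ _) _; rewrite addrC addKr.
have := infinitesimalB is_ id_; rewrite opprB addrC subrK hsin_real => /infinitesimal_real sc.
have c0 : c != 0 by rewrite /c mulf_neq0 ?invr_eq0 ?pnatr_eq0 // subr_eq0; apply/eqP.
have [cp|cn] := ltP 0 c.
  have := @sin_gt0_pi R c; rewrite sc ltxx => h.
  have : false by apply: h; rewrite /c in cp *; lra.
  by [].
have cn' : c < 0 by rewrite lt_neqAle c0.
have := @sin_gt0_pi R (- c); rewrite sinN sc oppr0 ltxx => h.
have : false by apply: h; rewrite /c in cn' *; lra.
by [].
Qed.

End two_angles.

End angles.

(** * Levels of orders of magnitude *)

Section levels.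
Variables (R : realType) (M : nonstandard_model R) (eps : hyper M) (prec : rel (hyper M)).
Hypotheses (eps0 : 0 < eps) (eps_small : infinitesimal eps).
Hypothesis prec_wo : wochoice.well_order prec.
Implicit Types (l m : Lambda M) (z : hyper M).
Notation "r %:H" := (hreal M r) (at level 1, format "r %:H").
Notation a_ l := (Defs.repr prec l).
Notation g := (Defs.g eps prec).

Let eps_ge0 : 0 <= eps := ltW eps0.
Let eps_neq0 : eps != 0 := lt0r_neq0 eps0.

Definition log_height z := - (eps * hln `|z|).

(** Logarithms of members of one class differ by a finite number, which [eps] makes infinitesimal.
    Hence [g] can be computed from any member instead of [a_ l]. *)
Lemma log_height_sim l z z' : sval l z -> sval l z' ->
  infinitesimal (log_height z - log_height z').
Proof.
move=> lz lz'; have z0 := Lambda_neq0 lz; have z0' := Lambda_neq0 lz'.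
have /simP[f f'] := Lambda_sim lz lz'.
have fin (u v : hyper M) : hfinite (u / v) -> hfinite (`|u| / `|v|).
  by apply: hfinite_mono; rewrite !normrM !normfV !normr_id.
have nz : 0 < `|z| by rewrite normr_gt0.
have nz' : 0 < `|z'| by rewrite normr_gt0.
have h := sim_hln nz' nz (fin _ _ f') (fin _ _ f).
have -> : log_height z - log_height z' = eps * (hln `|z'| - hln `|z|).
  by rewrite /log_height; ring.
exact: (infinitesimalMl eps_small h).
Qed.

Lemma g_finite l z : sval l z -> hfinite (log_height z) -> g l = (st (log_height z))%:E.
Proof.
move=> lz f; have h := log_height_sim (repr_mem prec_wo l) lz.
have f' : hfinite (log_height (a_ l)).
  by rewrite -(subrK (log_height z) (log_height _)); exact: (hfiniteD (infinitesimal_finite h) f).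
rewrite /Defs.g; case: pselect => [h' /=|[]]; last exact: f'.
exact: (congr1 EFin (st_eq f h)).
Qed.

Lemma g_infinite l z : sval l z -> ~ hfinite (log_height z) -> g l = +oo%E.
Proof.
move=> lz f; have h := log_height_sim lz (repr_mem prec_wo l).
rewrite /Defs.g; case: pselect => [f'|nf /=]; last by [].
case: f; rewrite -(subrK (log_height (a_ l)) (log_height z)).
exact: (hfiniteD (infinitesimal_finite h) f').
Qed.

Lemma g_lty l : (g l < +oo)%E -> hfinite (log_height (a_ l)) /\ g l = (st (log_height (a_ l)))%:E.
Proof.
move=> gl; have [f|f] := pselect (hfinite (log_height (a_ l))).
  by split; [exact: f|exact: (g_finite (repr_mem prec_wo l) f)].
by move: gl; rewrite (g_infinite (repr_mem prec_wo l) f) ltxx.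
Qed.

Lemma g_fineK l : (g l < +oo)%E -> g l = (fine (g l))%:E.
Proof. by move=> /g_lty[_ ->]. Qed.

Lemma g_lambda0 : g (lambda0 M) = 0%E.
Proof.
have e : log_height (1 : hyper M) = 0 by rewrite /log_height normr1 hln1 mulr0 oppr0.
have i0 := infinitesimal0 M; rewrite (g_finite (lambda0_mem M)) e.
  by rewrite (st_infinitesimal i0).
exact: (infinitesimal_finite i0).
Qed.

(** A finite [z] may exceed 1 in absolute value, so its height can be negative, but only by an
    infinitesimal. *)
Lemma log_height_bounded_below z : z != 0 -> hfinite z ->
  exists2 d, infinitesimal d & d <= log_height z.
Proof.
move=> z0 /hfiniteP[k zk]; exists (- (eps * (ln k)%:H)).
  exact: (infinitesimalN (infinitesimalMl eps_small (hfinite_real M (ln k)))).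
have h : hln `|z| <= (ln k)%:H.
  by rewrite -hln_real; apply: hln_le; [rewrite normr_gt0|exact: ltW].
by rewrite /log_height lerN2; exact: (ler_wpM2l eps_ge0 h).
Qed.

Lemma log_height_le z z' : z != 0 -> `|z| <= `|z'| -> log_height z' <= log_height z.
Proof.
move=> z0 zz'; have z0' : 0 < `|z| by rewrite normr_gt0.
by rewrite /log_height lerN2; exact: (ler_wpM2l eps_ge0 (hln_le z0' zz')).
Qed.

Lemma g_anti l m : le_Lambda l m -> le_Lambda m (lambda0 M) -> (g m <= g l)%E.
Proof.
move=> [-> //|[_ [z [z' [lz mz' /hltE zz']]]]] m0.
have z0 := Lambda_neq0 lz; have z0' := Lambda_neq0 mz'.
have h := log_height_le z0 (ltW zz').
have [f|f] := pselect (hfinite (log_height z)); last by rewrite (g_infinite lz f) leey.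
(* The height of [z'] lies between the infinitesimal [d] and the finite height of [z], hence is
   finite. *)
have [d di dz'] := log_height_bounded_below z0' ((le_lambda0 mz').1 m0).
have f' : hfinite (log_height z').
  have f1 := hfiniteB f (infinitesimal_finite di).
  have f2 : hfinite (log_height z' - d).
    have d0 : 0 <= log_height z' - d by rewrite subr_ge0.
    have le : log_height z' - d <= log_height z - d by rewrite lerD2r.
    apply: hfinite_mono f1; rewrite (ger0_norm d0).
    by apply: le_trans le _; exact: ler_norm.
  by rewrite -(subrK d (log_height z')); exact: (hfiniteD f2 (infinitesimal_finite di)).
rewrite (g_finite lz f) (g_finite mz' f') lee_fin; exact: (st_le f' f h).
Qed.

Lemma g_ge0 l : le_Lambda l (lambda0 M) -> (0 <= g l)%E.
Proof. by move=> l0; rewrite -g_lambda0; apply: (g_anti l0 (le_Lambda_refl _)). Qed.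

Lemma level_exists (t : R) : 0 <= t -> exists l, le_Lambda l (lambda0 M) /\ g l = t%:E.
Proof.
move=> t0; pose z := hexp (- (t%:H / eps)); have z0 : 0 < z := hexp_gt0 _.
have zE := magnitude_mem (lt0r_neq0 z0); exists (magnitude (lt0r_neq0 z0)).
have tH0 : 0 <= t%:H by rewrite -hreal0 hreal_le.
have e : log_height z = t%:H.
  rewrite /log_height (ger0_norm (ltW z0)) /z hexpK mulrN opprK mulrC.
  exact: (divfK eps_neq0).
have z1 : z <= 1 by apply: hexp_le1; rewrite oppr_le0; exact: (divr_ge0 tH0 eps_ge0).
split.
  apply/(le_lambda0 zE); apply: (@hfinite_le _ _ _ 1).
  by rewrite (ger0_norm (ltW z0)) hreal1.
by rewrite (g_finite zE) e ?st_real //; exact: (hfinite_real M t).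
Qed.

(** A strict inequality of levels leaves a real gap [r] between the scaled logarithms, and [hln_gap]
    then bounds the ratio by [eps / r]. *)
Lemma level_gap l z : 0 < z -> hfinite (log_height z) -> (g l < (st (log_height z))%:E)%E ->
  infinitesimal (z / a_ l).
Proof.
move=> z0 f gl; have [fl e] := g_lty (lt_trans gl (ltry _)).
rewrite e lte_fin in gl; have [r r0 h] := st_lt fl f gl.
have a0 : 0 < `|a_ l| by rewrite normr_gt0; exact: (repr_neq0 prec_wo l).
have h1 : r%:H <= eps * (hln `|a_ l| - hln z).
  by move: h; rewrite /log_height (ger0_norm (ltW z0)); lra.
have h2 := hln_gap eps0 z0 a0 r0 h1.
have := infinitesimalMl eps_small (hfinite_real M r^-1); apply: infinitesimal_mono.
rewrite normrM normfV (ger0_norm (ltW z0)); apply: (le_trans h2); exact: ler_norm.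
Qed.

End levels.

(** * Branches represented by points *)

Section representation.
Variables (R : realType) (M : nonstandard_model R) (eps : hyper M) (prec : rel (hyper M)).
Hypotheses (eps0 : 0 < eps) (eps_small : infinitesimal eps).
Hypotheses (M_saturated : saturated M) (prec_init : initial_well_order prec).
Implicit Types (l m : Lambda M) (x y : hyper M * hyper M).
Implicit Types b c : (Lambda M -> option R) * Lambda M.
Notation "r %:H" := (hreal M r) (at level 1, format "r %:H").
Notation a_ l := (Defs.repr prec l).
Notation g := (Defs.g eps prec).
Notation L0 := (lambda0 M).
Let prec_wo : wochoice.well_order prec := prec_init.1.
Let eps_ge0 : 0 <= eps := ltW eps0.
Let eps_neq0 : eps != 0 := lt0r_neq0 eps0.

(** Of the end of the branch only the level is tied to [x]. Several branches may therefore
    correspond to one point; they are at distance 0 from each other. *)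
Definition represents x b : Prop := exists theta u,
  [/\ is_angle x.2 theta u, b.1 L0 = Some theta,
      forall l, le_Lambda b.2 l -> lt_Lambda l L0 -> b.1 l = Some (coef prec (a_ l) u) &
      radius eps x = fine (g b.2)].

Lemma sup_halfline (A : set R) s : A = [set h | h <= s] -> sup A = s.
Proof.
move=> ->; apply/eqP; rewrite eq_le; apply/andP; split.
  by apply: ge_sup => [|h //]; exists s; rewrite /= lexx.
by apply: ub_le_sup; [exists s|rewrite /= lexx].
Qed.

(** * Meeting height of two branches and of the points representing them *)

Section meeting.
Variables (x y : hyper M * hyper M) (b c : (Lambda M -> option R) * Lambda M).
Hypotheses (Yx : Y eps x) (Yy : Y eps y) (bb : is_branch eps prec b) (bc : is_branch eps prec c).
Variables (theta theta' : R) (u u' : hyper M).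
Hypotheses (angx : is_angle x.2 theta u) (angy : is_angle y.2 theta' u').
Hypotheses (b0 : b.1 L0 = Some theta) (c0 : c.1 L0 = Some theta').
Hypothesis b_coef : forall l, le_Lambda b.2 l -> lt_Lambda l L0 ->
  b.1 l = Some (coef prec (a_ l) u).
Hypothesis c_coef : forall l, le_Lambda c.2 l -> lt_Lambda l L0 ->
  c.1 l = Some (coef prec (a_ l) u').
Hypotheses (rx : radius eps x = fine (g b.2)) (ry : radius eps y = fine (g c.2)).

Let w := hsin ((x.2 - y.2) / 2).

Let w_le : `|w| <= hsep x.1 x.2 y.1 y.2.
Proof. by rewrite hsepE le_max lexx orbT. Qed.

Let same_angle : infinitesimal w -> theta = theta'.
Proof. by move=> iw; apply: contrapT => /(angle_neq angx angy). Qed.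

(** At such a level the separation of the points is infinitesimal with respect to [a_ l]. So are the
    sine and then [u - u'], which gives equal coefficients. *)
Lemma agree_above l : le_Lambda l L0 -> (g l < (meet eps x y)%:E)%E ->
  exists2 t, b.1 l = Some t & c.1 l = Some t.
Proof.
move=> l0 gl; set mu := hsep x.1 x.2 y.1 y.2; have mu0 : 0 < mu := hsep_gt0 _ _ _ _.
have e : log_height eps mu = eps * split_height x y.
  by rewrite /log_height (ger0_norm (ltW mu0)) /split_height mulrN.
have f : hfinite (log_height eps mu) by rewrite e; exact: (split_height_finite Yx Yy).
have mul : infinitesimal (mu / a_ l).
  by apply: (level_gap eps0 eps_small prec_wo mu0 f); rewrite e.
have al0 := repr_neq0 prec_wo l.
have wl : infinitesimal (w / a_ l).
  apply: infinitesimal_mono mul; rewrite !normrM.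
  by apply: (ler_wpM2r (normr_ge0 _)); apply: (le_trans w_le); exact: ler_norm.
have iw : infinitesimal w.
  rewrite -(divfK al0 w).
  exact: (infinitesimalMl wl ((le_lambda0 (repr_mem prec_wo l)).1 l0)).
have th := same_angle iw.
(* The index lies in both domains: beyond the end of a branch the level would be at least the
   radius, hence at least the meeting height. *)
have below (d : (Lambda M -> option R) * Lambda M) (z : hyper M * hyper M) :
    is_branch eps prec d -> radius eps z = fine (g d.2) -> meet eps x y <= radius eps z ->
    le_Lambda d.2 l.
  case: d => d l1 [l10 gl1 _ _ _] /= rz mz.
  have [//|ll1] := le_Lambda_total l1 l.
  have := g_anti eps0 eps_small prec_wo (lt_Lambda_le ll1) l10.
  rewrite leNgt => /negP[]; apply: (lt_le_trans gl).
  by rewrite (g_fineK eps_small prec_wo gl1) -rz lee_fin.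
have /andP[_ mx] := meet_bounds eps0 Yx Yy.
have /andP[_ my] := meet_bounds eps0 Yy Yx; rewrite meet_sym in my.
have lb := below b x bb rx mx; have lc := below c y bc ry my.
have [el|ll0] := l0; first by exists theta; rewrite el // th.
have /andP[_ h] := angle_same angx angy th.
have small : infinitesimal ((u - u') / a_ l).
  have := infinitesimalMr (hfinite_real M 4%:R) wl; apply: infinitesimal_mono.
  rewrite hreal_nat mulrA !normrM (ger0_norm (ler0n _ 4)).
  exact: (ler_wpM2r (normr_ge0 _) h).
exists (coef prec (a_ l) u); first exact: (b_coef lb ll0).
exact: (etrans (c_coef lc ll0) (congr1 some (esym (coef_small prec_wo small)))).
Qed.

(** The separation is the largest of three terms. If it is an exponential, one branch ends at the
    meeting height. If it is the sine [w], the angles differ in order of magnitude exactly by [w],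
    so the coefficients cannot agree there. *)
Lemma disagree_below h :
  (forall l, le_Lambda l L0 -> (g l < h%:E)%E -> exists2 t, b.1 l = Some t & c.1 l = Some t) ->
  h <= meet eps x y.
Proof.
move=> hP; rewrite leNgt; apply/negP => mh.
have /andP[m0 _] := meet_bounds eps0 Yx Yy.
(* A branch whose radius equals the meeting height is not defined at the level halfway to [h],
   although agreement up to [h] would require it. *)
have too_high (d : (Lambda M -> option R) * Lambda M) (z : hyper M * hyper M) :
    is_branch eps prec d -> radius eps z = fine (g d.2) -> meet eps x y = radius eps z ->
    (forall l, le_Lambda l L0 -> (g l < h%:E)%E -> d.1 l <> None) -> False.
  case: d => d l1 [l10 gl1 dP _ _] /= rz mz dN.
  have [|l [l0 gl]] := @level_exists _ _ _ prec eps0 eps_small prec_wo ((meet eps x y + h) / 2).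
    by lra.
  have /dP[l1l _] : d l <> None by apply: dN => //; rewrite gl lte_fin; lra.
  have := g_anti eps0 eps_small prec_wo l1l l0.
  by rewrite gl (g_fineK eps_small prec_wo gl1) -rz -mz lee_fin; lra.
have x_high : hsep x.1 x.2 y.1 y.2 = hexp (- x.1) -> False.
  move=> e; apply: (too_high b x bb rx).
    by rewrite /meet /split_height e hexpK opprK.
  by move=> l l0 gl; have [t ->] := hP l l0 gl.
have y_high : hsep x.1 x.2 y.1 y.2 = hexp (- y.1) -> False.
  move=> e; apply: (too_high c y bc ry).
    by rewrite /meet /split_height e hexpK opprK.
  by move=> l l0 gl; have [t _ ->] := hP l l0 gl.
have wE : hsep x.1 x.2 y.1 y.2 = `|w|.
  move: x_high y_high; rewrite hsepE -/w.
  have [_ _ _|_] := leP (Num.max (hexp (- x.1)) (hexp (- y.1))) `|w|; first by [].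
  by have [_ _ /(_ erefl)|_ /(_ erefl)] := leP (hexp (- x.1)) (hexp (- y.1)).
have w0 : w != 0 by rewrite -normr_gt0 -wE; exact: hsep_gt0.
pose l := magnitude w0; have lw := magnitude_mem w0; rewrite -/l in lw.
have e : log_height eps w = eps * split_height x y.
  by rewrite /log_height /split_height wE mulrN.
have f : hfinite (log_height eps w) by rewrite e; exact: (split_height_finite Yx Yy).
have gl : g l = (meet eps x y)%:E by rewrite (g_finite eps_small prec_wo lw f) e.
have [x0 _ _] := (YP eps x).1 Yx; have [y0 _ _] := (YP eps y).1 Yy.
have l0 : le_Lambda l L0.
  apply/(le_lambda0 lw); apply: (@hfinite_le _ _ _ 1); rewrite hreal1 -wE.
  exact: hsep_le1.
have [|t bl cl] := hP l l0; first by rewrite gl lte_fin.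
(* Were [w] not infinitesimal, its class would be [lambda0]. Agreement at [lambda0] means equal
   standard angles, which makes [w] infinitesimal after all. *)
have iw : infinitesimal w.
  have [el|ll0] := l0; last exact/(lt_lambda0 lw).
  rewrite el b0 in bl; rewrite el c0 in cl.
  have th : theta = theta' by case: bl cl => -> [->].
  have /andP[h1 _] := angle_same angx angy th.
  have [_ iu _] := angx; have [_ iu' _] := angy.
  have := infinitesimalB iu iu'; apply: infinitesimal_mono; exact: h1.
have th := same_angle iw; have ll0 : lt_Lambda l L0 by apply/(lt_lambda0 lw).
have /andP[h1 h2] := angle_same angx angy th.
have defined (d : (Lambda M -> option R) * Lambda M) : is_branch eps prec d ->
    d.1 l <> None -> le_Lambda d.2 l.
  by case: d => d l1 [_ _ dP _ _] /= /dP[].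
have lb : le_Lambda b.2 l by apply: (defined b bb); rewrite bl.
have lc : le_Lambda c.2 l by apply: (defined c bc); rewrite cl.
have /simP[wl lw'] := Lambda_sim lw (repr_mem prec_wo l).
have fu : hfinite ((u - u') / a_ l).
  have := hfiniteM (hfinite_real M 4%:R) wl; apply: hfinite_mono.
  rewrite hreal_nat mulrA !normrM (ger0_norm (ler0n _ 4)).
  exact: (ler_wpM2r (normr_ge0 _) h2).
have cu : coef prec (a_ l) u = coef prec (a_ l) u'.
  have := b_coef lb ll0; have := c_coef lc ll0.
  by rewrite bl cl => -[<-] [].
have iul := coef_eq_small prec_wo fu cu.
have iwl : infinitesimal (w / a_ l).
  apply: infinitesimal_mono iul; rewrite !normrM; exact: (ler_wpM2r (normr_ge0 _) h1).
exact: (small_not_large w0 (repr_neq0 prec_wo l) iwl lw').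
Qed.

End meeting.

(** The two inequalities identify the set in [branch_meet] with the half-line up to
    [meet eps x y]. *)
Lemma branch_meetE x y b c : Y eps x -> Y eps y ->
    is_branch eps prec b -> is_branch eps prec c ->
    represents x b -> represents y c ->
  branch_meet eps prec b.1 c.1 = meet eps x y.
Proof.
move=> Yx Yy bb bc [th [u [angx b0 bu rx]]] [th' [u' [angy c0 cu ry]]].
apply: sup_halfline; apply/seteqP; split=> h /=.
  exact: (disagree_below Yx Yy bb bc angx angy b0 c0 bu cu rx ry).
move=> hm l l0 gl; apply: (agree_above Yx Yy bb bc angx angy b0 c0 bu cu rx ry l0).
by apply: (lt_le_trans gl); rewrite lee_fin.
Qed.

Lemma branch_distE x y b c : Y eps x -> Y eps y ->
    is_branch eps prec b -> is_branch eps prec c ->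
    represents x b -> represents y c ->
  branch_dist eps prec b c = st (eps_dist eps x y).
Proof.
move=> Yx Yy bb bc xb yc; have e := branch_meetE Yx Yy bb bc xb yc.
rewrite (eps_distE eps_small Yx Yy).2.
have [th [u [_ _ _ ->]]] := xb; have [th' [u' [_ _ _ ->]]] := yc.
have -> : branch_dist eps prec b c = (fine (g b.2) - branch_meet eps prec b.1 c.1) +
    (fine (g c.2) - branch_meet eps prec b.1 c.1) by case: (b) (c) => [? ?] [? ?].
have sum (r r' s : R) : (r - s) + (r' - s) = r + r' - 2 * s by ring.
rewrite e; exact: (sum (fine (g b.2)) (fine (g c.2)) (meet eps x y)).
Qed.

Lemma represented x : Y eps x -> exists2 b, is_branch eps prec b & represents x b.
Proof.
move=> Yx; have [x0 x2 xf] := (YP eps x).1 Yx.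
have [th [u ang]] := angle_exists x2.
(* The branch ends at the order of magnitude of [exp (- x.1)], whose level is the radius of [x]. *)
have z0 := hexp_gt0 (- x.1); pose l1 := magnitude (lt0r_neq0 z0).
have l1z := magnitude_mem (lt0r_neq0 z0); rewrite -/l1 in l1z.
have e : log_height eps (hexp (- x.1)) = eps * x.1.
  by rewrite /log_height (ger0_norm (ltW z0)) hexpK mulrN opprK.
have gl1 : g l1 = (radius eps x)%:E by rewrite (g_finite eps_small prec_wo l1z) e.
have l10 : le_Lambda l1 L0.
  apply/(le_lambda0 l1z); apply: (@hfinite_le _ _ _ 1).
  by rewrite (ger0_norm (ltW z0)) hreal1; apply: hexp_le1; rewrite oppr_le0.
pose f l := if pselect (le_Lambda l1 l /\ le_Lambda l L0) is left _ then
  Some (if pselect (l = L0) is left _ then th else coef prec (a_ l) u) else None.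
have f0 : f L0 = Some th.
  rewrite /f; case: pselect => [_|[]]; last by split; [exact: l10|exact: le_Lambda_refl].
  by case: pselect.
have fl l : le_Lambda l1 l -> lt_Lambda l L0 -> f l = Some (coef prec (a_ l) u).
  move=> l1l l0; rewrite /f; case: pselect => [_|[]]; last first.
    by split; [exact: l1l|exact: lt_Lambda_le].
  by case: pselect => // el; case: (@lt_Lambda_irr _ _ L0); rewrite -{1}el.
exists (f, l1); last first.
  exists th, u; split; [exact: ang|exact: f0|exact: fl|by rewrite gl1].
split.
- exact: l10.
- by rewrite gl1 ltry.
- by move=> l; rewrite /f; case: pselect.
- by move=> t; rewrite f0 => -[<-]; have [] := ang.
exists (coef_support prec u); split.
- exact: (coef_support_wo prec_wo).
- exact: (coef_support_card prec_init).
move=> l t; rewrite /f; case: pselect => [[_ l0]|_ //] + nS.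
case: pselect => [el|nl]; first by case: nS; split; [exact: l0|left].
by move=> [<-]; apply: contrapT => h; apply: nS; split; [exact: l0|right].
Qed.

Lemma branch_realized b : is_branch eps prec b -> exists2 x, Y eps x & represents x b.
Proof.
case: b => f l1 /[dup] bb [l10 gl1 fN f0 [S [S_wo S_card S0]]].
have [th fth] : exists th, f L0 = Some th.
  have : f L0 <> None by apply/fN; split; [exact: l10|exact: le_Lambda_refl].
  by case: (f L0) => // th _; exists th.
pose F l := odflt 0 (f l).
(* The index [lambda0] is removed, its value being the standard angle and not a coefficient of
   [u]. *)
have subS : S `&` [set l | lt_Lambda l L0] `<=` S by move=> l [].
have [||u u_small uF] := expansion_exists prec_init M_saturated
    (rev_well_ordered_sub subS S_wo) (F := F) (card_lt_le (subset_card_le subS) S_card).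
- by move=> l [].
- move=> l l0 nS; rewrite /F; case fl: (f l) => [t|//] /=.
  by apply: (S0 l t fl) => Sl; apply: nS.
have thP := f0 th fth; have [phi phiP ang] := angle_realized thP u_small.
pose t := fine (g l1); have t0 : 0 <= t by apply: fine_ge0; exact: g_ge0.
have tH0 : 0 <= t%:H by rewrite -hreal0 hreal_le.
have et : eps * (t%:H / eps) = t%:H by rewrite mulrC (divfK eps_neq0).
exists (t%:H / eps, phi).
  apply/YP; split; [exact: (divr_ge0 tH0 eps_ge0)|exact: phiP|].
  by rewrite /= et; exact: hfinite_real.
exists th, u; split; [exact: ang|exact: fth| |by rewrite /radius /= et st_real].
move=> l /= l1l l0; rewrite (uF l l0) /F.
have : f l <> None by apply/fN; split; [exact: l1l|exact: lt_Lambda_le].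
by case: (f l).
Qed.

End representation.

Theorem theorem6p2 (R : realType) (M : nonstandard_model R)
    (eps : hyper M) (prec : rel (hyper M)) :
  saturated M ->
  hlt (hreal M 0) eps ->
  infinitesimal eps ->
  initial_well_order prec ->
  isometric (@H0_dist R M eps) (@FM_dist R M eps prec) /\
  R_tree (@H0_dist R M eps).
Proof.
move=> M_sat /hltE eps0 eps_small prec_init; split; last exact: (H0_R_tree eps0 eps_small).
apply: (@correspondence_isometric _ _ _ _ _ _ _ _ (@represents R M eps prec)).
- exact: (rooted_dist_refl (fun x y Yx Yy => (eps_distE eps_small Yx Yy).2)
    (fun x _ => meet_refl eps x)).
- exact: (rooted_dist_sym (fun x y Yx Yy => (eps_distE eps_small Yx Yy).2)
    (fun x y _ _ => meet_sym eps x y)).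
- exact: (rooted_dist_triangle (fun x y Yx Yy => (eps_distE eps_small Yx Yy).2)
    (fun x y _ _ => meet_sym eps x y) (fun x y => meet_bounds eps0 (x := x) (y := y))
    (fun y x z => meet_ultra eps0 eps_small (y := y) (x := x) (z := z))).
- by move=> x y Yx Yy; exact: (approxP eps_small Yx Yy).
- by move=> x; exact: (represented eps_small prec_init).
- by move=> b; exact: (branch_realized eps0 eps_small M_sat prec_init).
- move=> x y b c Yx Yy bb bc; exact: (branch_distE eps0 eps_small prec_init Yx Yy bb bc).
Qed.
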